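(* Let $\underline{\nu}>0$, $\rho>0$, $\nu,\hat\nu\in\mathscr{A}=[\underline{\nu},(1+\rho)\underline{\nu}]$, $\mu>0$, $N\in\mathbb{N}$. Let $f\in H$ (time-independent) satisfy $|f|\le\frac{\nu^2}{2c_L}$, and let $u_*\in D(A)$ be the unique solution of $\nu Au_*+B(u_*,u_* )=f$. Let $u$ be the strong solution of $\partial_tu+\nu Au+B(u,u)=f$, $u(0)=u_0\in V$, and let $v$ be the unique strong solution of $\partial_tv+\hat\nu Av+B(v,v)=f-\mu P_Nv+\mu P_Nu$, $v(0)=v_0\in V$. Suppose that $$\mu\ge\frac{20c_L^2V_1^2}{\underline{\nu}},\qquad N\ge\frac{4\sqrt2\,c_LV_1}{\underline{\nu}}.$$ Let $v_*\in D(A)$ be the unique solution of $\hat\nu Av_*+B(v_*,v_* )+\mu P_Nv_*=f+\mu P_Nu_*$, let $\hat v$ be the solution of $\partial_t\hat v+\hat\nu A\hat v+DB(v)\hat v=-\mu P_N\hat v-Av$, $\hat v(0)=0$, and let $\hat v_*$ be the unique solution of the stationary sensitivity equation $\hat\nu A\hat v_*+\mu P_N\hat v_*+DB(v_* )\hat v_*=-Av_*$. Then there is a constant $C$, independent of $t$, such that $$|\hat v(t)-\hat v_*|^2\le C\,e^{-\underline{\nu}t},\qquad t\ge0.$$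
   Context: Setting: $\mathbb{T}^2=[0,2\pi]^2$ with periodic boundary conditions. $H$ is the space of mean-free, divergence-free vector fields in $L^2(\mathbb{T}^2)$ with inner product $(\cdot,\cdot)$ and norm $|\cdot|$; $V=H^1\cap H$ with norm $\|u\|=|\nabla u|$; $P_\sigma$ is the Leray projection, $A=P_\sigma(-\Delta)=-\Delta$ with domain $D(A)=H^2\cap V$; $B(u,v)=P_\sigma((u\cdot\nabla)v)$; $DB(v)\phi=B(v,\phi)+B(\phi,v)$. $P_N$ is the $L^2$-orthogonal projection onto Fourier wavenumbers $|k|\le N$. $c_L$ is the constant in Ladyzhenskaya's inequality $|\phi|_{L^4}^2\le c_L\|\phi\||\phi|$. $V_1$ is the supremum of $\|v(t)\|$ along the assimilated trajectory over the time interval under consideration, here $V_1=\sup_{t\ge0}\|v(t)\|$. According to the paper, the smallness of $f$ and the conditions on $\mu,N$ guarantee that $u_*$, $v_*$, $\hat v_*$ exist and are unique. *)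

(* Defs.v *)
From HB Require Import structures.
From mathcomp Require Import all_boot all_order all_algebra.
From mathcomp Require Import all_classical all_reals all_analysis.
Set Implicit Arguments.
Unset Strict Implicit.
Unset Printing Implicit Defensive.
Import Order.TTheory GRing.Theory Num.Theory.
Import numFieldNormedType.Exports.

Local Open Scope classical_set_scope.
Local Open Scope ring_scope.

(* Functions and vector fields on the torus [0, 2 pi]^2 are represented by
   functions on the plane of which only the values on the square matter:
   integrals, L^p spaces and equality a.e. are taken with respect to the measure
   [torus] below, so that two representatives that agree a.e. on the square are
   interchangeable.  Periodicity is carried by the test functions, which are the
   doubly periodic Fourier modes. *)
Notation sfield R := (R * R -> R).
Notation vfield R := (R * R -> 'rV[R]_2).

Section Torus.
Context {R : realType}.
Implicit Types (g h : sfield R) (u v w : vfield R) (k : int * int).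

Definition square : set (measurableTypeR R * measurableTypeR R) :=
  `[0, 2 * pi] `*` `[0, 2 * pi].

Lemma measurable_square : measurable square.
Proof. by apply: measurableX; exact: measurable_itv. Qed.

Definition plane_measure :
    set (measurableTypeR R * measurableTypeR R) -> \bar R :=
  (@lebesgue_measure R \x @lebesgue_measure R)%E.
HB.instance Definition _ := Measure.on plane_measure.

Definition torus : set (measurableTypeR R * measurableTypeR R) -> \bar R :=
  mrestr plane_measure measurable_square.
HB.instance Definition _ := Measure.on torus.

Definition component (i : 'I_2) u : sfield R := fun x => u x 0 i.

Definition wave k (j : 'I_2) : R := (if j == 0 then k.1 else k.2)%:~R.

Definition phase k (x : R * R) : R := k.1%:~R * x.1 + k.2%:~R * x.2.

Definition L2 g : Prop := g \in Lfun torus 2%:E.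

Definition sinner g h : R := \int[torus]_x (g x * h x).

(* h is the weak j-th partial derivative of g: the integrals of h * phi and of
   - g * d_j phi agree for phi = cos (k . x) and phi = sin (k . x).  On Fourier
   coefficients this says h_k = i k_j g_k for all k. *)
Definition is_wderiv (j : 'I_2) g h : Prop := forall k,
  sinner h (fun x => cos (phase k x)) =
    wave k j * sinner g (fun x => sin (phase k x)) /\
  sinner h (fun x => sin (phase k x)) =
    - (wave k j * sinner g (fun x => cos (phase k x))).

Definition H1 g : Prop :=
  L2 g /\ forall j, exists h, L2 h /\ is_wderiv j g h.

(* Unique up to a.e. equality; meaningful only when such a derivative exists. *)
Definition wD (j : 'I_2) g : sfield R :=
  xget (fun=> 0) [set h | L2 h /\ is_wderiv j g h].

Definition H2 g : Prop := H1 g /\ forall j, H1 (wD j g).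

Definition L2v u : Prop := forall i, L2 (component i u).

Definition inner u v : R := \sum_(i < 2) sinner (component i u) (component i v).

Definition norm u : R := Num.sqrt (inner u u).

Definition mean_free u : Prop :=
  forall i, \int[torus]_x component i u x = 0.

(* The integral of u . grad phi vanishes for all Fourier modes phi. *)
Definition div_free u : Prop := forall k,
  \sum_(j < 2)
    wave k j * sinner (component j u) (fun x => cos (phase k x)) = 0 /\
  \sum_(j < 2)
    wave k j * sinner (component j u) (fun x => sin (phase k x)) = 0.

Definition Hspace u : Prop := [/\ L2v u, mean_free u & div_free u].

Definition Vspace u : Prop := Hspace u /\ forall i, H1 (component i u).

Definition DA u : Prop := Vspace u /\ forall i, H2 (component i u).

Definition Vnorm u : R := Num.sqrt
  (\sum_(i < 2) \sum_(j < 2)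
     sinner (wD j (component i u)) (wD j (component i u))).

Definition L4norm u : \bar R :=
  'N[torus]_4%:E[EFin \o (fun x => Num.sqrt (\sum_(i < 2) u x 0 i ^+ 2))]%E.

Definition ladyzhenskaya (cL : R) : Prop := forall phi, Vspace phi ->
  (L4norm phi ^+ 2 <= (cL * Vnorm phi * norm phi)%:E)%E.

(* On D(A) the Leray projection commutes with the Laplacian: A = - Delta. *)
Definition stokes u : vfield R :=
  fun x => \row_i - \sum_(j < 2) wD j (wD j (component i u)) x.

(* The graph of the L^2-orthogonal projection onto H. *)
Definition is_leray u w : Prop :=
  [/\ L2v u, Hspace w & forall phi, Hspace phi -> inner w phi = inner u phi].

Definition advect u v : vfield R :=
  fun x => \row_i \sum_(j < 2) u x 0 j * wD j (component i v) x.

(* w = B(u, v) *)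
Definition is_B u v w : Prop := is_leray (advect u v) w.

(* w = DB(v) phi *)
Definition is_DB v (phi : vfield R) w : Prop :=
  exists w1 w2, [/\ is_B v phi w1, is_B phi v w2 & w = w1 + w2].

(* The truncated Fourier series: the sum over |k| <= N of u_k e^{i k . x}, with
   u_k = (2 pi)^-2 * integral of u(y) e^{- i k . y}.  The set of wavenumbers is
   symmetric, so the imaginary parts cancel and cos (k . (x - y)) remains. *)
Definition PN (N : nat) u : vfield R := fun x => \row_i
  \sum_(k \in [set k : int * int | k.1 ^+ 2 + k.2 ^+ 2 <= (N ^ 2)%N%:Z])
     (2 * pi) ^- 2 * sinner (component i u) (fun y => cos (phase k (x - y))).

(* w belongs to L^2(0, T; H) for every T > 0.  As H is separable, weak and
   strong measurability agree. *)
Definition L2loc_H (w : R -> vfield R) : Prop :=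
  [/\ {ae @lebesgue_measure R, forall t : R, 0 <= t -> Hspace (w t)},
      forall phi : vfield R, Hspace phi ->
        measurable_fun (`[0, +oo[ : set R) (fun t : R => inner (w t) phi) &
      forall T : R, 0 < T ->
        (@lebesgue_measure R).-integrable (`[0, T] : set R)
          (fun t : R => (norm (w t) ^+ 2)%:E)].

(* The regularity of a strong solution on [0, +oo[: u is continuous with values
   in V and belongs to L^2(0, T; D(A)), and du = d u / dt belongs to
   L^2(0, T; H), for every T > 0.  The identity u(t) = u(0) + \int_0^t du in H
   is tested against every element of H. *)
Definition strong_path (u du : R -> vfield R) : Prop :=
  [/\ forall t : R, 0 <= t -> Vspace (u t),
      forall t : R, 0 <= t ->
        Vnorm (u s - u t) @[s --> within `[0, +oo[ (nbhs t)] --> (0 : R),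
      {ae @lebesgue_measure R, forall t : R, 0 <= t -> DA (u t)} /\
        L2loc_H (fun t => stokes (u t)),
      L2loc_H du &
      forall (t : R) (phi : vfield R), 0 <= t -> Hspace phi ->
        inner (u t) phi = inner (u 0) phi +
          \int[@lebesgue_measure R]_(s in `[0, t]) inner (du s) phi].

(* d_t u + nu A u + B(u, u) = f,  u(0) = u0 *)
Definition NSE_solution (nu : R) (f u0 : vfield R) (u : R -> vfield R) : Prop :=
  exists du, [/\ strong_path u du,
    {ae @lebesgue_measure R, forall t : R, 0 <= t ->
      exists2 b, is_B (u t) (u t) b &
        du t + nu *: stokes (u t) + b = f %[ae torus]} &
    u 0 = u0 %[ae torus]].

(* d_t v + nuh A v + B(v, v) = f - mu P_N v + mu P_N u,  v(0) = v0 *)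
Definition nudged_solution (nuh mu : R) (N : nat) (f : vfield R)
    (u : R -> vfield R) (v0 : vfield R) (v : R -> vfield R) : Prop :=
  exists dv, [/\ strong_path v dv,
    {ae @lebesgue_measure R, forall t : R, 0 <= t ->
      exists2 b, is_B (v t) (v t) b &
        dv t + nuh *: stokes (v t) + b =
          f - mu *: PN N (v t) + mu *: PN N (u t) %[ae torus]} &
    v 0 = v0 %[ae torus]].

(* d_t vh + nuh A vh + DB(v) vh = - mu P_N vh - A v,  vh(0) = 0 *)
Definition sensitivity_solution (nuh mu : R) (N : nat) (v vh : R -> vfield R)
    : Prop :=
  exists dvh, [/\ strong_path vh dvh,
    {ae @lebesgue_measure R, forall t : R, 0 <= t ->
      exists2 b, is_DB (v t) (vh t) b &
        dvh t + nuh *: stokes (vh t) + b =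
          - (mu *: PN N (vh t)) - stokes (v t) %[ae torus]} &
    vh 0 = 0 %[ae torus]].

(* nu A us + B(us, us) = f *)
Definition steady_NSE (nu : R) (f us : vfield R) : Prop :=
  DA us /\ exists2 b, is_B us us b &
    nu *: stokes us + b = f %[ae torus].

(* nuh A vs + B(vs, vs) + mu P_N vs = f + mu P_N us *)
Definition steady_nudged (nuh mu : R) (N : nat) (f us vs : vfield R) : Prop :=
  DA vs /\ exists2 b, is_B vs vs b &
    nuh *: stokes vs + b + mu *: PN N vs = f + mu *: PN N us %[ae torus].

(* nuh A vhs + mu P_N vhs + DB(vs) vhs = - A vs *)
Definition steady_sensitivity (nuh mu : R) (N : nat) (vs vhs : vfield R)
    : Prop :=
  DA vhs /\ exists2 b, is_DB vs vhs b &
    nuh *: stokes vhs + mu *: PN N vhs + b = - stokes vs %[ae torus].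

End Torus.

(* Main.v *)
(* Testing the equations against V only, the difference of each path with its steady
   state has a norm squared whose derivative, for t > 0, is twice the value of the
   right-hand side on that difference: the right-hand side is continuous in t as an element of the
   dual of V, since the paths are continuous in V.  Write w = u - us, z = v - vs and
   h = vh - vhs.  The smallness of f gives cL ||us|| <= nu / 2, hence
   (|w|^2)' <= - nu ||w||^2.  The lower bounds on mu and N allow the nudging term to absorb
   b(z, v, z) and b(h, v, h), which leaves
     (|z|^2)' <= - (13/8) nu0 ||z||^2 + A |w|^2,
     (|h|^2)' <= - (3/2) nu0 ||h||^2 + B ||z||^2.
   For large M the functional |h|^2 + M |z|^2 thus decays at the rate (3/2) nu0 up to a
   forcing of size exp (- nu0 t).  The form b(u, v, w) = (B(u, v), w), [tri] below, is
   controlled by Hoelder's and Ladyzhenskaya's inequalities, and b(u, w, w) = 0 follows from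
   the case of trigonometric polynomials w; integration by parts, the spectral gap of P_N
   and the uniqueness of weak derivatives come from Parseval's identity, that is, from the
   density of the trigonometric polynomials in L^2. *)
From HB Require Import structures.
Require Import Defs.
From mathcomp Require Import all_boot all_order all_algebra.
From mathcomp Require Import all_classical all_reals all_analysis.
From mathcomp Require Import measurable_realfun ring lra zify.
Set Implicit Arguments.
Unset Strict Implicit.
Unset Printing Implicit Defensive.
Import Order.TTheory GRing.Theory Num.Theory.
Import numFieldNormedType.Exports.
Local Open Scope classical_set_scope.
Local Open Scope ring_scope.

(** The equations determine the time derivative only for almost every t, whereas the decay argument
    wants a differential inequality at every t > 0. The increment |w(s) - psi|^2 - |w(t) - psi|^2
    equals w(s) - w(t) paired with q, the sum of w(s) - psi and w(t) - psi, and q lies in V, so the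
    integrated equation applies to it. But q moves with s: continuity of the right-hand side for
    each fixed test field would not be enough, and this is why the paths in the dual of V are
    continuous in norm. The derivative so obtained is a classical one, and no absolute continuity
    enters. The density of trigonometric polynomials is obtained without a summation kernel.
    Iterating a cubic on a scaled trigonometric polynomial converges to its sign, so the set where
    it is positive has its indicator in the L^2 closure; arcs of the circle are such sets, and they
    generate the Borel sets up to null sets. *)

Lemma torus_fin (R : realType) : fin_num_fun (@torus R).
Proof.
apply: lty_fin_num_fun.
rewrite [X in (X < _)%E](_ : _ = plane_measure (@square R)); last first.
  by rewrite /= /torus /mrestr setTI.
rewrite /plane_measure /square.
rewrite product_measure1E; [|exact: measurable_itv..].
pose m := @lebesgue_measure R (`[0, 2 * pi] : set R).
suff : (m * m < +oo)%E by [].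
rewrite /m lebesgue_measure_itv /=.
by case: ifP => _; rewrite ?mule0 ?mul0e//= -EFinB -EFinM ltry.
Qed.

HB.instance Definition _ (R : realType) :=
  @Measure_isFinite.Build _ _ _ (@torus R) (@torus_fin R).

(** * Square integrable functions on the torus and their inner product *)

Section SquareIntegrable.
Context {R : realType}.
Implicit Types (f g h : sfield R) (a b c M : R).

Notation integ f := ((@torus R).-integrable setT (EFin \o f)).

Lemma L2_measurable f : L2 f -> measurable_fun setT f.
Proof. by rewrite /L2 inE => /andP[+ _]; rewrite inE. Qed.

Lemma L2P f : L2 f <-> measurable_fun setT f /\ integ (fun x => f x ^+ 2).
Proof.
split=> [Hf|[mf If]].
  by split; [exact: L2_measurable|exact: Lfun2_integrable_sqr].
rewrite /L2 inE; apply/andP; split; rewrite inE//=.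
rewrite /finite_norm unlock poweR_lty//.
have /integrableP[_] := If.
congr (_ < _)%E; apply: eq_integral => x _ /=.
by rewrite ger0_norm ?sqr_ge0// powR_mulrn// real_normK ?num_real.
Qed.

Lemma L2_mul_integrable f g : L2 f -> L2 g -> integ (fun x => f x * g x).
Proof.
by move=> Hf Hg; apply/Lfun1_integrable; exact: Lfun2_mul_Lfun1.
Qed.

Lemma L2_scale a f : L2 f -> L2 (fun x => a * f x).
Proof.
move=> /L2P[mf If]; apply/L2P; split; first exact: measurable_funM.
rewrite (_ : _ \o _ = fun x => ((a ^+ 2)%:E * (f x ^+ 2)%:E)%E).
  exact: integrableZl.
by apply/funext => x /=; rewrite exprMn.
Qed.

Lemma L2_add f g : L2 f -> L2 g -> L2 (fun x => f x + g x).
Proof.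
move=> Hf Hg; apply/L2P; split.
  by apply: measurable_funD; exact: L2_measurable.
have -> : EFin \o (fun x => (f x + g x) ^+ 2) = ((EFin \o (fun x => (f x ^+ 2)%R))
    \+ ((fun x => 2%:E * (EFin \o (fun x => (f x * g x)%R)) x)
    \+ (EFin \o (fun x => (g x ^+ 2)%R))))%E.
  by apply/funext => x /=; rewrite -EFinM -!EFinD; congr (_%:E); ring.
apply: integrableD => //; last apply: integrableD => //.
- by have /L2P[] := Hf.
- by apply: integrableZl => //; exact: L2_mul_integrable.
- by have /L2P[] := Hg.
Qed.

Lemma L2_opp f : L2 f -> L2 (fun x => - f x).
Proof.
by move/(L2_scale (-1)); congr L2; apply/funext => x; rewrite mulN1r.
Qed.

Lemma L2_sub f g : L2 f -> L2 g -> L2 (fun x => f x - g x).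
Proof. by move=> Hf Hg; apply: L2_add => //; exact: L2_opp. Qed.

Lemma L2_bounded f M : measurable_fun setT f -> (forall x, `|f x| <= M) -> L2 f.
Proof.
move=> mf fM; apply/L2P; split => //.
apply: (@le_integrable _ _ _ (@torus R) _ measurableT _ (cst (M ^+ 2)%:E)) => //.
- by apply/measurable_EFinP; exact: measurable_funX.
- move=> x _ /=; rewrite lee_fin !ger0_norm ?sqr_ge0//.
  by rewrite -real_normK ?num_real// ler_sqr ?nnegrE// (le_trans _ (fM x)).
- exact: finite_measure_integrable_cst.
Qed.

Lemma L2_cst c : L2 (cst c).
Proof. by apply: (@L2_bounded _ `|c|). Qed.

Lemma L2_sum (I : Type) (r : seq I) (P : pred I) (F : I -> sfield R) :
  (forall i, P i -> L2 (F i)) -> L2 (fun x => \sum_(i <- r | P i) F i x).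
Proof.
move=> HF; elim: r => [|i r IH].
  by rewrite (_ : (fun x => _) = cst 0); [exact: L2_cst|
     apply/funext => x; rewrite big_nil].
rewrite (_ : (fun x => _) = fun x => (if P i then F i x else 0) +
    \sum_(j <- r | P j) F j x); last first.
  by apply/funext => x; rewrite big_cons; case: ifP => //; rewrite add0r.
case: (boolP (P i)) => [Pi|_]; first by apply: L2_add => //; exact: HF.
by apply: L2_add => //; exact: (L2_cst 0).
Qed.

Lemma L2_mul_bounded f g M : L2 f -> measurable_fun setT g ->
  (forall x, `|g x| <= M) -> L2 (fun x => f x * g x).
Proof.
move=> /L2P[mf If] mg gM; apply/L2P; split; first exact: measurable_funM.
apply: (@le_integrable _ _ _ (@torus R) _ measurableT _
  (fun x => (M ^+ 2)%:E * (f x ^+ 2)%:E)%E) => //.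
- by apply/measurable_EFinP; apply: measurable_funX; exact: measurable_funM.
- move=> x _ /=; rewrite lee_fin (ger0_norm (sqr_ge0 _)) ger0_norm; last first.
    by rewrite mulr_ge0 ?sqr_ge0.
  rewrite exprMn mulrC ler_wpM2r ?sqr_ge0//.
  by rewrite -real_normK ?num_real// ler_sqr ?nnegrE// (le_trans _ (gM x)).
- exact: (integrableZl measurableT (M ^+ 2) If).
Qed.

Lemma sinnerC f g : sinner f g = sinner g f.
Proof. by apply: eq_Rintegral => x _; rewrite mulrC. Qed.

Lemma sinnerDl f g h : L2 f -> L2 g -> L2 h ->
  sinner (fun x => f x + g x) h = sinner f h + sinner g h.
Proof.
move=> Hf Hg Hh; rewrite -RintegralD//; [|exact: L2_mul_integrable..].
by apply: eq_Rintegral => x _; rewrite mulrDl.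
Qed.

Lemma sinnerZl a f h : L2 f -> L2 h ->
  sinner (fun x => a * f x) h = a * sinner f h.
Proof.
move=> Hf Hh; rewrite -RintegralZl//; last exact: L2_mul_integrable.
by apply: eq_Rintegral => x _; rewrite mulrA.
Qed.

Lemma sinnerNl f h : L2 f -> L2 h -> sinner (fun x => - f x) h = - sinner f h.
Proof.
move=> Hf Hh; rewrite -mulN1r -sinnerZl//.
by congr sinner; apply/funext => x; rewrite mulN1r.
Qed.

Lemma sinnerBl f g h : L2 f -> L2 g -> L2 h ->
  sinner (fun x => f x - g x) h = sinner f h - sinner g h.
Proof. by move=> *; rewrite sinnerDl// ?sinnerNl//; exact: L2_opp. Qed.

Lemma sinner0l f : sinner (cst 0) f = 0.
Proof.
rewrite /sinner (_ : (fun x => _) = cst 0); last first.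
  by apply/funext => x /=; rewrite mul0r.
by rewrite /Rintegral (_ : (fun x => _) = cst 0%E)// integral0.
Qed.

Lemma sinner_suml (I : Type) (r : seq I) (P : pred I) (F : I -> sfield R) h :
  (forall i, P i -> L2 (F i)) -> L2 h ->
  sinner (fun x => \sum_(i <- r | P i) F i x) h =
    \sum_(i <- r | P i) sinner (F i) h.
Proof.
move=> HF Hh; elim: r => [|i r IH].
  rewrite big_nil -[RHS](sinner0l h); congr sinner.
  by apply/funext => x; rewrite big_nil.
rewrite big_cons -IH; case: (boolP (P i)) => [Pi|/negPf Pi].
  rewrite -sinnerDl//; [|exact: HF|exact: L2_sum].
  by congr sinner; apply/funext => x; rewrite big_cons Pi.
by congr sinner; apply/funext => x; rewrite big_cons Pi.
Qed.

Lemma sinnerDr f g h : L2 f -> L2 g -> L2 h ->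
  sinner h (fun x => f x + g x) = sinner h f + sinner h g.
Proof. by move=> *; rewrite sinnerC sinnerDl// !(sinnerC h). Qed.

Lemma sinnerBr f g h : L2 f -> L2 g -> L2 h ->
  sinner h (fun x => f x - g x) = sinner h f - sinner h g.
Proof. by move=> *; rewrite sinnerC sinnerBl// !(sinnerC h). Qed.

Lemma sinnerZr a f h : L2 f -> L2 h ->
  sinner h (fun x => a * f x) = a * sinner h f.
Proof. by move=> *; rewrite sinnerC sinnerZl// !(sinnerC h). Qed.

Lemma sinner_ge0 f : 0 <= sinner f f.
Proof. by apply: Rintegral_ge0 => x _; rewrite -expr2 sqr_ge0. Qed.

(** Cauchy-Schwarz for any semidefinite form: it serves [sinner], finite sums of such products, and
    the degenerate form [pn]. At (c, -b) the form equals c (a c - b^2). *)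
Lemma form_CS a b c : (forall s t, 0 <= s ^+ 2 * a + 2 * s * t * b + t ^+ 2 * c) ->
  b ^+ 2 <= a * c.
Proof.
move=> H; have a0 : 0 <= a by have := H 1 0; rewrite expr1n expr0n /=; lra.
have c0 : 0 <= c by have := H 0 1; rewrite expr1n expr0n /=; lra.
have [c00|c00] := eqVneq c 0.
  rewrite c00 mulr0; have [->|n0] := eqVneq b 0; first by rewrite expr0n.
  (* With c = 0 the form is affine in t; at this point it equals - a - 2, which is negative. *)
  have := H 1 (- (a + 1) / b).
  rewrite c00 mulr0 addr0 -[X in _ + X]mulrA divfK//; lra.
have cp : 0 < c by rewrite lt_def c00.
have {}H := H c (- b); rewrite -subr_ge0 -(pmulr_rge0 _ cp); move: H.
by congr (_ <= _); ring.
Qed.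

Lemma sinner_CS f g : L2 f -> L2 g ->
  sinner f g ^+ 2 <= sinner f f * sinner g g.
Proof.
move=> Lf Lg; apply: form_CS => s t; have Ls := L2_scale s Lf; have Lt := L2_scale t Lg.
have := sinner_ge0 (fun x => s * f x + t * g x).
rewrite (sinnerDl Ls Lt (L2_add Ls Lt)) (sinnerDr Ls Lt Ls) (sinnerDr Ls Lt Lt).
rewrite !(sinnerZl _ Lf)// !(sinnerZl _ Lg)// !(sinnerZr _ Lf)// !(sinnerZr _ Lg)//.
by rewrite (sinnerC g f); lra.
Qed.

Lemma torus_aeS2 (P Q S : set (measurableTypeR R * measurableTypeR R)) :
  (forall x, P x -> Q x -> S x) -> {ae @torus R, forall x, P x} ->
  {ae @torus R, forall x, Q x} -> {ae @torus R, forall x, S x}.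
Proof. exact: (@filterS2 _ _ (ae_filter_ringOfSetsType (@torus R))). Qed.

Lemma eq_sinner f f' g g' : L2 f -> L2 f' -> L2 g -> L2 g' ->
  f = f' %[ae @torus R] -> g = g' %[ae @torus R] -> sinner f g = sinner f' g'.
Proof.
move=> Lf Lf' Lg Lg' ff gg; congr fine; apply: ae_eq_integral => //.
- by apply/measurable_EFinP/measurable_funM; exact: L2_measurable.
- by apply/measurable_EFinP/measurable_funM; exact: L2_measurable.
- by apply: (torus_aeS2 _ ff gg) => x /(_ I) + /(_ I) + _ /= => -> ->.
Qed.

Lemma sinner_eq0_ae f : L2 f -> sinner f f = 0 -> f = cst 0 %[ae @torus R].
Proof.
move=> Lf; rewrite /sinner /Rintegral => /eqP.
have If : (\int[@torus R]_x (f x * f x)%:E \is a fin_num)%E.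
  by apply: integrable_fin_num => //; exact: L2_mul_integrable.
rewrite fine_eq0// => /eqP I0.
have mf : measurable_fun setT (EFin \o (fun x => f x * f x)).
  by apply/measurable_EFinP/measurable_funM; exact: L2_measurable.
have : (\int[@torus R]_x `|(f x * f x)%:E| = 0)%E.
  rewrite -[RHS]I0; apply: eq_integral => x _.
  by rewrite gee0_abs// lee_fin -expr2 sqr_ge0.
move/(ae_eq_integral_abs (@torus R) measurableT mf).
apply: filterS => x /(_ I)/= [] /eqP + _.
by rewrite -expr2 sqrf_eq0 => /eqP.
Qed.

End SquareIntegrable.

(** * Real Fourier modes and their integrals over one period *)

Section FourierModes.
Context {R : realType}.
Implicit Types (f g h : sfield R) (k l : int * int) (a b c : R).

Definition cosw k : sfield R := fun x => cos (phase k x).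

Definition sinw k : sfield R := fun x => sin (phase k x).

Lemma phaseD k l (x : R * R) : phase (k + l) x = phase k x + phase l x.
Proof. by rewrite /phase /= !intrD; ring. Qed.

Lemma phaseN k (x : R * R) : phase (- k) x = - phase k x.
Proof. by rewrite /phase /= !intrN; ring. Qed.

Lemma phaseB k (x y : R * R) : phase k (x - y) = phase k x - phase k y.
Proof. by rewrite /phase /=; ring. Qed.

Lemma coswN k : cosw (- k) = cosw k.
Proof. by apply/funext => x; rewrite /cosw phaseN cosN. Qed.

Lemma sinwN k : sinw (- k) = fun x => - sinw k x.
Proof. by apply/funext => x; rewrite /sinw phaseN sinN. Qed.

Lemma measurable_phase k : measurable_fun setT (phase k : sfield R).
Proof.
by apply: measurable_funD; apply: measurable_funM.
Qed.

Lemma measurable_cosw k : measurable_fun setT (cosw k).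
Proof.
apply: (measurableT_comp _ (measurable_phase k)).
by apply: continuous_measurable_fun; exact: continuous_cos.
Qed.

Lemma measurable_sinw k : measurable_fun setT (sinw k).
Proof.
apply: (measurableT_comp _ (measurable_phase k)).
by apply: continuous_measurable_fun; exact: continuous_sin.
Qed.

Lemma L2_cosw k : L2 (cosw k).
Proof.
by apply: (@L2_bounded _ _ 1) => [|x]; [exact: measurable_cosw|exact: cos_max].
Qed.

Lemma L2_sinw k : L2 (sinw k).
Proof.
by apply: (@L2_bounded _ _ 1) => [|x]; [exact: measurable_sinw|exact: sin_max].
Qed.

Lemma cos_period (n : int) c : cos (n%:~R * (2 * pi) + c) = cos c.
Proof.
have P (m : nat) d : cos (m%:R * (2 * pi) + d) = cos d :> R.
  rewrite -[RHS](periodicn (@cosD2pi R) m); congr cos.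
  by rewrite -[pi *+ 2 *+ m]mulr_natr; ring.
case: n => n; first by rewrite -pmulrn P.
rewrite NegzE intrN -(P n.+1); congr cos.
by rewrite -pmulrn; ring.
Qed.

Lemma integral_cos_period (n : int) c : n != 0 ->
  (\int[@lebesgue_measure R]_(y in `[0%R, (2 * pi)%R]) (cos (n%:~R * y + c))%:E
    = 0)%E.
Proof.
move=> n0; have N0 : n%:~R != 0 :> R by rewrite intr_eq0.
(* This is sin (n y + c) / n, written as a shifted cosine. *)
pose F (y : R) : R := n%:~R^-1 * cos (n%:~R * y + (c - pi / 2)).
have dF (y : R) : is_derive y 1 F (cos (n%:~R * y + c)).
  have -> : cos (n%:~R * y + c) =
      n%:~R^-1 * (- sin (n%:~R * y + (c - pi / 2)) * n%:~R).
    rewrite addrA sinBpihalf opprK mulrCA [X in _ = _ * X]mulVf// mulr1//.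
  apply: is_deriveZ.
  apply: is_derive1_comp.
  rewrite -[X in is_derive _ _ _ X]addr0; apply: is_deriveD.
  by rewrite -[X in is_derive _ _ _ X]mulr1; apply: is_deriveZ.
rewrite (@continuous_FTC2 _ _ F); first last.
- by move=> y _; rewrite derive1E; exact: derive_val.
- have cF : continuous F.
    by move=> y; apply: differentiable_continuous; apply/derivable1_diffP.
  split=> [y _||]; first exact: ex_derive.
  + by apply: cvg_at_right_filter; exact: cF.
  + by apply: cvg_at_left_filter; exact: cF.
- apply: continuous_subspaceT => y; apply: continuous_comp.
    by apply: cvgD; [apply: cvgM; [exact: cvg_cst|exact: cvg_id]|exact: cvg_cst].
  exact: continuous_cos.
- by rewrite mulr_gt0// pi_gt0.
by rewrite /F mulr0 add0r cos_period -EFinB subrr.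
Qed.

End FourierModes.

(** * Integration over the square by Fubini, and orthogonality of the modes *)

Section TorusIntegral.
Context {R : realType}.
Implicit Types (f : sfield R) (k l : int * int) (c M : R).

Lemma plane_square : @plane_measure R (@square R) = ((2 * pi) ^+ 2)%:E.
Proof.
rewrite /plane_measure /square.
rewrite product_measure1E; [|exact: measurable_itv..].
pose m := @lebesgue_measure R (`[0, 2 * pi] : set R).
suff : (m * m = ((2 * pi) ^+ 2)%:E)%E by [].
by rewrite /m lebesgue_measure_itv /= lte_fin mulr_gt0 ?pi_gt0// -EFinB subr0.
Qed.

Lemma integrable_square f M : measurable_fun setT f -> (forall x, `|f x| <= M) ->
  (@plane_measure R).-integrable setT ((EFin \o f) \_ (@square R)).
Proof.
move=> mf fM; have mS := @measurable_square R.
apply/integrable_restrict; rewrite ?setTI//.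
apply: measurable_bounded_integrable => //.
- by have := plane_square; rewrite /= => ->; rewrite ltry.
- exact: measurable_funS mf.
- by exists M; split; [exact: num_real|move=> y /ltW My x _; exact: le_trans My].
Qed.

(** Fubini speaks of the product measure on the plane, while [torus] is its restriction to the
    square: the restriction is moved from the measure to the integrand. *)
Lemma integral_torus f M : measurable_fun setT f -> (forall x, `|f x| <= M) ->
  (\int[@torus R]_x (f x)%:E =
   \int[@plane_measure R]_x ((EFin \o f) \_ (@square R)) x)%E.
Proof.
move=> mf fM; rewrite -integral_mkcond.
have mS := @measurable_square R.
rewrite (@negligible_integral _ _ _ (@torus R) setT (~` (@square R))
  (EFin \o f)).
- rewrite setDE setCK setTI; apply: eq_measure_integral => A mA AS.
  transitivity (@plane_measure R (A `&` @square R)) => //.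
  by rewrite (setIidl AS).
- exact: measurableC.
- by [].
- apply: (@le_integrable _ _ _ (@torus R) _ measurableT _ (cst M%:E)) => //.
  + exact/measurable_EFinP.
  + by move=> x _ /=; rewrite lee_fin (le_trans (fM x))// ler_norm.
  + exact: finite_measure_integrable_cst.
- transitivity (@plane_measure R (~` @square R `&` @square R)) => //.
  by rewrite setICl measure0.
Qed.

(** The shift [c] treats sines and cosines together, and it absorbs the coordinate that is frozen in
    the inner integral. *)
Lemma mean_cosD k c : k != 0 ->
  \int[@torus R]_x cos (phase k x + c) = 0.
Proof.
move=> k0; rewrite /Rintegral.
have mf : measurable_fun setT ((fun x => cos (phase k x + c)) : sfield R).
  apply: (@measurableT_comp _ _ _ _ _ _ (@cos R)).
    by apply: continuous_measurable_fun; exact: continuous_cos.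
  by apply: measurable_funD => //; exact: measurable_phase.
have bf (x : R * R) : `|cos (phase k x + c)| <= 1 by exact: cos_max.
rewrite (integral_torus mf bf).
have Ifs := integrable_square mf bf.
have E (x y : R) : ((EFin \o (fun z => cos (phase k z + c))) \_ (@square R)) (x, y) =
  if (x \in `[0, 2 * pi]) && (y \in `[0, 2 * pi]) then (cos (phase k (x, y) + c))%:E
  else 0%E.
  rewrite patchE; congr (if _ then _ else _).
  by apply/idP/andP; rewrite inE.
(* The inner integral runs over a coordinate whose wavenumber is nonzero, so that it already
   vanishes. *)
have [k20|k20] := eqVneq k.2 0; last first.
  rewrite -integral12_prod_meas1//.
  rewrite (_ : fubini_F _ _ = cst 0%E) ?integral0//.
  apply/funext => x /=; rewrite /fubini_F.
  under eq_integral do rewrite E.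
  have [xI|xI] /= := boolP (x \in `[0, 2 * pi]); last by rewrite integral0.
  rewrite -[RHS](@integral_cos_period _ k.2 (k.1%:~R * x + c))// [RHS]integral_mkcond.
  apply: eq_integral => y _; rewrite patchE mem_setE; case: ifP => // _.
  by rewrite /phase /= addrCA addrA.
have k10 : k.1 != 0.
  by apply: contra k0 => /eqP k10; rewrite -pair_eqE /pair_eq k10 k20.
rewrite -integral21_prod_meas1//.
rewrite (_ : fubini_G _ _ = cst 0%E) ?integral0//.
apply/funext => y /=; rewrite /fubini_G.
under eq_integral do rewrite E.
have [yI|yI] /= := boolP (y \in `[0, 2 * pi]); last first.
  by under eq_integral do rewrite andbF; rewrite integral0.
rewrite -[RHS](@integral_cos_period _ k.1 (k.2%:~R * y + c))// [RHS]integral_mkcond.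
apply: eq_integral => x _; rewrite patchE mem_setE andbT; case: ifP => // _.
by rewrite /phase /= addrA.
Qed.

Lemma mean_cosw k : \int[@torus R]_x cosw k x = (2 * pi) ^+ 2 * (k == 0)%:R.
Proof.
have [->|k0] := eqVneq k 0.
  rewrite mulr1 /Rintegral.
  under eq_integral do rewrite /cosw /phase !mul0r addr0 cos0.
  rewrite integral_cst// mul1e.
  transitivity (fine (@plane_measure R (setT `&` @square R))) => //.
  have ps := plane_square; rewrite /= in ps.
  by rewrite setTI ps.
rewrite mulr0 -[RHS](mean_cosD 0 k0); apply: eq_Rintegral => x _.
by rewrite addr0.
Qed.

Lemma mean_sinw k : \int[@torus R]_x sinw k x = 0.
Proof.
have [->|k0] := eqVneq k 0.
  rewrite /Rintegral; under eq_integral do rewrite /sinw /phase !mul0r addr0 sin0.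
  by rewrite integral0.
rewrite -[RHS](mean_cosD (- (pi / 2)) k0); apply: eq_Rintegral => x _.
by rewrite cosBpihalf.
Qed.

(** k and -k name the same cosine, so both coincidences count; for k = l = 0 they count together and
    give the whole area. *)
Lemma sinner_cos_cos k l : sinner (cosw k) (cosw l) =
  (2 * pi) ^+ 2 / 2 * ((k + l == 0)%:R + (k - l == 0)%:R) :> R.
Proof.
have -> : sinner (cosw k) (cosw l) =
    sinner (fun x => 2^-1 * (cosw (k + l) x + cosw (k - l) x)) (cst (1 : R)).
  apply: eq_Rintegral => x _; rewrite /cosw !phaseD phaseN cosB cosD /=; lra.
have L0 := L2_cst (1 : R); have La := L2_cosw (k + l); have Lb := L2_cosw (k - l).
rewrite sinnerZl ?sinnerDl//; last exact: L2_add.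
have S m : sinner (cosw m) (cst 1) = \int[@torus R]_x cosw m x.
  by apply: eq_Rintegral => x _; rewrite mulr1.
by rewrite !S !mean_cosw; lra.
Qed.

Lemma sinner_sin_sin k l : sinner (sinw k) (sinw l) =
  (2 * pi) ^+ 2 / 2 * ((k - l == 0)%:R - (k + l == 0)%:R) :> R.
Proof.
have -> : sinner (sinw k) (sinw l) =
    sinner (fun x => 2^-1 * (cosw (k - l) x - cosw (k + l) x)) (cst (1 : R)).
  apply: eq_Rintegral => x _; rewrite /sinw /cosw !phaseD phaseN cosB cosD /=; lra.
have L0 := L2_cst (1 : R); have La := L2_cosw (k + l); have Lb := L2_cosw (k - l).
rewrite sinnerZl ?sinnerBl//; last exact: L2_sub.
have S m : sinner (cosw m) (cst 1) = \int[@torus R]_x cosw m x.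
  by apply: eq_Rintegral => x _; rewrite mulr1.
by rewrite !S !mean_cosw; lra.
Qed.

Lemma sinner_sin_cos k l : sinner (sinw k) (cosw l) = 0 :> R.
Proof.
have -> : sinner (sinw k) (cosw l) =
    sinner (fun x => 2^-1 * (sinw (k + l) x + sinw (k - l) x)) (cst (1 : R)).
  apply: eq_Rintegral => x _.
  by rewrite /sinw /cosw !phaseD phaseN [sin (phase k x - _)]sinB sinD /=; lra.
have L0 := L2_cst (1 : R); have La := L2_sinw (k + l); have Lb := L2_sinw (k - l).
rewrite sinnerZl ?sinnerDl//; last exact: L2_add.
have S m : sinner (sinw m) (cst 1) = \int[@torus R]_x sinw m x.
  by apply: eq_Rintegral => x _; rewrite mulr1.
by rewrite !S !mean_sinw; lra.
Qed.

End TorusIntegral.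

(* The list of triples (k, (a, b)) stands for the sum of the
   a cos (k . x) + b sin (k . x). *)
Definition tpoly (R : realType) : Type := seq ((int * int) * (R * R)).

(** * The algebra of trigonometric polynomials, with symbolic derivative and product *)

Section TrigonometricPolynomials.
Context {R : realType}.
Implicit Types (f g h : sfield R) (k l : int * int) (j : 'I_2)
  (s t : tpoly R) (m : (int * int) * (R * R)).

Definition tterm m : sfield R := fun x => m.2.1 * cosw m.1 x + m.2.2 * sinw m.1 x.

Definition teval s : sfield R := fun x => \sum_(m <- s) tterm m x.

Definition tderiv j s : tpoly R :=
  [seq (m.1, (wave m.1 j * m.2.2, - (wave m.1 j * m.2.1))) | m <- s].

(** The product-to-sum formulas: two modes multiply into modes at the sum and at the difference of
    their wavenumbers. *)
Definition tmul1 m m' : tpoly R :=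
  [:: (m.1 + m'.1, ((m.2.1 * m'.2.1 - m.2.2 * m'.2.2) / 2,
                    (m.2.1 * m'.2.2 + m.2.2 * m'.2.1) / 2));
      (m.1 - m'.1, ((m.2.1 * m'.2.1 + m.2.2 * m'.2.2) / 2,
                    (m.2.2 * m'.2.1 - m.2.1 * m'.2.2) / 2))].

Definition tmul s t : tpoly R := flatten [seq tmul1 m m' | m <- s, m' <- t].

Lemma teval_cat s t x : teval (s ++ t) x = teval s x + teval t x.
Proof. by rewrite /teval big_cat. Qed.

Lemma teval_mul s t x : teval (tmul s t) x = teval s x * teval t x.
Proof.
rewrite /teval /tmul big_flatten /= big_allpairs_dep /= mulr_suml.
apply: eq_bigr => m _; rewrite mulr_sumr; apply: eq_bigr => m' _.
rewrite /tmul1 !big_cons big_nil /tterm /cosw /sinw /= !phaseD !phaseN.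
rewrite cosD sinD cosB sinB; lra.
Qed.

Lemma waveD k l j : wave (k + l) j = wave k j + wave l j :> R.
Proof. by rewrite /wave; case: ifP => _; rewrite /= intrD. Qed.

Lemma waveN k j : wave (- k) j = - wave k j :> R.
Proof. by rewrite /wave; case: ifP => _; rewrite /= intrN. Qed.

Lemma teval_deriv_mul j s t x : teval (tderiv j (tmul s t)) x =
  teval (tderiv j s) x * teval t x + teval s x * teval (tderiv j t) x.
Proof.
rewrite /teval /tderiv !big_map /tmul big_flatten /= big_allpairs_dep /=.
rewrite !mulr_suml -big_split /=.
apply: eq_bigr => m _; rewrite !mulr_sumr -big_split /=; apply: eq_bigr => m' _.
rewrite /tmul1 !big_cons big_nil /tterm /cosw /sinw /= !waveD !waveN !phaseD !phaseN.
rewrite cosD sinD cosB sinB; lra.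
Qed.

Lemma L2_tterm m : L2 (tterm m).
Proof.
by apply: L2_add; apply: L2_scale; [exact: L2_cosw|exact: L2_sinw].
Qed.

Lemma L2_teval s : L2 (teval s).
Proof. by apply: L2_sum => m _; exact: L2_tterm. Qed.

Lemma measurable_teval s : measurable_fun setT (teval s).
Proof. exact: L2_measurable (L2_teval s). Qed.

Lemma teval_bounded s : exists M, forall x, `|teval s x| <= M.
Proof.
exists (\sum_(m <- s) (`|m.2.1| + `|m.2.2|)) => x.
apply: (le_trans (ler_norm_sum _ _ _)); apply: ler_sum => m _.
apply: (le_trans (ler_normD _ _)); rewrite !normrM lerD// ler_piMr//.
  exact: cos_max.
exact: sin_max.
Qed.

Lemma sinner_teval s h : L2 h -> sinner (teval s) h =
  \sum_(m <- s) (m.2.1 * sinner h (cosw m.1) + m.2.2 * sinner h (sinw m.1)).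
Proof.
move=> Lh; rewrite sinner_suml//; last by move=> m _; exact: L2_tterm.
apply: eq_bigr => m _.
have Lc := L2_cosw (R := R) m.1; have Ls := L2_sinw (R := R) m.1.
by rewrite sinnerDl ?sinnerZl ?(sinnerC h)//; exact: L2_scale.
Qed.

End TrigonometricPolynomials.

(** * Truncated Fourier series: Bessel's inequality and best approximation *)

Section FourierProjection.
Context {R : realType}.
Implicit Types (f g h : sfield R) (k l : int * int) (n : nat).

Definition ball_waves n : set (int * int) :=
  [set k | k.1 ^+ 2 + k.2 ^+ 2 <= (n ^ 2)%N%:Z].

Lemma finite_ball_waves n : finite_set (ball_waves n).
Proof.
pose I := (fun m : nat => m%:Z - n%:Z) @` `I_(2 * n).+1.
apply: (@sub_finite_set _ _ (I `*` I)); last first.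
  by apply: finite_setX; apply: finite_image; exact: finite_II.
have H (z : int) : z ^+ 2 <= (n ^ 2)%N%:Z -> I z.
  move=> zn; have {}zn : `|z| <= n%:Z.
    rewrite -(@ler_pXn2r _ 2)// ?nnegrE//.
    by rewrite real_normK ?num_real// -natrX -[X in _ <= X]natz natrX natz in zn *.
  have [lo hi] : - n%:Z <= z /\ z <= n%:Z by apply/andP; rewrite -ler_norml.
  exists (absz (z + n%:Z)) => /=; lia.
move=> k; rewrite /ball_waves /= => kn; have k1 := sqr_ge0 k.1; have k2 := sqr_ge0 k.2.
by split; apply: H; lia.
Qed.

Definition waves n : seq (int * int) :=
  finmap.enum_fset (fset_set (ball_waves n)).

Lemma mem_waves n k : (k \in waves n) = (k.1 ^+ 2 + k.2 ^+ 2 <= (n ^ 2)%N%:Z).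
Proof.
rewrite [LHS]in_fset_set; last exact: finite_ball_waves.
by apply/idP/idP; rewrite inE.
Qed.

Lemma waves_uniq n : uniq (waves n).
Proof. exact: finmap.fset_uniq. Qed.

Lemma waves_opp n k : (- k \in waves n) = (k \in waves n).
Proof. by rewrite !mem_waves /= !sqrrN. Qed.

(** The factor is the same for all k, zero included, because each nonzero mode is listed twice,
    under k and under -k. *)
Definition proj n g : tpoly R :=
  [seq (k, ((2 * pi) ^- 2 * sinner g (cosw k), (2 * pi) ^- 2 * sinner g (sinw k)))
     | k <- waves n].

(* The partial sum of the Parseval series of the inner product of g and h. *)
Definition specsum n g h : R := (2 * pi) ^- 2 * \sum_(k <- waves n)
  (sinner g (cosw k) * sinner h (cosw k) + sinner g (sinw k) * sinner h (sinw k)).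

Lemma sinner_proj n g h : L2 h -> sinner (teval (proj n g)) h = specsum n g h.
Proof.
move=> Lh; rewrite sinner_teval// big_map /specsum mulr_sumr.
by apply: eq_bigr => k _ /=; ring.
Qed.

Lemma specsumC n g h : specsum n g h = specsum n h g.
Proof.
by congr (_ * _); apply: eq_bigr => k _; congr (_ + _); rewrite mulrC.
Qed.

Lemma specsum_ge0 n g : 0 <= specsum n g g.
Proof.
apply: mulr_ge0; first by rewrite invr_ge0 sqr_ge0.
by apply: sumr_ge0 => k _; rewrite addr_ge0// -expr2 sqr_ge0.
Qed.

Lemma sum_indicator (T : eqType) (r : seq T) (F : T -> R) (l : T) : uniq r ->
  \sum_(k <- r) F k * (k == l)%:R = if l \in r then F l else 0.
Proof.
move=> ur; case: ifPn => lr.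
  rewrite (bigD1_seq l)//= eqxx mulr1 big1 ?addr0// => k /negPf ->.
  by rewrite mulr0.
rewrite big_seq big1// => k kr; have /negPf -> : k != l.
  by apply: contraNneq lr => <-.
by rewrite mulr0.
Qed.

Lemma sqr_2pi_ne0 : (2 * pi) ^+ 2 != 0 :> R.
Proof. by rewrite expf_neq0// mulf_neq0// gt_eqF// pi_gt0. Qed.

(** [waves n] is symmetric, and the entries at l and -l contribute one half of the coefficient
    each. *)
Lemma proj_cosw n g l : L2 g -> sinner (teval (proj n g)) (cosw l) =
  if l \in waves n then sinner g (cosw l) else 0.
Proof.
move=> Lg; rewrite (sinner_proj _ _ (L2_cosw l)) /specsum.
have : (2 * pi) ^+ 2 != 0 :> R by exact: sqr_2pi_ne0.
set K := (2 * pi) ^+ 2 => K0.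
rewrite (eq_bigr (fun k => K / 2 * (sinner g (cosw k) * (k == - l)%:R +
    sinner g (cosw k) * (k == l)%:R))) => [|k _]; last first.
  rewrite (sinnerC (cosw l)) (sinnerC (cosw l) (sinw k)) sinner_cos_cos.
  rewrite sinner_sin_cos subr_eq0 addr_eq0 -/K; ring.
rewrite -mulr_sumr big_split /= !sum_indicator ?waves_uniq// waves_opp coswN.
by case: ifP => _; [field|rewrite addr0 !mulr0].
Qed.

Lemma proj_sinw n g l : L2 g -> sinner (teval (proj n g)) (sinw l) =
  if l \in waves n then sinner g (sinw l) else 0.
Proof.
have Ls := L2_sinw (R := R) l.
move=> Lg; rewrite (sinner_proj _ _ Ls) /specsum.
have : (2 * pi) ^+ 2 != 0 :> R by exact: sqr_2pi_ne0.
set K := (2 * pi) ^+ 2 => K0.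
rewrite (eq_bigr (fun k => K / 2 * (sinner g (sinw k) * (k == l)%:R -
    sinner g (sinw k) * (k == - l)%:R))) => [|k _]; last first.
  rewrite (sinnerC (sinw l)) (sinnerC (sinw l) (sinw k)) sinner_sin_sin.
  rewrite (sinnerC _ (sinw l)) sinner_sin_cos subr_eq0 addr_eq0 -/K; ring.
rewrite -mulr_sumr sumrB !sum_indicator ?waves_uniq// waves_opp sinwN.
case: ifP => _; last by rewrite subr0 !mulr0.
rewrite (sinnerC g (fun _ => - _)) sinnerNl// (sinnerC _ g).
by field.
Qed.

Lemma proj_residual_orthogonal n g (s : tpoly R) : L2 g ->
  all (fun m => m.1 \in waves n) s ->
  sinner (teval s) (fun x => g x - teval (proj n g) x) = 0.
Proof.
move=> Lg /allP sn; have LP := L2_teval (proj n g).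
rewrite sinner_teval; last exact: L2_sub.
rewrite big_seq big1// => m /sn mn.
have Lc := L2_cosw (R := R) m.1; have Ls := L2_sinw (R := R) m.1.
by rewrite !(sinnerBl Lg LP)// proj_cosw// proj_sinw// mn !subrr !mulr0 addr0.
Qed.

Lemma proj_modes n g : all (fun m => m.1 \in waves n) (proj n g).
Proof. by apply/allP => _ /mapP[k kn ->]. Qed.

Lemma proj_residual n g : L2 g ->
  sinner (fun x => g x - teval (proj n g) x) (fun x => g x - teval (proj n g) x) =
  sinner g g - specsum n g g.
Proof.
move=> Lg; have LP := L2_teval (proj n g); have Ld := L2_sub Lg LP.
rewrite sinnerBl// proj_residual_orthogonal ?proj_modes// subr0.
by rewrite sinnerBr// (sinnerC g (teval _)) sinner_proj.
Qed.

Lemma bessel n g : L2 g -> specsum n g g <= sinner g g.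
Proof.
by move=> Lg; rewrite -subr_ge0 -proj_residual//; exact: sinner_ge0.
Qed.

(** Pythagoras: the residual of [proj n g] is orthogonal to every polynomial with wavenumbers in
    [waves n], in particular to [proj n g] minus [s]. *)
Lemma proj_best n g (s : tpoly R) : L2 g ->
  all (fun m => m.1 \in waves n) s ->
  sinner g g - specsum n g g <=
  sinner (fun x => g x - teval s x) (fun x => g x - teval s x).
Proof.
move=> Lg sn; rewrite -proj_residual//.
have LP := L2_teval (proj n g); have Ls := L2_teval s; have Ld := L2_sub Lg LP.
have Lq := L2_sub LP Ls.
have -> : (fun x => g x - teval s x) =
    fun x => (g x - teval (proj n g) x) + (teval (proj n g) x - teval s x).
  by apply/funext => x; rewrite addrA subrK.
have O : sinner (fun x => teval (proj n g) x - teval s x)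
    (fun x => g x - teval (proj n g) x) = 0.
  by rewrite sinnerBl// !proj_residual_orthogonal ?proj_modes// subrr.
rewrite (sinnerDl Ld Lq (L2_add Ld Lq)) (sinnerDr Ld Lq Ld) (sinnerDr Ld Lq Lq).
by rewrite O (sinnerC _ (fun x => _ - teval s x)) O addr0 add0r lerDl sinner_ge0.
Qed.

End FourierProjection.

(** * The L^2 closure of the trigonometric polynomials *)

Section Density.
Context {R : realType}.
Implicit Types (f g h : sfield R) (s : tpoly R) (a c M e : R).

Notation plane := (measurableTypeR R * measurableTypeR R)%type.

(** The parallelogram identity, as a triangle inequality for squared distances; the factors 2
    explain the tolerances [e / 4] below. *)
Lemma sinner_subD f g h : L2 f -> L2 g -> L2 h ->
  sinner (fun x => f x - h x) (fun x => f x - h x) <=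
  2 * sinner (fun x => f x - g x) (fun x => f x - g x) +
  2 * sinner (fun x => g x - h x) (fun x => g x - h x).
Proof.
move=> Lf Lg Lh; have La := L2_sub Lf Lg; have Lb := L2_sub Lg Lh.
have -> : (fun x => f x - h x) = fun x => (f x - g x) + (g x - h x).
  by apply/funext => x; rewrite addrA subrK.
have := sinner_ge0 (fun x => (f x - g x) - (g x - h x)).
rewrite (sinnerBl La Lb (L2_sub La Lb)) (sinnerBr La Lb La) (sinnerBr La Lb Lb).
rewrite (sinnerDl La Lb (L2_add La Lb)) (sinnerDr La Lb La) (sinnerDr La Lb Lb).
by rewrite (sinnerC (fun x => g x - h x) (fun x => f x - g x)); lra.
Qed.

(** [L2 f] is demanded separately because a divergent integral has the real value 0, which would
    make the distance condition hold for free. *)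
Definition approx f := L2 f /\ forall e, 0 < e -> exists s,
  sinner (fun x => f x - teval s x) (fun x => f x - teval s x) < e.

Lemma approx_teval s : approx (teval s).
Proof.
split=> [|e e0]; first exact: L2_teval.
exists s; rewrite (_ : (fun x => _) = cst 0) ?sinner0l//.
by apply/funext => x; rewrite subrr.
Qed.

Lemma approx_closed f : L2 f -> (forall e, 0 < e -> exists2 g, approx g &
  sinner (fun x => f x - g x) (fun x => f x - g x) < e) -> approx f.
Proof.
move=> Lf H; split=> // e e0; have e4 : 0 < e / 4 by lra.
have [g [Lg /(_ _ e4)[s gs]] fg] := H _ e4; exists s.
by apply: le_lt_trans (sinner_subD Lf Lg (L2_teval s)) _; lra.
Qed.

Lemma approx_ae f g : L2 g -> f = g %[ae @torus R] -> approx f -> approx g.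
Proof.
move=> Lg fg [Lf fa]; apply: approx_closed => // e e0; exists f => //.
suff -> : sinner (fun x => g x - f x) (fun x => g x - f x) = sinner (cst 0) (cst 0).
  by rewrite sinner0l.
have L0 : L2 (cst (0 : R)) by exact: L2_cst.
have Ld := L2_sub Lg Lf.
have E : (fun x => g x - f x) = cst 0 %[ae @torus R].
  by apply: (torus_aeS2 _ fg fg) => x /(_ I) + _ _ => -> /=; rewrite subrr.
exact: eq_sinner.
Qed.

Lemma approx_scale a f : approx f -> approx (fun x => a * f x).
Proof.
move=> [Lf fa]; split=> [|e e0]; first exact: L2_scale.
have a1 : 0 < a ^+ 2 + 1 by have := sqr_ge0 a; lra.
have [s fs] := fa (e / (a ^+ 2 + 1)) (divr_gt0 e0 a1).
exists [seq (m.1, (a * m.2.1, a * m.2.2)) | m <- s].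
have -> : (fun x => a * f x - teval [seq (m.1, (a * m.2.1, a * m.2.2)) | m <- s] x)
    = fun x => a * (f x - teval s x).
  apply/funext => x; rewrite mulrBr /teval big_map mulr_sumr; congr (_ - _).
  by apply: eq_bigr => m _; rewrite /tterm /= mulrDr !mulrA.
have Ld := L2_sub Lf (L2_teval s).
rewrite (sinnerZl a Ld (L2_scale a Ld)) (sinnerZr a Ld Ld) mulrA -expr2.
move: fs; rewrite ltr_pdivlMr// mulrDr mulr1.
by have := sinner_ge0 (fun x => f x - teval s x); lra.
Qed.

Lemma approx_add f g : approx f -> approx g -> approx (fun x => f x + g x).
Proof.
move=> [Lf fa] [Lg ga]; split=> [|e e0]; first exact: L2_add.
have e4 : 0 < e / 4 by lra.
have [s fs] := fa _ e4; have [t gt] := ga _ e4; exists (s ++ t).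
have Lh : L2 (fun x => teval s x + g x) by apply: L2_add => //; exact: L2_teval.
apply: le_lt_trans (sinner_subD (L2_add Lf Lg) Lh (L2_teval _)) _.
have -> : (fun x => f x + g x - (teval s x + g x)) = fun x => f x - teval s x.
  by apply/funext => x; ring.
have -> : (fun x => teval s x + g x - teval (s ++ t) x) = fun x => g x - teval t x.
  by apply/funext => x; rewrite teval_cat; ring.
by lra.
Qed.

Lemma approx_sub f g : approx f -> approx g -> approx (fun x => f x - g x).
Proof.
move=> fa /(approx_scale (-1)) ga; have := approx_add fa ga.
by congr approx; apply/funext => x; rewrite mulN1r.
Qed.

Lemma approx_sum (I : Type) (r : seq I) (P : pred I) (F : I -> sfield R) :
  (forall i, P i -> approx (F i)) -> approx (fun x => \sum_(i <- r | P i) F i x).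
Proof.
move=> HF; elim: r => [|i r IH].
  rewrite (_ : (fun x => _) = teval [::]); first exact: approx_teval.
  by apply/funext => x; rewrite /teval !big_nil.
case: (boolP (P i)) => [Pi|/negPf Pi].
  rewrite (_ : (fun x => _) = fun x => F i x + \sum_(j <- r | P j) F j x).
    by apply: approx_add => //; exact: HF.
  by apply/funext => x; rewrite big_cons Pi.
rewrite (_ : (fun x => _) = fun x => \sum_(j <- r | P j) F j x)//.
by apply/funext => x; rewrite big_cons Pi.
Qed.

Lemma sinner_mul_bounded f g M : L2 f -> measurable_fun setT g ->
  (forall x, `|g x| <= M) ->
  sinner (fun x => f x * g x) (fun x => f x * g x) <= M ^+ 2 * sinner f f.
Proof.
move=> Lf mg gM; have Lfg := L2_mul_bounded Lf mg gM.
rewrite -(sinnerZl (M ^+ 2) Lf Lf).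
apply: le_Rintegral => //; [exact: L2_mul_integrable| |].
  by apply: L2_mul_integrable => //; exact: L2_scale.
move=> x _; rewrite mulrACA mulrC -mulrA ler_wpM2r//; first by rewrite -expr2 sqr_ge0.
rewrite -expr2 -real_normK ?num_real// ler_sqr ?nnegrE//.
exact: le_trans (gM x).
Qed.

(** f g - s t = (f - s) g + (g - t) s. The polynomial [s] comes first, since the accuracy required
    of [t] depends on the bound of [s]. *)
Lemma approx_mul f g M : approx f -> approx g -> (forall x, `|g x| <= M) ->
  approx (fun x => f x * g x).
Proof.
move=> [Lf fa] [Lg ga] gM; have mg := L2_measurable Lg.
split=> [|e e0]; first exact: (L2_mul_bounded Lf mg gM).
have M1 : 0 < M ^+ 2 + 1 by have := sqr_ge0 M; lra.
have e4 : 0 < e / 4 by lra.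
have [s fs] := fa (e / 4 / (M ^+ 2 + 1)) (divr_gt0 e4 M1).
have [K sK] := teval_bounded s.
have K1 : 0 < K ^+ 2 + 1 by have := sqr_ge0 K; lra.
have [t gt] := ga (e / 4 / (K ^+ 2 + 1)) (divr_gt0 e4 K1).
exists (tmul s t).
have Ls := L2_teval s; have Lt := L2_teval t; have ms := measurable_teval s.
have Lfs := L2_sub Lf Ls; have Lgt := L2_sub Lg Lt.
apply: le_lt_trans (sinner_subD (L2_mul_bounded Lf mg gM)
  (L2_mul_bounded Ls mg gM) (L2_teval _)) _.
have -> : (fun x => f x * g x - teval s x * g x) = fun x => (f x - teval s x) * g x.
  by apply/funext => x; ring.
have -> : (fun x => teval s x * g x - teval (tmul s t) x) =
    fun x => (g x - teval t x) * teval s x.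
  by apply/funext => x; rewrite teval_mul; ring.
have := sinner_mul_bounded Lfs mg gM; have := sinner_mul_bounded Lgt ms sK.
move: fs gt; rewrite !ltr_pdivlMr// !mulrDr !mulr1.
have := sinner_ge0 (fun x => f x - teval s x).
have := sinner_ge0 (fun x => g x - teval t x).
by lra.
Qed.

Lemma cvg_norm_le (u : R^nat) l M : u n @[n --> \oo] --> l ->
  (forall n, `|u n| <= M) -> `|l| <= M.
Proof.
move=> ul uM; have cn : `|u n| @[n --> \oo] --> `|l| by exact: cvg_norm.
rewrite -(cvg_lim (@Rhausdorff R) cn); apply: limr_le.
  by apply/cvg_ex; exists `|l|.
by apply: nearW => n; exact: uM.
Qed.

Lemma sinner_dominated_cvg (f_ : nat -> sfield R) f g :
  (forall n, measurable_fun setT (f_ n)) -> measurable_fun setT f -> L2 g ->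
  (forall n x, `|f_ n x| <= g x) -> (forall x, f_ n x @[n --> \oo] --> f x) ->
  sinner (fun x => f x - f_ n x) (fun x => f x - f_ n x) @[n --> \oo] --> (0 : R).
Proof.
move=> mf_ mf Lg fg cf.
have fgx x : `|f x| <= g x by exact: (cvg_norm_le (cf x)).
have L2g := L2_scale 2 Lg.
have := @dominated_cvg _ _ R (@torus R) setT measurableT
  (fun n x => ((f x - f_ n x) * (f x - f_ n x))%:E) (cst 0%E)
  (fun x => ((2 * g x) * (2 * g x))%:E).
rewrite integral0 => H.
apply: (fine_cvg (a := 0)); apply: H => //.
- move=> n; apply/measurable_EFinP; have mB := measurable_funB mf (mf_ n).
  exact: (measurable_funM mB mB).
- move=> x _; rewrite (_ : cst 0%E x = ((f x - f x) * (f x - f x))%:E); last first.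
    by rewrite subrr mul0r.
  apply/fine_cvgP; split; first exact: nearW.
  by apply: cvgM; (apply: cvgB; [exact: cvg_cst|exact: cf]).
- exact: L2_mul_integrable.
- move=> n x _ /=; rewrite lee_fin normrM ler_pM//.
    by apply: (le_trans (ler_normB _ _)); have := fg n x; have := fgx x; lra.
  by apply: (le_trans (ler_normB _ _)); have := fg n x; have := fgx x; lra.
Qed.

(** Gives the closure stability under dominated pointwise limits, the only kind of limit taken
    below. *)
Lemma approx_dominated (f_ : nat -> sfield R) f g :
  (forall n, approx (f_ n)) -> L2 g ->
  (forall n x, `|f_ n x| <= g x) -> (forall x, f_ n x @[n --> \oo] --> f x) ->
  approx f.
Proof.
move=> fa Lg fg cf.
have mf_ n : measurable_fun setT (f_ n) by apply: L2_measurable; case: (fa n).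
have mf : measurable_fun setT f by apply: (measurable_fun_cvg mf_) => x _; exact: cf.
have C := sinner_dominated_cvg mf_ mf Lg fg cf.
have fgx x : `|f x| <= g x by exact: (cvg_norm_le (cf x)).
have Lf : L2 f.
  apply/L2P; split => //; apply: le_integrable (L2_mul_integrable Lg Lg) => //.
    by apply/measurable_EFinP; exact: measurable_funX.
  move=> x _ /=; rewrite lee_fin normrX expr2 normrM.
  by rewrite ler_pM// (le_trans (fgx x))// ler_norm.
apply: approx_closed => // e e0.
have /cvgr0Pnorm_lt /(_ _ e0)[n _ /(_ n)/= Hn] := C.
exists (f_ n) => //; apply: le_lt_trans (ler_norm _) _; exact: Hn.
Qed.

(* q -> (3 q - q^3) / 2 maps [-1, 1] into itself, fixes 0, 1 and -1, and moves
   every other point of [-1, 1] towards 1 or -1 according to its sign. *)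
Definition sgstep (q : R) : R := 3 / 2 * q - 1 / 2 * (q * (q * q)).

Lemma sgstep_le1 (q : R) : -1 <= q <= 1 -> -1 <= sgstep q <= 1.
Proof.
move=> /andP[q0 q1]; apply/andP; split; rewrite -subr_ge0.
  have -> : sgstep q - -1 = (1 + q) ^+ 2 * (2 - q) / 2 by rewrite /sgstep; field.
  by rewrite divr_ge0// mulr_ge0 ?sqr_ge0//; lra.
have -> : 1 - sgstep q = (1 - q) ^+ 2 * (2 + q) / 2 by rewrite /sgstep; field.
by rewrite divr_ge0// mulr_ge0 ?sqr_ge0//; lra.
Qed.

Lemma sgstep_ge (q : R) : 0 <= q <= 1 -> q <= sgstep q.
Proof.
move=> /andP[q0 q1]; rewrite -subr_ge0.
have -> : sgstep q - q = q * (1 - q) * (1 + q) / 2 by rewrite /sgstep; field.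
by rewrite divr_ge0// mulr_ge0 ?mulr_ge0//; lra.
Qed.

(** The iterates increase and stay below 1, so they tend to a fixed point in [q, 1], and 1 is the
    only one. *)
Lemma sgstep_iter_pos (q : R) : 0 < q <= 1 -> iter n sgstep q @[n --> \oo] --> (1 : R).
Proof.
move=> /andP[q0 q1].
have B n : q <= iter n sgstep q <= 1.
  elim: n => [|n /andP[]]; first by rewrite /= lexx q1.
  rewrite iterS; set r := iter n sgstep q => qr r1.
  have /andP[_ ->] : -1 <= sgstep r <= 1 by apply: sgstep_le1; lra.
  by rewrite andbT (le_trans qr)// sgstep_ge//; lra.
have nd : nondecreasing_seq (fun n => iter n sgstep q).
  apply/nondecreasing_seqP => n; rewrite iterS; have /andP[] := B n.
  by set r := iter n sgstep q => qr r1; rewrite sgstep_ge//; lra.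
have ub : has_ubound (range (fun n => iter n sgstep q)).
  by exists 1 => _ [n _ <-]; have /andP[] := B n.
have cv := nondecreasing_is_cvgn nd ub.
set l := limn (fun n => iter n sgstep q) in cv *.
have ql : q <= l.
  by apply: limr_ge => //; apply: nearW => n; have /andP[] := B n.
have l1 : l <= 1.
  by apply: limr_le => //; apply: nearW => n; have /andP[] := B n.
have cvl : iter n sgstep q @[n --> \oo] --> l by exact: cv.
have cS : sgstep (iter n sgstep q) @[n --> \oo] --> sgstep l.
  apply: cvgB; apply: cvgM; [exact: cvg_cst|exact: cvl|exact: cvg_cst|].
  by apply: cvgM => //; exact: cvgM.
have cS' : iter n.+1 sgstep q @[n --> \oo] --> l by rewrite (cvg_shiftS (fun n => iter n sgstep q)).
have fl : sgstep l = l.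
  by rewrite -[LHS](cvg_lim (@Rhausdorff R) cS); exact: (cvg_lim (@Rhausdorff R) cS').
suff -> : 1 = l by [].
have l0 : 0 < l by exact: lt_le_trans ql.
have /eqP : l * ((1 - l) * (1 + l)) = 0.
  by move: fl; rewrite /sgstep; lra.
rewrite !mulf_eq0 gt_eqF//= (gt_eqF (_ : 0 < 1 + l)) ?orbF; last by lra.
by rewrite subr_eq0 => /eqP.
Qed.

Lemma sgstep_iterN n (q : R) : iter n sgstep (- q) = - iter n sgstep q.
Proof. by elim: n => //= n ->; rewrite /sgstep; ring. Qed.

Lemma sgstep_iter_bounded n (q : R) : `|q| <= 1 -> `|iter n sgstep q| <= 1.
Proof.
move=> q1; elim: n => //= n; set r := iter n sgstep q.
by rewrite !ler_norml; exact: sgstep_le1.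
Qed.

Lemma sgstep_iter_cvg (q : R) : `|q| <= 1 ->
  iter n sgstep q @[n --> \oo] --> Num.sg q.
Proof.
rewrite ler_norml => /andP[qN1 q1]; have [q0|q0|->] := ltgtP q 0.
- rewrite ltr0_sg//.
  rewrite (_ : (fun n => _) = (fun n => - iter n sgstep (- q))); last first.
    by apply/funext => n; rewrite sgstep_iterN opprK.
  by apply: cvgN; apply: sgstep_iter_pos; apply/andP; split; lra.
- by rewrite gtr0_sg//; apply: sgstep_iter_pos; rewrite q0 q1.
- rewrite sgr0 (_ : (fun n => _) = (fun=> 0)); first exact: cvg_cst.
  by apply/funext => n; elim: n => //= n ->; rewrite /sgstep; ring.
Qed.

(** The iterates of [sgstep] are polynomials in a function bounded by 1, hence stay in the closure
    by [approx_mul]; they converge boundedly to the sign of [teval s]. *)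
Lemma approx_pos s : approx (fun x => (0 < teval s x)%R%:R).
Proof.
have [M sM] := teval_bounded s.
pose K := `|M| + 1; have K0 : 0 < K by rewrite ltr_wpDl.
pose q n : sfield R := fun x => iter n sgstep (K^-1 * teval s x).
have qb x : `|K^-1 * teval s x| <= 1.
  rewrite normrM gtr0_norm ?invr_gt0// ler_pdivrMl// mulr1.
  by apply: (le_trans (sM x)); rewrite /K; have := ler_norm M; lra.
have qa n : approx (q n).
  elim: n => [|n IH]; first by apply: approx_scale; exact: approx_teval.
  have bq x : `|q n x| <= 1 by exact: sgstep_iter_bounded.
  have IH2 := approx_mul IH IH bq.
  have bq2 x : `|q n x * q n x| <= 1 by rewrite normrM mulr_ile1.
  exact: approx_sub (approx_scale _ IH) (approx_scale _ (approx_mul IH IH2 bq2)).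
have ms := measurable_teval s.
pose sg : sfield R := fun x => Num.sg (teval s x).
have sgb x : `|sg x| <= 1 by rewrite /sg normr_sg; case: (_ == _).
have asg : approx sg.
  apply: (approx_dominated (f_ := q) (g := cst 1)) => //; first exact: L2_cst.
    by move=> n x; exact: sgstep_iter_bounded.
  move=> x; rewrite /sg (_ : Num.sg _ = Num.sg (K^-1 * teval s x)).
    exact: sgstep_iter_cvg.
  by rewrite sgrM (gtr0_sg (_ : 0 < K^-1)) ?mul1r ?invr_gt0.
have sgE (y : R) : Num.sg y = (0 < y)%R%:R - (y < 0)%R%:R.
  case: (ltgtP y 0) => [y0|y0|->]; first by rewrite ltr0_sg//= sub0r.
    by rewrite gtr0_sg//= subr0.
  by rewrite sgr0 subrr.
(* The indicator of positivity is (sg^2 + sg) / 2. *)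
have := approx_scale (1 / 2) (approx_add (approx_mul asg asg sgb) asg).
congr approx; apply/funext => x; rewrite /sg sgE.
by case: (ltgtP (teval s x) 0) => _; rewrite ?mulr1n ?mulr0n; lra.
Qed.

(** This family is shown to be a sigma-algebra containing all rectangles, hence all measurable
    sets. *)
Definition approxset : set (set plane) :=
  [set E | measurable E /\ approx (\1_E : sfield R)].

Lemma indic_bounded (E : set plane) (x : plane) : `|(\1_E x : R)| <= 1.
Proof. by rewrite indicE; case: (_ \in _); rewrite ?normr1 ?normr0. Qed.

Lemma L2_indic (E : set plane) : measurable E -> L2 (\1_E : sfield R).
Proof.
move=> mE; apply: (@L2_bounded _ _ 1); last exact: indic_bounded.
exact: measurable_indic.
Qed.

Lemma approxsetI E F : approxset E -> approxset F -> approxset (E `&` F).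
Proof.
move=> [mE aE] [mF aF]; split; first exact: measurableI.
by rewrite indicI; exact: (approx_mul aE aF (@indic_bounded F)).
Qed.

Lemma approxsetC E : approxset E -> approxset (~` E).
Proof.
move=> [mE aE]; split; first exact: measurableC.
have := approx_sub (approx_teval [:: (0, (1, 0))]) aE.
congr approx; apply/funext => x; rewrite /teval big_cons big_nil /tterm /= mul0r !addr0 mul1r.
rewrite /cosw /phase /= !mul0r addr0 cos0 !indicE in_setC.
by case: (x \in E); rewrite ?subrr ?subr0.
Qed.

Lemma approxset_bigcup (A : (set plane)^nat) :
  (forall n, approxset (A n)) -> approxset (\bigcup_n A n).
Proof.
move=> HA; split; first by apply: bigcup_measurable => k _; case: (HA k).
(* The union of the first [n] sets, written through complements so that [approxsetC] and
   [approxsetI] apply. *)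
pose B n := ~` (\big[setI/setT]_(k < n) ~` A k).
have HB n : approxset (B n).
  apply: approxsetC; elim/big_ind: _ => [|E F|k _].
  - rewrite -setC0; apply: approxsetC; split => //.
    by rewrite indic0; rewrite (_ : cst 0 = teval [::]);
      [exact: approx_teval|apply/funext => x; rewrite /teval big_nil].
  - exact: approxsetI.
  - exact: approxsetC.
apply: (approx_dominated (f_ := fun n => \1_(B n)) (g := cst 1)).
- by move=> n; case: (HB n).
- exact: L2_cst.
- by move=> n x; exact: indic_bounded.
move=> x; rewrite indicE; have [|xA] := boolP (x \in \bigcup_n A n).
  rewrite inE => -[m _ xm]; apply: cvg_near_cst; exists m.+1 => // n /= mn.
  rewrite indicE mem_set// /B => /= xI; move: xm.
  have : (\big[setI/setT]_(k < n) ~` A k) `<=` ~` A m.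
    by rewrite -(bigcap_mkord n (fun k => ~` A k)) => y /(_ m mn).
  by apply.
apply: cvg_near_cst; apply: nearW => n; rewrite indicE memNset// => xB; move/negP: xA; apply.
rewrite inE; move: xB; rewrite /B -(bigcap_mkord n (fun k => ~` A k)) setC_bigcap => -[k _ /=].
by move=> /contrapT xk; exists k.
Qed.

End Density.

(** * Indicators of measurable sets lie in the closure; density and Parseval's identity *)

Section DensityOfTrigonometricPolynomials.
Context {R : realType}.
Implicit Types (f g h : sfield R) (s : tpoly R) (a c M e : R).

Notation plane := (measurableTypeR R * measurableTypeR R)%type.
Implicit Types (E F : set plane).

Lemma approxset_null E : measurable E -> @torus R E = 0%E -> approxset E.
Proof.
move=> mE E0; split => //; apply: (@approx_ae _ (teval [::])).
- exact: L2_indic.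
- exists E; split => // x /=; apply: contra_notP => xE _.
  by rewrite /teval big_nil indicE memNset.
- exact: approx_teval.
Qed.

(* The endpoints 0 and 2 pi are identified on the torus, so that they cannot be
   told apart by trigonometric polynomials: they are discarded as null sets. *)
Lemma torus_boundary_null (A : set R) : measurable A -> A `&` `]0, 2 * pi[ = set0 ->
  @torus R (A `*` setT) = 0%E /\ @torus R (setT `*` A) = 0%E.
Proof.
move=> mA A0.
have AI : @lebesgue_measure R (A `&` `[0, 2 * pi]) = 0%E.
  apply: countable_lebesgue_measure0.
  apply: (@sub_countable _ _ _ [set 0; 2 * pi]); last exact: finite_set_countable.
  apply: subset_card_le => x [Ax] /=; rewrite in_itv /= => /andP[x0 x2].
  have [->|x0'] := eqVneq x 0; first by left.
  have [->|x2'] := eqVneq x (2 * pi); first by right.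
  exfalso; suff : (A `&` `]0, 2 * pi[) x by rewrite A0.
  by split=> //=; rewrite in_itv /= !lt_neqAle x0 x2 x2' eq_sym x0'.
have mI : measurable (`[0, 2 * pi] : set R) by exact: measurable_itv.
have mAI := measurableI _ _ mA mI.
split.
- transitivity (@plane_measure R ((A `&` `[0, 2 * pi]) `*` `[0, 2 * pi])).
    by rewrite -[RHS]/(plane_measure _) /square; congr (plane_measure _); rewrite -setXI setTI.
  by rewrite /plane_measure product_measure1E// [X in (X * _)%E]AI mul0e.
- transitivity (@plane_measure R (`[0, 2 * pi] `*` (A `&` `[0, 2 * pi]))).
    by rewrite -[RHS]/(plane_measure _) /square; congr (plane_measure _); rewrite -setXI setTI.
  by rewrite /plane_measure product_measure1E// [X in (_ * X)%E]AI mule0.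
Qed.

(** Exhibits the arc ]0, a[ as the set where a trigonometric polynomial is positive. The difference
    is 2 sin (t / 2) sin ((a - t) / 2): the first sine is positive on the period, and (a - t) / 2
    lies strictly between -pi and pi. *)
Lemma cos_half_gt (a t : R) : 0 < a < 2 * pi -> 0 < t < 2 * pi ->
  (0 < cos (t - a / 2) - cos (a / 2)) = (t < a).
Proof.
move=> /andP[a0 a2] /andP[t0 t2].
have -> : cos (t - a / 2) - cos (a / 2) = 2 * (sin (t / 2) * sin ((a - t) / 2)).
  have -> : t - a / 2 = t / 2 - (a - t) / 2 by field.
  have -> : a / 2 = t / 2 + (a - t) / 2 by field.
  by rewrite cosB cosD; ring.
have st : 0 < sin (t / 2) by apply: sin_gt0_pi; lra.
rewrite pmulr_rgt0// pmulr_rgt0//.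
have [ta|at_] := ltP t a; first by apply: sin_gt0_pi; lra.
apply/negbTE; rewrite -leNgt -oppr_ge0 -sinN; apply: sin_ge0_pi; lra.
Qed.

Lemma approxset_fst_itv (a : R) : approxset ((`]-oo, a[ : set R) `*` setT : set plane).
Proof.
have mA : measurable (`]-oo, a[ : set R) by exact: measurable_itv.
have mI : measurable (`]0, 2 * pi[ : set R) by exact: measurable_itv.
have mX (A : set R) : measurable A -> measurable (A `*` setT : set plane).
  by move=> mA'; exact: measurableX.
(* Unless 0 < a < 2 pi, the strip or its complement is a null set. *)
have [a0|a0] := leP a 0.
  apply: approxset_null; first exact: mX.
  apply: (torus_boundary_null mA _).1; rewrite -subset0 => x /=.
  by rewrite !in_itv /=; lra.
have [a2|a2] := leP (2 * pi) a.
  rewrite -[X in approxset X]setCK; apply: approxsetC.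
  have -> : ~` (`]-oo, a[ `*` setT : set plane) = (~` `]-oo, a[) `*` setT.
    by apply/seteqP; split=> [x /= xa|x [xa _] [? _]//]; split => // xa'; apply: xa.
  apply: approxset_null; first exact: mX _ (measurableC mA).
  apply: (torus_boundary_null (measurableC mA) _).1; rewrite -subset0 => x /=.
  by rewrite !in_itv /= => -[/negP]; lra.
pose s : tpoly R := [:: ((1, 0), (cos (a / 2), sin (a / 2))); (0, (- cos (a / 2), 0))].
have sE x : teval s x = cos (x.1 - a / 2) - cos (a / 2).
  rewrite /teval !big_cons big_nil /tterm /cosw /sinw /phase /= !mul0r !addr0 mul1r.
  by rewrite cos0 mulr1 cosB; ring.
split; first exact: mX.
apply: approx_ae (approx_pos s); first by apply: L2_indic; exact: mX.
exists (~` `]0, 2 * pi[ `*` setT); split.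
- exact: mX _ (measurableC mI).
- by apply: (torus_boundary_null (measurableC mI) _).1; rewrite setICl.
move=> x /= H; split=> // xI; apply: H => _.
rewrite sE cos_half_gt ?a0// indicE; congr ((nat_of_bool _)%:R).
by apply/idP/idP; rewrite inE /= in_itv /=; [move=> ?; split|case].
Qed.

Lemma approxset_snd_itv (a : R) : approxset (setT `*` (`]-oo, a[ : set R) : set plane).
Proof.
have mA : measurable (`]-oo, a[ : set R) by exact: measurable_itv.
have mI : measurable (`]0, 2 * pi[ : set R) by exact: measurable_itv.
have mX (A : set R) : measurable A -> measurable (setT `*` A : set plane).
  by move=> mA'; exact: measurableX.
have [a0|a0] := leP a 0.
  apply: approxset_null; first exact: mX.
  apply: (torus_boundary_null mA _).2; rewrite -subset0 => x /=.
  by rewrite !in_itv /=; lra.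
have [a2|a2] := leP (2 * pi) a.
  rewrite -[X in approxset X]setCK; apply: approxsetC.
  have -> : ~` (setT `*` `]-oo, a[ : set plane) = setT `*` (~` `]-oo, a[).
    by apply/seteqP; split=> [x /= xa|x [_ xa] [_ ?]//]; split => // xa'; apply: xa.
  apply: approxset_null; first exact: mX _ (measurableC mA).
  apply: (torus_boundary_null (measurableC mA) _).2; rewrite -subset0 => x /=.
  by rewrite !in_itv /= => -[/negP]; lra.
pose s : tpoly R := [:: ((0, 1), (cos (a / 2), sin (a / 2))); (0, (- cos (a / 2), 0))].
have sE x : teval s x = cos (x.2 - a / 2) - cos (a / 2).
  rewrite /teval !big_cons big_nil /tterm /cosw /sinw /phase /= !mul0r !addr0 add0r mul1r.
  by rewrite cos0 mulr1 cosB; ring.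
split; first exact: mX.
apply: approx_ae (approx_pos s); first by apply: L2_indic; exact: mX.
exists (setT `*` ~` `]0, 2 * pi[); split.
- exact: mX _ (measurableC mI).
- by apply: (torus_boundary_null (measurableC mI) _).2; rewrite setICl.
move=> x /= H; split=> // xI; apply: H => _.
rewrite sE cos_half_gt ?a0// indicE; congr ((nat_of_bool _)%:R).
by apply/idP/idP; rewrite inE /= in_itv /=; [move=> ?; split|case].
Qed.

Lemma approxset_fst (A : set R) : measurable A -> approxset (A `*` setT : set plane).
Proof.
move=> mA; have : (@ocitv R).-sigma.-measurable A by [].
rewrite RGenInftyO.measurableE; move: A {mA}; apply: smallest_sub.
  split.
  - by rewrite set0X; apply: approxset_null; [exact: measurable0|rewrite measure0].
  - move=> A /approxsetC; rewrite setTD; congr approxset.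
    by apply/seteqP; split=> [x /= xA|x [xA _] [? _]//]; split => // xA'; apply: xA.
  - move=> A HA; have -> : (\bigcup_k A k) `*` setT = \bigcup_k (A k `*` setT) :> set plane.
      apply/seteqP; split=> [x [[k _ xk] _]|x [k _ [xk _]]]; first by exists k.
      by split=> //; exists k.
    exact: approxset_bigcup.
by move=> _ [a ->]; exact: approxset_fst_itv.
Qed.

Lemma approxset_snd (A : set R) : measurable A -> approxset (setT `*` A : set plane).
Proof.
move=> mA; have : (@ocitv R).-sigma.-measurable A by [].
rewrite RGenInftyO.measurableE; move: A {mA}; apply: smallest_sub.
  split.
  - by rewrite setX0; apply: approxset_null; [exact: measurable0|rewrite measure0].
  - move=> A /approxsetC; rewrite setTD; congr approxset.
    by apply/seteqP; split=> [x /= xA|x [_ xA] [_ ?]//]; split => // xA'; apply: xA.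
  - move=> A HA; have -> : setT `*` (\bigcup_k A k) = \bigcup_k (setT `*` A k) :> set plane.
      apply/seteqP; split=> [x [_ [k _ xk]]|x [k _ [_ xk]]]; first by exists k.
      by split=> //; exists k.
    exact: approxset_bigcup.
by move=> _ [a ->]; exact: approxset_snd_itv.
Qed.

Lemma approxset_measurable (E : set plane) : measurable E -> approxset E.
Proof.
rewrite measurable_prod_measurableType; move: E; apply: smallest_sub.
  split.
  - by apply: approxset_null; [exact: measurable0|rewrite measure0].
  - by move=> A /approxsetC; rewrite setTD.
  - by move=> A HA; exact: approxset_bigcup.
move=> _ [A mA] [B mB] <-.
have -> : A `*` B = (A `*` setT) `&` (setT `*` B) :> set plane.
  by rewrite -setXI setTI setIT.
exact: approxsetI (approxset_fst mA) (approxset_snd mB).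
Qed.

Import HBNNSimple.

(** Simple functions increase to a nonnegative function, which dominates them; a general f is the
    difference of max (f, 0) and max (f, 0) - f. *)
Lemma L2_approx f : L2 f -> approx f.
Proof.
have pos g : L2 g -> (forall x, 0 <= g x) -> approx g.
  move=> Lg g0; have mE : measurable_fun setT (EFin \o g).
    by apply/measurable_EFinP; exact: L2_measurable.
  have g0' (x : plane) : setT x -> (0 <= (EFin \o g) x)%E by move=> _; rewrite lee_fin.
  pose h n := nnsfun_approx measurableT mE n.
  have ha n : approx (h n : sfield R).
    have -> : (h n : sfield R) =
        fun x => \sum_(y <- finmap.enum_fset (fset_set (range (h n)))) y * \1_(h n @^-1` [set y]) x.
      by apply/funext => x; rewrite fimfunE fsbig_finite.
    apply: approx_sum => y _; apply: approx_scale.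
    by case: (approxset_measurable (measurable_sfunP (h n) (measurable_set1 y))).
  have hg n x : `|h n x| <= g x.
    rewrite ger0_norm// -lee_fin /h nnsfun_approxE.
    by apply: le_approx.
  have hc x : h n x @[n --> \oo] --> g x.
    by have := cvg_nnsfun_approx measurableT mE g0' (I : setT x); exact: fine_cvg.
  exact: (approx_dominated ha Lg hg hc).
move=> Lf; have mf := L2_measurable Lf.
have Lp : L2 (fun x => Num.max (f x) 0).
  apply/L2P; split; first exact: measurable_maxr.
  apply: le_integrable (L2_mul_integrable Lf Lf) => //.
    by apply/measurable_EFinP; apply: measurable_funX; exact: measurable_maxr.
  move=> x _ /=; rewrite lee_fin -expr2 !ger0_norm ?sqr_ge0//.
  by case: (leP (f x) 0) => // _; rewrite expr0n sqr_ge0.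
have ap : approx (fun x => Num.max (f x) 0) by apply: pos => // x; rewrite le_max lexx orbT.
have an : approx (fun x => Num.max (f x) 0 - f x).
  apply: pos => [|x]; first exact: L2_sub.
  by rewrite subr_ge0 le_max lexx.
have := approx_sub ap an; congr approx; apply/funext => x; ring.
Qed.

Lemma proj_residual_cvg g : L2 g ->
  sinner g g - specsum n g g @[n --> \oo] --> (0 : R).
Proof.
move=> Lg; have [_ ga] := L2_approx Lg; apply/cvgr0Pnorm_lt => e e0.
have [s gs] := ga _ e0.
have [n0 Hn0] : exists n0, forall n, (n0 <= n)%N -> all (fun m => m.1 \in waves n) s.
  elim: (s) => [|m t [n0 IH]]; first by exists 0%N.
  (* |k_1| + |k_2| bounds the Euclidean length of k, so this radius captures the new mode. *)
  exists (maxn n0 (`|m.1.1| + `|m.1.2|)%N) => n; rewrite geq_max => /andP[n1 n2] /=.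
  rewrite IH// andbT mem_waves; nia.
exists n0 => // n /= /Hn0 Hn; rewrite ger0_norm; last first.
  by rewrite subr_ge0; exact: bessel.
exact: le_lt_trans (proj_best Lg Hn) gs.
Qed.

(** By Cauchy-Schwarz the error is at most |g - P_n g| |h|, so the bilinear identity needs
    convergence for [g] alone. *)
Lemma parseval g h : L2 g -> L2 h -> specsum n g h @[n --> \oo] --> sinner g h.
Proof.
move=> Lg Lh; apply/cvgrPdist_lt => e e0.
have h1 : 0 < sinner h h + 1 by have := sinner_ge0 h; lra.
have /cvgr0Pnorm_lt /(_ (e ^+ 2 / (sinner h h + 1))) := proj_residual_cvg Lg.
have e1 : 0 < e ^+ 2 / (sinner h h + 1) by rewrite divr_gt0// exprn_gt0.
move=> /(_ e1)[n0 _ Hn]; exists n0 => // n /Hn /= {}Hn.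
have LP := L2_teval (proj n g).
rewrite -(sinner_proj n g Lh) -(sinnerBl Lg LP Lh).
have Ld := L2_sub Lg LP.
have := sinner_CS Ld Lh; rewrite proj_residual//.
have := le_lt_trans (ler_norm _) Hn; rewrite ltr_pdivlMr// => H1 H2.
rewrite -(@ltr_pXn2r _ 2)// ?nnegrE ?normr_ge0//; last exact: ltW.
rewrite real_normK ?num_real//; apply: le_lt_trans H2 _.
have r0 : 0 <= sinner g g - specsum n g g by rewrite subr_ge0; exact: bessel.
by apply: le_lt_trans H1; rewrite mulrDr mulr1 lerDl.
Qed.

End DensityOfTrigonometricPolynomials.

(** * Weak derivatives read on Fourier coefficients *)

Section WeakDerivatives.
Context {R : realType}.
Implicit Types (f g h : sfield R) (k : int * int) (j : 'I_2) (n : nat) (a : R).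

Lemma fourier_coef_eq0 g : L2 g ->
  (forall k, sinner g (cosw k) = 0) -> (forall k, sinner g (sinw k) = 0) ->
  sinner g g = 0.
Proof.
move=> Lg c0 s0; rewrite -(cvg_lim (@Rhausdorff R) (parseval Lg Lg)).
rewrite (_ : (fun n => specsum n g g) = (fun=> 0)) ?lim_cst//.
apply/funext => n; rewrite /specsum big1 ?mulr0// => k _.
by rewrite c0 s0 !mul0r addr0.
Qed.

Lemma is_wderiv_unique j g h1 h2 : L2 h1 -> L2 h2 ->
  is_wderiv j g h1 -> is_wderiv j g h2 -> h1 = h2 %[ae @torus R].
Proof.
move=> L1 L2' D1 D2; have Ld := L2_sub L1 L2'.
have : sinner (fun x => h1 x - h2 x) (fun x => h1 x - h2 x) = 0.
  apply: fourier_coef_eq0 => // k.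
    by rewrite (sinnerBl L1 L2' (L2_cosw k)) (D1 k).1 (D2 k).1 subrr.
  by rewrite (sinnerBl L1 L2' (L2_sinw k)) (D1 k).2 (D2 k).2 subrr.
move/(sinner_eq0_ae Ld) => E; apply: (torus_aeS2 _ E E) => x /(_ I) /= /subr0_eq ->.
by [].
Qed.

Lemma H1_wDP j g : H1 g -> L2 (wD j g) /\ is_wderiv j g (wD j g).
Proof. by move=> [_ /(_ j) D]; exact: (xgetPex (fun=> 0) D). Qed.

Lemma H1_L2 g : H1 g -> L2 g. Proof. by case. Qed.

Lemma wD_L2 j g : H1 g -> L2 (wD j g).
Proof. by move=> /(H1_wDP j)[]. Qed.

Lemma wD_wderiv j g : H1 g -> is_wderiv j g (wD j g).
Proof. by move=> /(H1_wDP j)[]. Qed.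

(** [wD] is a chosen representative: it is computed by exhibiting some weak derivative, and only up
    to a null set. *)
Lemma wD_ae j g h : H1 g -> L2 h -> is_wderiv j g h -> wD j g = h %[ae @torus R].
Proof.
move=> Hg Lh; apply: is_wderiv_unique => //; [exact: wD_L2|exact: wD_wderiv].
Qed.

Lemma is_wderiv_lin j a f g f' g' : L2 f -> L2 g -> L2 f' -> L2 g' ->
  is_wderiv j f f' -> is_wderiv j g g' ->
  is_wderiv j (fun x => a * f x + g x) (fun x => a * f' x + g' x).
Proof.
move=> Lf Lg Lf' Lg' Df Dg k.
have Lc := L2_cosw (R := R) k; have Ls := L2_sinw (R := R) k.
have L h1 h2 q : L2 h1 -> L2 h2 -> L2 q ->
    sinner (fun x => a * h1 x + h2 x) q = a * sinner h1 q + sinner h2 q.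
  by move=> L1 L2' Lq; rewrite (sinnerDl (L2_scale a L1))// sinnerZl.
rewrite (L f' g' (cosw k))// (L f g (sinw k))// (L f' g' (sinw k))// (L f g (cosw k))//.
rewrite (Df k).1 (Df k).2 (Dg k).1 (Dg k).2.
by rewrite /cosw /sinw; split; ring.
Qed.

Lemma H1_lin a f g : H1 f -> H1 g -> H1 (fun x => a * f x + g x).
Proof.
move=> Hf Hg; have Lf := H1_L2 Hf; have Lg := H1_L2 Hg; split=> [|j].
  by apply: L2_add => //; exact: L2_scale.
exists (fun x => a * wD j f x + wD j g x); split.
  by apply: L2_add; [apply: L2_scale|]; exact: wD_L2.
by apply: is_wderiv_lin => //; (exact: wD_L2 || exact: wD_wderiv).
Qed.

Lemma wD_lin j a f g : H1 f -> H1 g ->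
  wD j (fun x => a * f x + g x) = (fun x => a * wD j f x + wD j g x) %[ae @torus R].
Proof.
move=> Hf Hg; apply: wD_ae; first exact: H1_lin.
  by apply: L2_add; [apply: L2_scale|]; exact: wD_L2.
by apply: is_wderiv_lin; (exact: H1_L2 || exact: wD_L2 || exact: wD_wderiv).
Qed.

Definition specterm k g h : R :=
  sinner g (cosw k) * sinner h (cosw k) + sinner g (sinw k) * sinner h (sinw k).

Lemma specsumE n g h :
  specsum n g h = (2 * pi) ^- 2 * \sum_(k <- waves n) specterm k g h.
Proof. by []. Qed.

Lemma specterm_ge0 k g : 0 <= specterm k g g.
Proof. by rewrite addr_ge0// -expr2 sqr_ge0. Qed.

Lemma specterm_wD k j g h : H1 g -> H1 h ->
  specterm k (wD j g) h = - specterm k g (wD j h).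
Proof.
move=> /(wD_wderiv j)/(_ k)[gc gs] /(wD_wderiv j)/(_ k)[hc hs].
by rewrite /specterm /cosw /sinw gc gs hc hs; ring.
Qed.

Lemma specterm_grad k g : H1 g ->
  \sum_(j < 2) specterm k (wD j g) (wD j g) = (k.1 ^+ 2 + k.2 ^+ 2)%:~R * specterm k g g.
Proof.
move=> Hg; rewrite !big_ord_recl big_ord0.
have [c0 s0] := wD_wderiv ord0 Hg k; have [c1 s1] := wD_wderiv (lift ord0 ord0) Hg k.
rewrite /specterm /cosw /sinw c0 s0 c1 s1 /wave /=.
by rewrite intrD !rmorphXn /=; ring.
Qed.

(** Differentiation exchanges the sine and cosine coefficients with opposite signs, so the identity
    holds mode by mode and passes to the limit by Parseval. *)
Lemma wD_parts j g h : H1 g -> H1 h -> sinner (wD j g) h = - sinner g (wD j h).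
Proof.
move=> Hg Hh; have Lg := H1_L2 Hg; have Lh := H1_L2 Hh.
rewrite -(cvg_lim (@Rhausdorff R) (parseval (wD_L2 j Hg) Lh)).
apply/cvg_lim; first exact: Rhausdorff.
rewrite (_ : (fun n => _) = (fun n => - specsum n g (wD j h))); last first.
  apply/funext => n; rewrite !specsumE -mulrN -sumrN; congr (_ * _).
  by apply: eq_bigr => k _; rewrite specterm_wD.
by apply: cvgN; apply: parseval => //; exact: wD_L2.
Qed.

Definition grad2 g : R := \sum_(j < 2) sinner (wD j g) (wD j g).

Lemma specsum_grad n g : H1 g ->
  (2 * pi) ^- 2 * \sum_(k <- waves n) (k.1 ^+ 2 + k.2 ^+ 2)%:~R * specterm k g g
    <= grad2 g.
Proof.
move=> Hg; rewrite (eq_bigr _ (fun k _ => esym (specterm_grad k Hg))).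
rewrite exchange_big mulr_sumr /=; apply: ler_sum => j _.
by rewrite -specsumE; apply: bessel; exact: wD_L2.
Qed.

Lemma kappa_gt0 : 0 < (2 * pi) ^- 2 :> R.
Proof. by rewrite invr_gt0 exprn_gt0// mulr_gt0// pi_gt0. Qed.

(** The constant is 1 because the mean is zero and every nonzero integer wavenumber has |k|^2 >=
    1. *)
Lemma poincare g : H1 g -> sinner g (cosw 0) = 0 -> sinner g g <= grad2 g.
Proof.
move=> Hg g0; have Lg := H1_L2 Hg.
rewrite -(cvg_lim (@Rhausdorff R) (parseval Lg Lg)); apply: limr_le.
  by apply/cvg_ex; exists (sinner g g); exact: parseval.
apply: nearW => n; apply: le_trans (specsum_grad n Hg).
rewrite specsumE ler_pM2l ?kappa_gt0//; apply: ler_sum => k _.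
have [->|k0] := eqVneq k 0.
  rewrite /specterm g0 (_ : sinner g (sinw 0) = 0) ?mul0r ?addr0 ?mulr0//.
  rewrite sinnerC -[RHS](sinner0l g); congr sinner; apply/funext => x.
  by rewrite /sinw /phase !mul0r addr0 sin0.
apply: ler_peMl; first exact: specterm_ge0.
have : 1 <= k.1 ^+ 2 + k.2 ^+ 2.
  move: k0; case: k => k1 k2 /=; rewrite -pair_eqE /pair_eq /= negb_and.
  have sq (z : int) : z != 0 -> 1 <= z ^+ 2 by rewrite -gtz0_ge1 exprn_even_gt0.
  by case/orP => /sq k0; [rewrite ler_wpDr ?sqr_ge0|rewrite ler_wpDl ?sqr_ge0].
by rewrite -(ler_int R).
Qed.

(** The modes missing from [specsum n] satisfy |k|^2 > n^2. The inequality is proved for the partial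
    sums of order m >= n, then m goes to infinity. *)
Lemma spectral_gap n g : H1 g ->
  n%:R ^+ 2 * (sinner g g - specsum n g g) <= grad2 g.
Proof.
move=> Hg; have Lg := H1_L2 Hg.
have cv : n%:R ^+ 2 * (specsum m g g - specsum n g g) @[m --> \oo] -->
    n%:R ^+ 2 * (sinner g g - specsum n g g).
  by apply: cvgM; [exact: cvg_cst|apply: cvgB; [exact: parseval|exact: cvg_cst]].
rewrite -(cvg_lim (@Rhausdorff R) cv); apply: limr_le.
  by apply/cvg_ex; eexists; exact: cv.
exists n => // m /= nm; apply: le_trans (specsum_grad m Hg).
rewrite !specsumE -mulrBr mulrCA ler_pM2l ?kappa_gt0//.
rewrite (bigID (fun k => k \in waves n)) /=.
rewrite [X in _ <= X](bigID (fun k => k \in waves n)) /=.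
have -> : \sum_(k <- waves m | k \in waves n) specterm k g g =
    \sum_(k <- waves n) specterm k g g.
  rewrite -big_filter; apply: perm_big; apply: uniq_perm; rewrite ?filter_uniq ?waves_uniq//.
  move=> k; rewrite mem_filter; case: (boolP (k \in waves n)) => //=.
  rewrite !mem_waves => /le_trans; apply; nia.
rewrite [X in _ * X]addrAC subrr add0r mulr_sumr; apply: ler_wpDl.
  apply: sumr_ge0 => k _; rewrite mulr_ge0 ?specterm_ge0// ler0z.
  by rewrite addr_ge0 ?sqr_ge0.
apply: ler_sum => k; rewrite mem_waves -ltNge => kn.
rewrite ler_wpM2r ?specterm_ge0// -natrX -[X in X <= _]mulrz_nat.
by rewrite ler_int natz ltW.
Qed.

Lemma proj_wderiv n j g : H1 g ->
  is_wderiv j (teval (proj n g)) (teval (proj n (wD j g))).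
Proof.
move=> Hg k; have Lg := H1_L2 Hg; have LD := wD_L2 j Hg.
have [gc gs] := wD_wderiv j Hg k.
rewrite -/(cosw k) -/(sinw k) !proj_cosw// !proj_sinw//.
by case: ifP => _; rewrite ?mulr0 ?oppr0.
Qed.

Lemma H1_proj n g : H1 g -> H1 (teval (proj n g)).
Proof.
move=> Hg; split=> [|j]; first exact: L2_teval.
by exists (teval (proj n (wD j g))); split; [exact: L2_teval|exact: proj_wderiv].
Qed.

(** An equality of coefficient lists: it makes the symbolic product rule [teval_deriv_mul] available
    for weak derivatives of truncations. *)
Lemma tderiv_proj n j g : H1 g -> tderiv j (proj n g) = proj n (wD j g).
Proof.
move=> Hg; rewrite /tderiv /proj -map_comp; apply: eq_map => k /=.
have [gc gs] := wD_wderiv j Hg k.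
by rewrite /cosw /sinw gc gs; congr (_, (_, _)); ring.
Qed.

End WeakDerivatives.

(** * Vector fields: the spaces H and V and their inner products *)

HB.lock Definition dotV {R : realType} (u v : vfield R) : R :=
  \sum_(i < 2) \sum_(j < 2) sinner (wD j (component i u)) (wD j (component i v)).

Section VectorFields.
Context {R : realType}.
Implicit Types (f g h : sfield R) (u v w : vfield R) (k : int * int) (j i : 'I_2)
  (n : nat) (a b c : R).

Lemma component_lin i a u v :
  component i (a *: u + v) = fun x => a * component i u x + component i v x.
Proof. by apply/funext => x; rewrite /component !mxE. Qed.

Lemma componentB i u v :
  component i (u - v) = fun x => component i u x - component i v x.
Proof. by apply/funext => x; rewrite /component !mxE. Qed.

Lemma componentZ i a u : component i (a *: u) = fun x => a * component i u x.
Proof. by apply/funext => x; rewrite /component !mxE. Qed.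

Lemma L2v_lin a u v : L2v u -> L2v v -> L2v (a *: u + v).
Proof.
by move=> Lu Lv i; rewrite component_lin; apply: L2_add => //; exact: L2_scale.
Qed.

Lemma L2vZ a u : L2v u -> L2v (a *: u).
Proof. by move=> Lu i; rewrite componentZ; exact: L2_scale. Qed.

Lemma L2vD u v : L2v u -> L2v v -> L2v (u + v).
Proof. by move=> Lu Lv; rewrite -[u]scale1r; exact: L2v_lin. Qed.

Lemma L2vN u : L2v u -> L2v (- u).
Proof. by move=> Lu; rewrite -scaleN1r; exact: L2vZ. Qed.

Lemma mean_freeE u : mean_free u <-> forall i, sinner (component i u) (cosw 0) = 0.
Proof.
have E i : sinner (component i u) (cosw 0) = \int[@torus R]_x component i u x.
  by apply: eq_Rintegral => x _; rewrite /cosw /phase !mul0r addr0 cos0 mulr1.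
by split=> H i; [rewrite E|rewrite -E]; exact: H.
Qed.

Lemma Hspace_lin a u v : Hspace u -> Hspace v -> Hspace (a *: u + v).
Proof.
move=> [Lu mu du] [Lv mv dv]; have L g h q : L2 g -> L2 h -> L2 q ->
    sinner (fun x => a * g x + h x) q = a * sinner g q + sinner h q.
  by move=> Lg Lh Lq; rewrite (sinnerDl (L2_scale a Lg))// sinnerZl.
split; first exact: L2v_lin.
  apply/mean_freeE => i; rewrite component_lin L//; last exact: L2_cosw.
  by move/mean_freeE : mu => ->; move/mean_freeE : mv => ->; rewrite mulr0 addr0.
move=> k; have [du1 du2] := du k; have [dv1 dv2] := dv k.
split.
  rewrite (eq_bigr (fun j => a * (wave k j * sinner (component j u) (cosw k)) +
     wave k j * sinner (component j v) (cosw k))).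
    by rewrite big_split /= -mulr_sumr [X in a * X]du1 [X in _ + X]dv1 mulr0 addr0.
  by move=> j _; rewrite component_lin L//; [ring|exact: L2_cosw].
rewrite (eq_bigr (fun j => a * (wave k j * sinner (component j u) (sinw k)) +
   wave k j * sinner (component j v) (sinw k))).
  by rewrite big_split /= -mulr_sumr [X in a * X]du2 [X in _ + X]dv2 mulr0 addr0.
by move=> j _; rewrite component_lin L//; [ring|exact: L2_sinw].
Qed.

Lemma Vspace_lin a u v : Vspace u -> Vspace v -> Vspace (a *: u + v).
Proof.
move=> [Hu Vu] [Hv Vv]; split; first exact: Hspace_lin.
by move=> i; rewrite component_lin; exact: H1_lin.
Qed.

Lemma VspaceD u v : Vspace u -> Vspace v -> Vspace (u + v).
Proof. by move=> Vu Vv; rewrite -[u]scale1r; exact: Vspace_lin. Qed.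

Lemma VspaceB u v : Vspace u -> Vspace v -> Vspace (u - v).
Proof. by move=> Vu Vv; rewrite addrC -scaleN1r; exact: Vspace_lin. Qed.

Lemma Vspace_Hspace u : Vspace u -> Hspace u. Proof. by case. Qed.

Lemma Hspace_L2v u : Hspace u -> L2v u. Proof. by case. Qed.

Lemma Vspace_L2v u : Vspace u -> L2v u. Proof. by move=> /Vspace_Hspace/Hspace_L2v. Qed.

Lemma Vspace_H1 u i : Vspace u -> H1 (component i u). Proof. by case. Qed.

Lemma innerC u v : inner u v = inner v u.
Proof. by apply: eq_bigr => i _; exact: sinnerC. Qed.

Lemma inner_linl a u v w : L2v u -> L2v v -> L2v w ->
  inner (a *: u + v) w = a * inner u w + inner v w.
Proof.
move=> Lu Lv Lw; rewrite /inner mulr_sumr -big_split; apply: eq_bigr => i _ /=.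
by rewrite component_lin (sinnerDl (L2_scale a (Lu i)))// sinnerZl.
Qed.

Lemma innerDl u v w : L2v u -> L2v v -> L2v w -> inner (u + v) w = inner u w + inner v w.
Proof. by move=> *; rewrite -[u]scale1r inner_linl// mul1r scale1r. Qed.

Lemma innerBl u v w : L2v u -> L2v v -> L2v w -> inner (u - v) w = inner u w - inner v w.
Proof. by move=> *; rewrite addrC -scaleN1r inner_linl// mulN1r addrC. Qed.

Lemma innerDr u v w : L2v u -> L2v v -> L2v w -> inner w (u + v) = inner w u + inner w v.
Proof. by move=> *; rewrite innerC innerDl// !(innerC w). Qed.

Lemma innerBr u v w : L2v u -> L2v v -> L2v w -> inner w (u - v) = inner w u - inner w v.
Proof. by move=> *; rewrite innerC innerBl// !(innerC w). Qed.

Lemma inner_ge0 u : 0 <= inner u u.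
Proof. by apply: sumr_ge0 => i _; exact: sinner_ge0. Qed.

Lemma sqr_norm u : norm u ^+ 2 = inner u u.
Proof. by rewrite sqr_sqrtr// inner_ge0. Qed.

(* Summing the quadratic forms in each pair (F k, G k). *)
Lemma sum_sinner_CS (I : Type) (r : seq I) (F G : I -> sfield R) :
  (forall x, L2 (F x)) -> (forall x, L2 (G x)) ->
  (\sum_(x <- r) sinner (F x) (G x)) ^+ 2 <=
  (\sum_(x <- r) sinner (F x) (F x)) * (\sum_(x <- r) sinner (G x) (G x)).
Proof.
move=> LF LG; apply: form_CS => s t; rewrite !mulr_sumr -!big_split /=.
apply: sumr_ge0 => i _; have Ls := L2_scale s (LF i); have Lt := L2_scale t (LG i).
have := sinner_ge0 (fun x => s * F i x + t * G i x).
rewrite (sinnerDl Ls Lt (L2_add Ls Lt)) (sinnerDr Ls Lt Ls) (sinnerDr Ls Lt Lt).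
rewrite !(sinnerZl _ (LF i))// !(sinnerZl _ (LG i))//.
rewrite !(sinnerZr _ (LF i))// !(sinnerZr _ (LG i))// (sinnerC (G i) (F i)); lra.
Qed.

Lemma dotVC u v : dotV u v = dotV v u.
Proof.
by rewrite dotV.unlock; apply: eq_bigr => i _; apply: eq_bigr => j _; exact: sinnerC.
Qed.

Lemma dotV_ge0 u : 0 <= dotV u u.
Proof.
by rewrite dotV.unlock; do 2!(apply: sumr_ge0 => ? _); exact: sinner_ge0.
Qed.

Lemma dotV_pair u v : dotV u v =
  \sum_(p : 'I_2 * 'I_2) sinner (wD p.2 (component p.1 u)) (wD p.2 (component p.1 v)).
Proof. by rewrite dotV.unlock pair_bigA. Qed.

Lemma VnormE u : Vnorm u = Num.sqrt (dotV u u).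
Proof. by rewrite dotV.unlock. Qed.

Lemma sqr_Vnorm u : Vnorm u ^+ 2 = dotV u u.
Proof. by rewrite VnormE sqr_sqrtr// dotV_ge0. Qed.

Lemma Vnorm_ge0 u : 0 <= Vnorm u. Proof. exact: sqrtr_ge0. Qed.

Lemma norm_ge0 u : 0 <= norm u. Proof. exact: sqrtr_ge0. Qed.

#[local] Opaque Vnorm norm inner.

Lemma L2_wD j i u : Vspace u -> L2 (wD j (component i u)).
Proof. by move=> Vu; apply: wD_L2; exact: Vspace_H1. Qed.

Lemma sinner_wD_lin j i a u v h : Vspace u -> Vspace v -> L2 h ->
  sinner (wD j (component i (a *: u + v))) h =
  a * sinner (wD j (component i u)) h + sinner (wD j (component i v)) h.
Proof.
move=> Vu Vv Lh; have Lu := L2_wD j i Vu; have Lv := L2_wD j i Vv.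
rewrite -(sinnerZl a Lu Lh) -(sinnerDl (L2_scale a Lu) Lv Lh).
apply: eq_sinner => //.
- by apply: L2_wD; exact: Vspace_lin.
- exact: L2_add (L2_scale a Lu) Lv.
- by rewrite component_lin; apply: wD_lin; exact: Vspace_H1.
- exact: aeW.
Qed.

Lemma dotV_linl a u v w : Vspace u -> Vspace v -> Vspace w ->
  dotV (a *: u + v) w = a * dotV u w + dotV v w.
Proof.
move=> Vu Vv Vw; rewrite dotV.unlock mulr_sumr -big_split; apply: eq_bigr => i _ /=.
rewrite mulr_sumr -big_split; apply: eq_bigr => j _ /=.
by rewrite sinner_wD_lin//; exact: L2_wD.
Qed.

Lemma dotVDl u v w : Vspace u -> Vspace v -> Vspace w -> dotV (u + v) w = dotV u w + dotV v w.
Proof. by move=> *; rewrite -[u]scale1r dotV_linl// mul1r scale1r. Qed.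

Lemma dotVBl u v w : Vspace u -> Vspace v -> Vspace w -> dotV (u - v) w = dotV u w - dotV v w.
Proof. by move=> *; rewrite addrC -scaleN1r dotV_linl// mulN1r addrC. Qed.

Lemma dotVDr u v w : Vspace u -> Vspace v -> Vspace w -> dotV w (u + v) = dotV w u + dotV w v.
Proof. by move=> *; rewrite dotVC dotVDl// !(dotVC w). Qed.

Lemma dotV_CS u v : Vspace u -> Vspace v -> `|dotV u v| <= Vnorm u * Vnorm v.
Proof.
move=> Vu Vv; rewrite -(@ler_pXn2r _ 2)// ?nnegrE ?mulr_ge0 ?Vnorm_ge0//.
have := sqr_Vnorm u; have := sqr_Vnorm v.
move: (Vnorm u) (Vnorm v) => a b Eb Ea; rewrite (real_normK (num_real _)) exprMn Ea Eb.
rewrite (dotV_pair u v) (dotV_pair u u) (dotV_pair v v).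
by apply: sum_sinner_CS => p; exact: L2_wD.
Qed.

Lemma inner_CS u v : L2v u -> L2v v -> `|inner u v| <= norm u * norm v.
Proof.
move=> Lu Lv; rewrite -(@ler_pXn2r _ 2)// ?nnegrE ?mulr_ge0 ?norm_ge0//.
by rewrite real_normK ?num_real// exprMn !sqr_norm; exact: sum_sinner_CS.
Qed.

Lemma VnormD u v : Vspace u -> Vspace v -> Vnorm (u + v) <= Vnorm u + Vnorm v.
Proof.
move=> Vu Vv; have Vuv := VspaceD Vu Vv.
rewrite -(@ler_pXn2r _ 2)// ?nnegrE ?addr_ge0 ?Vnorm_ge0//.
rewrite sqr_Vnorm (dotVDl Vu Vv Vuv) (dotVDr Vu Vv Vu) (dotVDr Vu Vv Vv).
have := le_trans (ler_norm _) (dotV_CS Vu Vv).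
have := sqr_Vnorm u; have := sqr_Vnorm v; rewrite (dotVC v u).
move: (Vnorm u) (Vnorm v) (dotV u v) => a b c <- <-.
by rewrite sqrrD; lra.
Qed.

Lemma VnormN u : Vspace u -> Vnorm (- u) = Vnorm u.
Proof.
move=> Vu; have V0 : Vspace (u - u) by exact: VspaceB.
have VN : Vspace (- u) by rewrite -[- u]add0r -(subrr u); exact: VspaceB.
have E w : Vspace w -> dotV (- u) w = - dotV u w.
  move=> Vw; have := dotVBl Vu Vu Vw; rewrite subrr => d0.
  by have := dotVDl Vu VN Vw; rewrite subrr d0; lra.
by rewrite !VnormE E// dotVC E// opprK.
Qed.

Lemma norm_poincare u : Vspace u -> norm u <= Vnorm u.
Proof.
move=> Vu; rewrite -(@ler_pXn2r _ 2)// ?nnegrE ?norm_ge0 ?Vnorm_ge0//.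
rewrite sqr_norm sqr_Vnorm dotV.unlock; apply: ler_sum => i _.
apply: poincare; first exact: Vspace_H1.
by have [[_ /mean_freeE m0 _] _] := Vu; exact: m0.
Qed.

End VectorFields.

(** * The trilinear form and its bounds from Ladyzhenskaya's inequality *)

HB.lock Definition tri {R : realType} (u v w : vfield R) : R :=
  \sum_(p : 'I_2 * 'I_2)
    sinner (wD p.2 (component p.1 v)) (fun x => component p.2 u x * component p.1 w x).

Section TrilinearForm.
Context {R : realType}.
Implicit Types (f g h : sfield R) (u v w phi : vfield R) (k : int * int) (j i : 'I_2)
  (n : nat) (a b c cL : R).

Definition sqv u : sfield R := fun x => \sum_(i < 2) component i u x ^+ 2.

Lemma sqv_ge0 u x : 0 <= sqv u x.
Proof. by apply: sumr_ge0 => i _; exact: sqr_ge0. Qed.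

Lemma measurable_sqv u : L2v u -> measurable_fun setT (sqv u).
Proof.
move=> Lu; rewrite (_ : sqv u = fun x => component ord0 u x ^+ 2 +
    component (lift ord0 ord0) u x ^+ 2).
  by apply: measurable_funD; apply: measurable_funX; apply: L2_measurable.
by apply/funext => x; rewrite /sqv !big_ord_recl big_ord0 addr0.
Qed.

Lemma L4norm_sqv u : L2v u ->
  (L4norm u `^ 4 = \int[@torus R]_x (sqv u x * sqv u x)%:E)%E.
Proof.
move=> Lu; rewrite /L4norm poweR_Lnorm ?lt0r_neq0//.
apply: eq_integral => x _ /=; rewrite ger0_norm ?sqrtr_ge0//; congr (_%:E).
rewrite powR_mulrn ?sqrtr_ge0//.
have -> : \sum_(i < 2) u x 0 i ^+ 2 = sqv u x by [].
by rewrite (exprM _ 2 2) sqr_sqrtr ?sqv_ge0// expr2.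
Qed.

(** The L^4 norm is an extended real; its finiteness is read off from the inequality, whose
    right-hand side is a real number. *)
Lemma ladyzhenskaya_sqv cL u : ladyzhenskaya cL -> Vspace u ->
  L2 (sqv u) /\ sinner (sqv u) (sqv u) <= (cL * Vnorm u * norm u) ^+ 2.
Proof.
move=> /(_ u) H Vu; have Lu := Vspace_L2v Vu; have {H} := H Vu.
set c := cL * Vnorm u * norm u => H.
have N0 : (0 <= L4norm u)%E by exact: Lnorm_ge0.
have I4 := L4norm_sqv Lu.
have [r E r0] : exists2 r, L4norm u = r%:E & 0 <= r.
  move: N0 H; case: (L4norm u) => [r||]//; by exists r.
rewrite E -EFin_expe lee_fin in H.
have {}I4 : (\int[@torus R]_x (sqv u x * sqv u x)%:E = (r ^+ 4)%:E)%E.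
  by rewrite -I4 E poweR_EFin -powR_mulrn.
have L : L2 (sqv u).
  apply/L2P; split; first exact: measurable_sqv.
  apply/integrableP; split.
    by apply/measurable_EFinP; apply: measurable_funX; exact: measurable_sqv.
  rewrite (_ : (\int[_]_x _ = (r ^+ 4)%:E)%E) ?ltry// -I4.
  by apply: eq_integral => x _ /=; rewrite ger0_norm ?sqr_ge0// expr2.
split=> //; rewrite /sinner /Rintegral I4 /=.
rewrite (exprM r 2 2) ler_pXn2r// nnegrE ?sqr_ge0//.
by apply: le_trans H; exact: sqr_ge0.
Qed.

(** This gives [tri] its meaning: the product of two components of fields in V is square integrable
    and can be paired with a derivative in L^2, whereas [advect u v] itself need not be in L^2. *)
Lemma L2_component_mul cL u w i j : ladyzhenskaya cL -> Vspace u -> Vspace w ->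
  L2 (fun x => component i u x * component j w x).
Proof.
move=> H Vu Vw; have [Lu _] := ladyzhenskaya_sqv H Vu.
have [Lw _] := ladyzhenskaya_sqv H Vw; have Luw := L2_add Lu Lw.
have mf : measurable_fun setT (fun x => component i u x * component j w x).
  by apply: measurable_funM; apply: L2_measurable; exact: Vspace_L2v.
apply/L2P; split => //; apply: le_integrable (L2_mul_integrable Luw Luw) => //.
  by apply/measurable_EFinP; exact: measurable_funX.
move=> x _ /=; rewrite lee_fin -expr2 !normrX ler_sqr ?nnegrE//.
rewrite [X in _ <= X]ger0_norm ?addr_ge0 ?sqv_ge0//.
have comp_le z l : `|component l z x| ^+ 2 <= sqv z x.
  rewrite real_normK ?num_real// /sqv (bigD1 l)//= lerDl.
  by apply: sumr_ge0 => m _; exact: sqr_ge0.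
rewrite normrM; have := comp_le u i; have := comp_le w j.
have := sqr_ge0 (`|component i u x| - `|component j w x|).
have := sqv_ge0 u x; have := sqv_ge0 w x.
move: `|component i u x| `|component j w x| (sqv u x) (sqv w x) => a b c d.
by rewrite sqrrB; lra.
Qed.

(** One Cauchy-Schwarz over all index pairs loses no dimensional factor, since the sum of (u_j
    w_i)^2 is |u|^2 |w|^2 pointwise; a second one separates |u|^2 from |w|^2. *)
Lemma tri_bound cL u v w : 0 <= cL -> ladyzhenskaya cL ->
  Vspace u -> Vspace v -> Vspace w ->
  tri u v w ^+ 2 <= dotV v v * (cL * Vnorm u * norm u * (cL * Vnorm w * norm w)).
Proof.
move=> cL0 H Vu Vv Vw; have [Lu Iu] := ladyzhenskaya_sqv H Vu.
have [Lw Iw] := ladyzhenskaya_sqv H Vw.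
have LM (p : 'I_2 * 'I_2) := L2_component_mul p.2 p.1 H Vu Vw.
have LD (p : 'I_2 * 'I_2) : L2 (wD p.2 (component p.1 v)) by exact: L2_wD.
rewrite tri.unlock; apply: le_trans (sum_sinner_CS _ LD LM) _.
rewrite -(dotV_pair v v); apply: ler_wpM2l; first exact: dotV_ge0.
have -> : \sum_(p : 'I_2 * 'I_2) sinner (fun x => component p.2 u x * component p.1 w x)
    (fun x => component p.2 u x * component p.1 w x) = sinner (sqv u) (sqv w).
  rewrite /sinner /Rintegral.
  rewrite (eq_bigr (fun p : 'I_2 * 'I_2 => fine (\int[@torus R]_x
     ((component p.2 u x * component p.1 w x) *
        (component p.2 u x * component p.1 w x))%:E)%E))//.
  rewrite sum_fine; last first.
    by move=> p _; apply: integrable_fin_num => //; exact: (L2_mul_integrable (LM p) (LM p)).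
  rewrite -ge0_integral_sum//; first last.
  - by move=> p x _; rewrite lee_fin -expr2 sqr_ge0.
  - by move=> p; have /integrableP[] := L2_mul_integrable (LM p) (LM p).
  congr fine; apply: eq_integral => x _; rewrite sumEFin; congr (_%:E).
  rewrite /sqv mulr_suml -(pair_bigA _ (fun i j => (component j u x * component i w x) *
    (component j u x * component i w x))) exchange_big /=.
  apply: eq_bigr => i _; rewrite mulr_sumr; apply: eq_bigr => j _; ring.
rewrite -(@ler_pXn2r _ 2)// ?nnegrE.
- apply: le_trans (sinner_CS Lu Lw) _; rewrite exprMn.
  by apply: ler_pM => //; exact: sinner_ge0.
- apply: Rintegral_ge0 => x _; exact: mulr_ge0 (sqv_ge0 _ _) (sqv_ge0 _ _).
- by do ![apply: mulr_ge0 => //]; rewrite ?Vnorm_ge0 ?norm_ge0.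
Qed.

(** Both L^2 norms are given up by Poincare's inequality: boundedness on V is what continuity in the
    dual of V requires. *)
Lemma ladyzhenskaya_tri cL u v w : 0 <= cL -> ladyzhenskaya cL ->
  Vspace u -> Vspace v -> Vspace w ->
  `|tri u v w| <= cL * Vnorm u * Vnorm v * Vnorm w.
Proof.
move=> cL0 H Vu Vv Vw; rewrite -(@ler_pXn2r _ 2)// ?nnegrE; last first.
  by rewrite !mulr_ge0// Vnorm_ge0.
rewrite (real_normK (num_real _)); apply: le_trans (tri_bound cL0 H Vu Vv Vw) _.
have pu := norm_poincare Vu; have pw := norm_poincare Vw.
have := sqr_Vnorm v; have := norm_ge0 u; have := norm_ge0 w.
have := Vnorm_ge0 u; have := Vnorm_ge0 v; have := Vnorm_ge0 w.
move: (Vnorm u) (Vnorm v) (Vnorm w) (norm u) (norm w) pu pw => a b c d e.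
move=> da ec c0 b0 a0 e0 d0 <-.
rewrite (_ : (cL * a * b * c) ^+ 2 = b ^+ 2 * ((cL * a * a) * (cL * c * c))); last by ring.
apply: ler_wpM2l; first exact: sqr_ge0.
by apply: ler_pM; rewrite ?mulr_ge0//; apply: ler_wpM2l => //; exact: mulr_ge0.
Qed.

(** Keeps a factor [norm u], whose low modes are controlled by the nudging term and whose high modes
    by the spectral gap. *)
Lemma ladyzhenskaya_tri_diag cL u v : 0 <= cL -> ladyzhenskaya cL ->
  Vspace u -> Vspace v -> `|tri u v u| <= cL * Vnorm v * Vnorm u * norm u.
Proof.
move=> cL0 H Vu Vv; rewrite -(@ler_pXn2r _ 2)// ?nnegrE; last first.
  by rewrite !mulr_ge0// ?Vnorm_ge0 ?norm_ge0.
rewrite (real_normK (num_real _)); apply: le_trans (tri_bound cL0 H Vu Vv Vu) _.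
rewrite -(sqr_Vnorm v); move: (Vnorm u) (Vnorm v) (norm u) => a b d.
by rewrite (_ : b ^+ 2 * _ = (cL * b * a * d) ^+ 2)//; ring.
Qed.

Lemma tri_linr cL a u v w w' : ladyzhenskaya cL ->
  Vspace u -> Vspace v -> Vspace w -> Vspace w' ->
  tri u v (a *: w + w') = a * tri u v w + tri u v w'.
Proof.
move=> H Vu Vv Vw Vw'; rewrite tri.unlock mulr_sumr -big_split; apply: eq_bigr => p _ /=.
have LD : L2 (wD p.2 (component p.1 v)) by exact: L2_wD.
have Lw := L2_component_mul p.2 p.1 H Vu Vw.
have Lw' := L2_component_mul p.2 p.1 H Vu Vw'.
rewrite -(sinnerZr _ Lw LD) -(sinnerDr (L2_scale a Lw) Lw' LD); congr sinner.
by apply/funext => x; rewrite component_lin; ring.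
Qed.

Lemma tri_linl cL a u u' v w : ladyzhenskaya cL ->
  Vspace u -> Vspace u' -> Vspace v -> Vspace w ->
  tri (a *: u + u') v w = a * tri u v w + tri u' v w.
Proof.
move=> H Vu Vu' Vv Vw; rewrite tri.unlock mulr_sumr -big_split; apply: eq_bigr => p _ /=.
have LD : L2 (wD p.2 (component p.1 v)) by exact: L2_wD.
have Lw := L2_component_mul p.2 p.1 H Vu Vw.
have Lw' := L2_component_mul p.2 p.1 H Vu' Vw.
rewrite -(sinnerZr _ Lw LD) -(sinnerDr (L2_scale a Lw) Lw' LD); congr sinner.
by apply/funext => x; rewrite component_lin; ring.
Qed.

Lemma tri_linm cL a u v v' w : ladyzhenskaya cL ->
  Vspace u -> Vspace v -> Vspace v' -> Vspace w ->
  tri u (a *: v + v') w = a * tri u v w + tri u v' w.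
Proof.
move=> H Vu Vv Vv' Vw; rewrite tri.unlock mulr_sumr -big_split; apply: eq_bigr => p _ /=.
by apply: sinner_wD_lin => //; exact: (L2_component_mul p.2 p.1 H Vu Vw).
Qed.

Lemma triBr cL u v w w' : ladyzhenskaya cL ->
  Vspace u -> Vspace v -> Vspace w -> Vspace w' ->
  tri u v (w - w') = tri u v w - tri u v w'.
Proof. by move=> H *; rewrite addrC -scaleN1r (tri_linr _ H)// mulN1r addrC. Qed.

Lemma triBl cL u u' v w : ladyzhenskaya cL ->
  Vspace u -> Vspace u' -> Vspace v -> Vspace w ->
  tri (u - u') v w = tri u v w - tri u' v w.
Proof. by move=> H *; rewrite addrC -scaleN1r (tri_linl _ H)// mulN1r addrC. Qed.

Lemma triBm cL u v v' w : ladyzhenskaya cL ->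
  Vspace u -> Vspace v -> Vspace v' -> Vspace w ->
  tri u (v - v') w = tri u v w - tri u v' w.
Proof. by move=> H *; rewrite addrC -scaleN1r (tri_linm _ H)// mulN1r addrC. Qed.

Lemma inner_advect cL u v w : ladyzhenskaya cL -> L2v (advect u v) ->
  Vspace u -> Vspace v -> Vspace w -> inner (advect u v) w = tri u v w.
Proof.
move=> H La Vu Vv Vw; rewrite tri.unlock.
rewrite -(pair_bigA _ (fun i j => sinner (wD j (component i v))
   (fun x => component j u x * component i w x))) /=.
rewrite /inner; apply: eq_bigr => i _.
transitivity (sinner (fun x => \sum_(j < 2) wD j (component i v) x *
    (component j u x * component i w x)) (cst 1)).
  apply: eq_Rintegral => x _; rewrite mulr1 /component /advect mxE mulr_suml.
  by apply: eq_bigr => j _; ring.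
rewrite /sinner.
transitivity (\sum_(j < 2) \int[@torus R]_x (wD j (component i v) x *
    (component j u x * component i w x))).
  rewrite !big_ord_recl big_ord0 addr0 -RintegralD//.
  - by apply: eq_Rintegral => x _; rewrite mulr1 !big_ord_recl big_ord0 addr0.
  - apply: L2_mul_integrable; first exact: L2_wD.
    exact: (L2_component_mul _ _ H Vu Vw).
  - apply: L2_mul_integrable; first exact: L2_wD.
    exact: (L2_component_mul _ _ H Vu Vw).
by [].
Qed.

End TrilinearForm.

(** * The truncation P_N on V, its quadratic form [pn], and the cancellation b(u, w, w) = 0 *)

HB.lock Definition pn {R : realType} (n : nat) (u v : vfield R) : R :=
  \sum_(i < 2) specsum n (component i u) (component i v).

Section Galerkin.
Context {R : realType}.
Implicit Types (f g h : sfield R) (u v w phi : vfield R) (k : int * int) (j i : 'I_2)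
  (n : nat) (a b c cL : R).

#[local] Opaque Vnorm norm inner.

Lemma component_PN n i w : L2v w ->
  component i (PN n w) = teval (proj n (component i w)).
Proof.
move=> Lw; apply/funext => x; rewrite /component /PN mxE.
rewrite fsbig_finite; last exact: finite_ball_waves.
rewrite /teval /proj big_map -/(waves n); apply: eq_bigr => k _.
have Li := Lw i; have Lc := L2_cosw (R := R) k; have Ls := L2_sinw (R := R) k.
have -> : (fun y => cos (phase k (x - y))) =
    fun y => cosw k x * cosw k y + sinw k x * sinw k y :> R.
  by apply/funext => y; rewrite phaseB cosB.
rewrite (sinnerDr (L2_scale _ Lc) (L2_scale _ Ls) Li) !(sinnerZr _ _ Li)//.
by rewrite /tterm /= /component; ring.
Qed.

Lemma wD_PN n i j w : Vspace w ->
  wD j (component i (PN n w)) = teval (proj n (wD j (component i w))) %[ae @torus R].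
Proof.
move=> Vw; have Hw := Vspace_H1 i Vw.
rewrite component_PN; last exact: Vspace_L2v.
by apply: wD_ae; [exact: H1_proj|exact: L2_teval|exact: proj_wderiv].
Qed.

Lemma Vspace_PN n w : Vspace w -> Vspace (PN n w).
Proof.
move=> Vw; have Lw := Vspace_L2v Vw; have [[_ mw dw] Hw] := Vw.
split; last by move=> i; rewrite component_PN//; exact: H1_proj.
split.
- by move=> i; rewrite component_PN//; exact: L2_teval.
- apply/mean_freeE => i; rewrite component_PN// proj_cosw//.
  by move/mean_freeE : mw => ->; case: ifP.
- move=> k; have [d1 d2] := dw k; split.
    rewrite (eq_bigr (fun j => (k \in waves n)%:R *
        (wave k j * sinner (component j w) (cosw k)))) => [|j _].
      by rewrite -mulr_sumr [X in _ * X]d1 mulr0.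
    rewrite component_PN// -/(cosw k) proj_cosw//.
    by case: ifP => _; rewrite /= ?mulr0 ?mul0r ?mul1r.
  rewrite (eq_bigr (fun j => (k \in waves n)%:R *
      (wave k j * sinner (component j w) (sinw k)))) => [|j _].
    by rewrite -mulr_sumr [X in _ * X]d2 mulr0.
  rewrite component_PN// -/(sinw k) proj_sinw//.
  by case: ifP => _; rewrite /= ?mulr0 ?mul0r ?mul1r.
Qed.

(** Truncation commutes with weak derivatives, so this is the convergence of the Fourier series of
    each derivative. *)
Lemma Vnorm_PN_cvg w : Vspace w -> Vnorm (w - PN n w) @[n --> \oo] --> (0 : R).
Proof.
move=> Vw; suff H : dotV (w - PN n w) (w - PN n w) @[n --> \oo] --> (0 : R).
  rewrite (_ : (fun n => _) = fun n => Num.sqrt (dotV (w - PN n w) (w - PN n w))).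
    have := cvg_comp _ _ H (@sqrt_continuous R 0).
    by rewrite sqrtr0.
  by apply/funext => n; rewrite VnormE.
rewrite (_ : (fun n => _) = fun n => \sum_(p : 'I_2 * 'I_2)
   (sinner (wD p.2 (component p.1 w)) (wD p.2 (component p.1 w)) -
    specsum n (wD p.2 (component p.1 w)) (wD p.2 (component p.1 w)))); last first.
  apply/funext => n; rewrite dotV_pair; apply: eq_bigr => p _; set g := component p.1 w.
  have Hg : H1 g by exact: Vspace_H1.
  have LD : L2 (wD p.2 g) by exact: wD_L2.
  have VP := Vspace_PN n Vw.
  rewrite -proj_residual//; have Lr := L2_sub LD (L2_teval (proj n (wD p.2 g))).
  have L' : L2 (wD p.2 (component p.1 (w - PN n w))).
    by apply: L2_wD; exact: VspaceB.
  have E : wD p.2 (component p.1 (w - PN n w)) =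
      (fun x => wD p.2 g x - teval (proj n (wD p.2 g)) x) %[ae @torus R].
    have := wD_lin p.2 (-1) (Vspace_H1 p.1 VP) Hg.
    have := wD_PN n p.1 p.2 Vw; rewrite -/g => E1 E2.
    apply: (torus_aeS2 _ E1 E2) => x /(_ I) e1 /(_ I) e2 _.
    rewrite componentB -/g.
    rewrite (_ : (fun y => g y - component p.1 (PN n w) y) =
      (fun y => -1 * component p.1 (PN n w) y + g y)); last first.
      by apply/funext => y; rewrite mulN1r addrC.
    by rewrite e2 e1 mulN1r addrC.
  exact: eq_sinner.
have cv (p : 'I_2 * 'I_2) := proj_residual_cvg (wD_L2 p.2 (Vspace_H1 p.1 Vw)).
have E : (0 : R) = \sum_(p : 'I_2 * 'I_2) 0 by rewrite big1.
by rewrite [in X in _ --> X]E; apply: cvg_big => [|p _]; [exact: add_continuous|exact: cv].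
Qed.

Lemma div_free_tderiv u (s : tpoly R) : L2v u -> div_free u ->
  \sum_(j < 2) sinner (teval (tderiv j s)) (component j u) = 0.
Proof.
move=> Lu du; rewrite (eq_bigr (fun j => \sum_(m <- s)
   (m.2.2 * (wave m.1 j * sinner (component j u) (cosw m.1)) -
    m.2.1 * (wave m.1 j * sinner (component j u) (sinw m.1))))) => [|j _]; last first.
  rewrite (sinner_teval _ (Lu j)) big_map; apply: eq_bigr => m _ /=; ring.
rewrite exchange_big big1//= => m _; have [d1 d2] := du m.1.
by rewrite sumrB -!mulr_sumr [X in _ * X - _]d1 [X in _ - _ * X]d2 !mulr0 subrr.
Qed.

(* For a trigonometric polynomial w, the integrand u . grad (|w|^2 / 2) is the
   pairing of u with the gradient of a trigonometric polynomial. *)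
Lemma tri_PN_diag0 cL n u w : ladyzhenskaya cL -> Vspace u -> Vspace w ->
  tri u (PN n w) (PN n w) = 0.
Proof.
move=> H Vu Vw; have VP := Vspace_PN n Vw; have Lw := Vspace_L2v Vw.
rewrite tri.unlock.
rewrite -(pair_bigA _ (fun i j => sinner (wD j (component i (PN n w)))
  (fun x => component j u x * component i (PN n w) x))) /=.
apply: big1 => i _; have Hw := Vspace_H1 i Vw.
pose s := proj n (component i w).
have Lu := Vspace_L2v Vu; have [_ _ du] := Vspace_Hspace Vu.
rewrite (eq_bigr (fun j => 2^-1 * sinner (teval (tderiv j (tmul s s))) (component j u))).
  by rewrite -mulr_sumr div_free_tderiv ?mulr0.
move=> j _; have LM := L2_component_mul j i H Vu VP.
have Ls := L2_teval s; have Lt := L2_teval (tderiv j s).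
transitivity (sinner (teval (tderiv j s)) (fun x => component j u x * teval s x)).
  apply: eq_sinner => //.
  - exact: L2_wD.
  - by rewrite -component_PN.
  - by rewrite /s tderiv_proj//; exact: wD_PN.
  - by apply: aeW => x; rewrite component_PN.
rewrite -sinnerZl//; last exact: L2_teval.
by apply: eq_Rintegral => x _; rewrite teval_deriv_mul; lra.
Qed.

(** The diagonal vanishes at P_n w. Splitting w leaves b(u, w - P_n w, w) + b(u, P_n w, w - P_n w),
    and both terms are small because the form is bounded on V. *)
Lemma tri_diag0 cL u w : 0 <= cL -> ladyzhenskaya cL -> Vspace u -> Vspace w ->
  tri u w w = 0.
Proof.
have aux (x y z t : R) : 0 <= y -> 0 <= z -> x <= t + z ->
    y * z * t + y * x * z <= y * z * (2 * t + z).
  by move=> y0 z0 h; have := ler_wpM2l (mulr_ge0 y0 z0) h; lra.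
move=> cL0 H Vu Vw.
pose r n := Vnorm (w - PN n w).
have b n : `|tri u w w| <= cL * Vnorm u * r n * (2 * Vnorm w + r n).
  have VP := Vspace_PN n Vw; have Vd := VspaceB Vw VP.
  have -> : tri u w w = tri u (w - PN n w) w + tri u (PN n w) (w - PN n w).
    rewrite (triBm H Vu Vw VP Vw) (triBr H Vu VP Vw VP) (tri_PN_diag0 n H Vu Vw).
    by rewrite subr0 subrK.
  apply: le_trans (ler_normD _ _) _.
  have t1 := ladyzhenskaya_tri cL0 H Vu Vd Vw.
  have t2 := ladyzhenskaya_tri cL0 H Vu VP Vd.
  have t3 : Vnorm (PN n w) <= Vnorm w + r n.
    have -> : PN n w = w + - (w - PN n w) by rewrite opprB addrC subrK.
    have VN : Vspace (- (w - PN n w)) by rewrite opprB; exact: VspaceB.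
    by apply: (le_trans (VnormD Vw VN)); rewrite (VnormN Vd) lexx.
  apply: le_trans (lerD t1 t2) _; rewrite -/(r n).
  have cu : 0 <= cL * Vnorm u by rewrite mulr_ge0 ?Vnorm_ge0.
  have r0 : 0 <= r n by exact: Vnorm_ge0.
  exact: aux.
apply/normr0_eq0/le_anti; rewrite normr_ge0 andbT.
have rc : r n @[n --> \oo] --> (0 : R) by exact: Vnorm_PN_cvg.
have cv : cL * Vnorm u * r n * (2 * Vnorm w + r n) @[n --> \oo] --> (0 : R).
  rewrite (_ : 0 = cL * Vnorm u * 0 * (2 * Vnorm w + 0)); last by rewrite mulr0 mul0r.
  apply: cvgM; first by apply: cvgM => //; exact: cvg_cst.
  by apply: cvgD => //; exact: cvg_cst.
rewrite -(cvg_lim (@Rhausdorff R) cv); apply: limr_ge; last exact: nearW.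
by apply/cvg_ex; exists 0.
Qed.

Lemma inner_PN n u v : L2v u -> L2v v -> inner (PN n u) v = pn n u v.
Proof.
move=> Lu Lv; rewrite pn.unlock; apply: eq_bigr => i _.
by rewrite component_PN// sinner_proj.
Qed.

Lemma pnC n u v : pn n u v = pn n v u.
Proof. by rewrite pn.unlock; apply: eq_bigr => i _; exact: specsumC. Qed.

Lemma pn_linr n a u v w : L2v u -> L2v v -> L2v w ->
  pn n w (a *: u + v) = a * pn n w u + pn n w v.
Proof.
move=> Lu Lv Lw; rewrite pn.unlock mulr_sumr -big_split; apply: eq_bigr => i _ /=.
have Li := Lu i; have Lj := Lv i; have Lk := L2_teval (proj n (component i w)).
rewrite -!sinner_proj//; last first.
  by rewrite component_lin; apply: L2_add => //; exact: L2_scale.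
by rewrite component_lin (sinnerDr (L2_scale a Li) Lj Lk) (sinnerZr _ Li Lk).
Qed.

Lemma pnBl n u v w : L2v u -> L2v v -> L2v w ->
  pn n (u - v) w = pn n u w - pn n v w.
Proof.
by move=> *; rewrite pnC addrC -scaleN1r pn_linr// mulN1r addrC !(pnC n w).
Qed.

Lemma pn_ge0 n u : 0 <= pn n u u.
Proof. by rewrite pn.unlock; apply: sumr_ge0 => i _; exact: specsum_ge0. Qed.

Lemma pn_le n u : L2v u -> pn n u u <= norm u ^+ 2.
Proof.
by move=> Lu; rewrite sqr_norm pn.unlock; apply: ler_sum => i _; exact: bessel.
Qed.

Lemma pn_CS n u v : L2v u -> L2v v -> pn n u v ^+ 2 <= pn n u u * pn n v v.
Proof.
move=> Lu Lv; apply: form_CS => s t.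
have E w : L2v w -> pn n w (s *: u + t *: v) = s * pn n w u + t * pn n w v.
  move=> Lw; rewrite (pn_linr _ _ Lu (L2vZ t Lv) Lw); congr (_ + _).
  have L0 : L2v (0 : vfield R).
    by move=> i; rewrite (_ : component i 0 = cst 0);
      [exact: L2_cst|apply/funext => x; rewrite /component mxE].
  have z : pn n w 0 = 0.
    by have := pn_linr n 1 L0 L0 Lw; rewrite scale1r addr0 mul1r => /(canLR (addrK _)); rewrite subrr.
  by rewrite -[t *: v]addr0 (pn_linr _ _ Lv L0 Lw) z addr0.
have Ls : L2v (s *: u + t *: v) by apply: L2v_lin => //; exact: L2vZ.
have := pn_ge0 n (s *: u + t *: v).
rewrite (E _ Ls) (pnC n _ u) (pnC n _ v) (E u Lu) (E v Lv) (pnC n v u).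
by move: (pn n u u) (pn n u v) (pn n v v) => x y z; lra.
Qed.

Lemma pn_gap n u : Vspace u -> n%:R ^+ 2 * (norm u ^+ 2 - pn n u u) <= Vnorm u ^+ 2.
Proof.
move=> Vu; rewrite sqr_norm sqr_Vnorm pn.unlock dotV.unlock.
have -> : inner u u - \sum_(i < 2) specsum n (component i u) (component i u) =
    \sum_(i < 2) (sinner (component i u) (component i u) -
       specsum n (component i u) (component i u)) by rewrite sumrB.
rewrite mulr_sumr; apply: ler_sum => i _.
exact: spectral_gap (Vspace_H1 i Vu).
Qed.

Lemma L2v_stokes u : DA u -> L2v (stokes u).
Proof.
move=> [Vu Hu] i; rewrite (_ : component i _ =
    fun x => - \sum_(j < 2) wD j (wD j (component i u)) x); last first.
  by apply/funext => x; rewrite /component mxE.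
by apply: L2_opp; apply: L2_sum => j _; apply: wD_L2; case: (Hu i) => _; exact.
Qed.

Lemma inner_stokes u phi : DA u -> Vspace phi -> inner (stokes u) phi = dotV u phi.
Proof.
move=> [Vu Hu] Vphi; rewrite dotV.unlock; apply: eq_bigr => i _.
have Hi := Vspace_H1 i Vphi; have Li := H1_L2 Hi.
have HD j : H1 (wD j (component i u)) by case: (Hu i) => _; exact.
have LD j : L2 (wD j (wD j (component i u))) by exact: wD_L2.
rewrite (_ : component i (stokes u) =
    fun x => - \sum_(j < 2) wD j (wD j (component i u)) x); last first.
  by apply/funext => x; rewrite /component mxE.
rewrite sinnerNl//; last by apply: L2_sum => j _; exact: LD.
rewrite sinner_suml//.
by rewrite -sumrN; apply: eq_bigr => j _; rewrite wD_parts// opprK.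
Qed.

End Galerkin.

(** * Continuous paths in V and in its dual *)

Section DualPaths.
Context {R : realType}.
Implicit Types (u v w : R -> vfield R) (psi phi f : vfield R) (n : nat) (a b c e t s cL : R)
  (F G : R -> vfield R -> R).

#[local] Opaque Vnorm norm inner.

Definition V_path u : Prop := (forall t, 0 <= t -> Vspace (u t)) /\
  forall t, 0 <= t -> Vnorm (u s - u t) @[s --> within `[0, +oo[ (nbhs t)] --> (0 : R).

(* A continuous path in the dual of V, for the norm topology. *)
Record dual_path F : Prop := DualPath {
  dual_lin : forall t a psi phi, 0 <= t -> Vspace psi -> Vspace phi ->
    F t (a *: psi + phi) = a * F t psi + F t phi;
  dual_bounded : forall t, 0 <= t ->
    exists K, forall psi, Vspace psi -> `|F t psi| <= K * Vnorm psi;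
  dual_continuous : forall t, 0 <= t -> forall e, 0 < e ->
    \forall s \near within `[0, +oo[ (nbhs t), forall psi, Vspace psi ->
      `|F s psi - F t psi| <= e * Vnorm psi }.

Lemma dual_path_lin a F G : dual_path F -> dual_path G ->
  dual_path (fun t psi => a * F t psi + G t psi).
Proof.
have aux (x y x' y' d V : R) : 0 < d -> 0 <= V -> `|x - x'| <= d / 2 / (`|a| + 1) * V ->
    `|y - y'| <= d / 2 * V -> `|a * x + y - (a * x' + y')| <= d * V.
  move=> d0 V0 h1 h2.
  rewrite (_ : _ - _ = a * (x - x') + (y - y')); last by ring.
  apply: le_trans (ler_normD _ _) _; rewrite normrM.
  have a1 : 0 < `|a| + 1 by rewrite ltr_wpDl.
  have h3 : `|a| * `|x - x'| <= (`|a| + 1) * (d / 2 / (`|a| + 1) * V).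
    by apply: ler_pM => //; rewrite lerDl.
  rewrite (_ : (`|a| + 1) * _ = d / 2 * V) in h3; last by field; rewrite gt_eqF.
  by have := lerD h3 h2; lra.
move=> [Fl Fb Fc] [Gl Gb Gc]; split.
- by move=> t b psi phi t0 Vp Vq; rewrite Fl// Gl//; ring.
- move=> t t0; have [K HK] := Fb t t0; have [L HL] := Gb t t0.
  exists (`|a| * K + L) => psi Vp; apply: le_trans (ler_normD _ _) _.
  by rewrite normrM mulrDl lerD ?HL// -mulrA ler_wpM2l ?HK.
- move=> t t0 e e0; have a1 : 0 < `|a| + 1 by rewrite ltr_wpDl.
  have e1 : 0 < e / 2 / (`|a| + 1) by rewrite !divr_gt0.
  have e2 : 0 < e / 2 by rewrite divr_gt0.
  near=> s => psi Vp.
  have h1 : forall psi, Vspace psi -> `|F s psi - F t psi| <= e / 2 / (`|a| + 1) * Vnorm psi.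
    by near: s; exact: Fc.
  have h2 : forall psi, Vspace psi -> `|G s psi - G t psi| <= e / 2 * Vnorm psi.
    by near: s; exact: Gc.
  exact: (aux _ _ _ _ _ _ e0 (Vnorm_ge0 psi) (h1 psi Vp) (h2 psi Vp)).
Unshelve. all: by end_near. Qed.

Lemma dual_continuous_majorant F t (r : R -> R) :
  r s @[s --> within `[0, +oo[ (nbhs t)] --> (0 : R) ->
  (forall s, 0 <= s -> forall psi, Vspace psi -> `|F s psi - F t psi| <= r s * Vnorm psi) ->
  forall e, 0 < e -> \forall s \near within `[0, +oo[ (nbhs t), forall psi, Vspace psi ->
      `|F s psi - F t psi| <= e * Vnorm psi.
Proof.
move=> r0 H e e0; near=> s => psi Vp.
have s0 : 0 <= s.
  have : `[0, +oo[%classic s by near: s; exact: withinT.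
  by rewrite /= in_itv/= andbT.
apply: le_trans (H s s0 psi Vp) _; apply: ler_wpM2r; first exact: Vnorm_ge0.
apply: le_trans (ler_norm _) _; rewrite -[r s]subr0 distrC.
by near: s; move/cvgrPdist_le : r0; exact.
Unshelve. all: by end_near. Qed.

Lemma dual_path_inner f : L2v f -> dual_path (fun=> inner f).
Proof.
move=> Lf; split.
- move=> t a psi phi _ Vp Vq; rewrite !(innerC f) inner_linl//; exact: Vspace_L2v.
- move=> t _; exists (norm f) => psi Vp; apply: le_trans (inner_CS Lf (Vspace_L2v Vp)) _.
  by apply: ler_wpM2l; [exact: norm_ge0|exact: norm_poincare].
- move=> t _ e e0; near=> s => psi _.
  by rewrite subrr normr0 mulr_ge0 ?Vnorm_ge0// ltW.
Unshelve. all: by end_near. Qed.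

Lemma dual_path_dotV u : V_path u -> dual_path (fun t => dotV (u t)).
Proof.
move=> [Vu cu]; split.
- by move=> t a psi phi t0 Vp Vq; rewrite !(dotVC (u t)) dotV_linl//; exact: Vu.
- by move=> t t0; exists (Vnorm (u t)) => psi; apply: dotV_CS; exact: Vu.
- move=> t t0; apply: dual_continuous_majorant (cu t t0) _ => s s0 psi Vp.
  have V1 := Vu s s0; have V2 := Vu t t0.
  by rewrite -(dotVBl V1 V2 Vp); apply: dotV_CS => //; exact: VspaceB.
Qed.

Lemma pn_bound n psi phi : Vspace psi -> Vspace phi ->
  `|pn n psi phi| <= Vnorm psi * Vnorm phi.
Proof.
move=> Vp Vq; have Lp := Vspace_L2v Vp; have Lq := Vspace_L2v Vq.
rewrite -(@ler_pXn2r _ 2)// ?nnegrE ?mulr_ge0 ?Vnorm_ge0//.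
rewrite (real_normK (num_real _)) exprMn; apply: le_trans (pn_CS n Lp Lq) _.
have sq z : Vspace z -> pn n z z <= Vnorm z ^+ 2.
  move=> Vz; apply: le_trans (pn_le n (Vspace_L2v Vz)) _.
  by rewrite ler_pXn2r ?nnegrE ?norm_ge0 ?Vnorm_ge0 ?norm_poincare.
by apply: ler_pM; rewrite ?pn_ge0 ?sq.
Qed.

Lemma dual_path_pn n u : V_path u -> dual_path (fun t => pn n (u t)).
Proof.
move=> [Vu cu]; split.
- by move=> t a psi phi t0 Vp Vq; rewrite pn_linr//; apply: Vspace_L2v => //; exact: Vu.
- by move=> t t0; exists (Vnorm (u t)) => psi; apply: pn_bound; exact: Vu.
- move=> t t0; apply: dual_continuous_majorant (cu t t0) _ => s s0 psi Vp.
  have V1 := Vu s s0; have V2 := Vu t t0.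
  rewrite -(pnBl n (Vspace_L2v V1) (Vspace_L2v V2) (Vspace_L2v Vp)).
  by apply: pn_bound => //; exact: VspaceB.
Qed.

Lemma dual_path_tri cL u v : 0 <= cL -> ladyzhenskaya cL -> V_path u -> V_path v ->
  dual_path (fun t => tri (u t) (v t)).
Proof.
have aux2 (c X Ys Yt d d' V p q : R) : 0 <= c -> 0 <= d -> 0 <= V ->
    Ys <= Yt + d' -> p <= c * d * Ys * V -> q <= c * X * d' * V ->
    p + q <= c * (d * (Yt + d') + X * d') * V.
  move=> c0 d0 V0 h hp hq; apply: le_trans (lerD hp hq) _.
  have := ler_wpM2l (mulr_ge0 (mulr_ge0 c0 d0) V0) h; lra.
have aux3 (Q : set_system R) (c a b : R) (p q : R -> R) : Filter Q ->
    p @ Q --> 0 -> q @ Q --> 0 -> c * (p s * (a + q s) + b * q s) @[s --> Q] --> 0.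
  move=> FQ p0 q0.
  have -> : 0 = c * (0 * (a + 0) + b * 0) :> R by ring.
  apply: cvgM; first exact: cvg_cst.
  apply: cvgD; last by apply: cvgM => //; exact: cvg_cst.
  by apply: cvgM => //; apply: cvgD => //; exact: cvg_cst.
move=> cL0 H [Vu cu] [Vv cv]; split.
- move=> t a psi phi t0 Vp Vq; apply: (tri_linr a H) => //; [exact: Vu|exact: Vv].
- move=> t t0; exists (cL * Vnorm (u t) * Vnorm (v t)) => psi Vp.
  exact: (ladyzhenskaya_tri cL0 H (Vu t t0) (Vv t t0) Vp).
- move=> t t0; have V1 := Vu t t0; have V2 := Vv t t0.
  (* Comes from b(u_s, v_s) - b(u_t, v_t) = b(u_s - u_t, v_s) + b(u_t, v_s - v_t), with ||v_s||
     bounded by ||v_t|| + ||v_s - v_t||. *)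
  pose r s := cL * (Vnorm (u s - u t) * (Vnorm (v t) + Vnorm (v s - v t)) +
    Vnorm (u t) * Vnorm (v s - v t)).
  apply: (dual_continuous_majorant (r := r)) => [|s s0 psi Vp].
    exact: (aux3 _ _ _ _ _ _ _ (cu t t0) (cv t t0)).
  have W1 := Vu s s0; have W2 := Vv s s0.
  have Vdu := VspaceB W1 V1; have Vdv := VspaceB W2 V2.
  rewrite (_ : tri (u s) (v s) psi - tri (u t) (v t) psi =
    tri (u s - u t) (v s) psi + tri (u t) (v s - v t) psi); last first.
    by rewrite (triBl H W1 V1 W2 Vp) (triBm H V1 W2 V2 Vp); ring.
  apply: le_trans (ler_normD _ _) _.
  have tn : Vnorm (v s) <= Vnorm (v t) + Vnorm (v s - v t).
    by have := VnormD V2 Vdv; rewrite addrC subrK.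
  have p1 := ladyzhenskaya_tri cL0 H Vdu W2 Vp.
  have p2 := ladyzhenskaya_tri cL0 H V1 Vdv Vp.
  exact: (aux2 _ _ _ _ _ _ _ _ _ cL0 (Vnorm_ge0 _) (Vnorm_ge0 _) tn p1 p2).
Qed.

End DualPaths.

(** * Differentiability of the squared distance to a fixed field of V *)

Section EvolutionDerivative.
Context {R : realType}.
Implicit Types (u v w : R -> vfield R) (psi phi f : vfield R) (n : nat) (a b c e t s cL : R)
  (F G : R -> vfield R -> R).

#[local] Opaque Vnorm norm inner.

Lemma is_derive_estimate (g : R -> R) t a :
  (forall e, 0 < e -> \forall s \near t, `|g s - g t - (s - t) * a| <= e * `|s - t|) ->
  is_derive t 1 g a.
Proof.
move=> H; suff cv : (h^-1 *: ((g \o shift t) (h *: 1) - g t)) @[h --> 0^'] --> a.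
  by split; [apply/cvg_ex; exists a|exact: cvg_lim cv].
apply/cvgrPdist_le => e e0; have /nbhs_ballP[d /= d0 B] := H e e0.
near=> h; have h0 : h != 0 by near: h; exact: nbhs_dnbhs_neq.
have hd : `|h| < d by near: h; exact: dnbhs0_lt.
have := B (h + t); rewrite /ball /= addrK => /(_ _) He.
rewrite /GRing.scale /= mulr1; set X := g (h + t) - g t in He *.
rewrite (_ : a - h^-1 * X = - (h^-1 * (X - h * a))); last by field.
rewrite normrN normrM normfV mulrC ler_pdivrMr ?normr_gt0//; apply: He.
by rewrite opprD addrCA subrr addr0 normrN.
Unshelve. all: by end_near. Qed.

Lemma interior_ge0 t : 0 < t -> (`[0, +oo[ : set R)° t.
Proof.
by rewrite interior_itv_bndy /= in_itv/= andbT.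
Qed.

Lemma within_ge0 t (P : R -> Prop) : 0 < t ->
  (\forall s \near within `[0, +oo[ (nbhs t), P s) -> \forall s \near t, P s.
Proof.
move=> t0 H; rewrite /prop_near1 -(within_interior (interior_ge0 t0)).
exact: H.
Qed.

Lemma dual_path_cvg F psi t : dual_path F -> 0 <= t -> Vspace psi ->
  F s psi @[s --> within `[0, +oo[ (nbhs t)] --> F t psi.
Proof.
move=> [_ _ Fc] t0 Vp; apply/cvgrPdist_le => e e0.
have p1 : 0 < Vnorm psi + 1 by rewrite ltr_wpDl// Vnorm_ge0.
have e1 : 0 < e / (Vnorm psi + 1) by rewrite divr_gt0.
apply: filterS (Fc t t0 _ e1) => s Hs; rewrite distrC.
apply: le_trans (Hs psi Vp) _; rewrite mulrAC ler_pdivrMr// ler_wpM2l ?lerDl//.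
exact: ltW.
Qed.

Lemma dual_path_within F psi b : dual_path F -> Vspace psi ->
  {within `[0, b], continuous (fun s => F s psi)}.
Proof.
move=> dF Vp; apply/subspace_continuousP => t /=; rewrite in_itv /= => /andP[t0 _].
apply: cvg_trans (dual_path_cvg dF t0 Vp); apply: cvg_app.
by apply: within_subset => s /=; rewrite !in_itv/= => /andP[->].
Qed.

Lemma dual_path_integrable F psi b : dual_path F -> Vspace psi ->
  (@lebesgue_measure R).-integrable `[0, b] (EFin \o (fun s => F s psi)).
Proof.
move=> dF Vp; apply: continuous_compact_integrable; first exact: segment_compact.
exact: dual_path_within.
Qed.

Lemma dual_path_integral_derive F psi t : dual_path F -> Vspace psi -> 0 < t ->
  is_derive t 1 (fun b => \int[@lebesgue_measure R]_(s in `[0, b]) F s psi) (F t psi).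
Proof.
move=> dF Vp t0; have tt1 : t < t + 1 by rewrite ltrDl.
have ct : {for t, continuous (fun s => F s psi)}.
  by have := dual_path_cvg dF (ltW t0) Vp; rewrite (within_interior (interior_ge0 t0)).
have [D E] := continuous_FTC1_closed tt1 (dual_path_integrable (t + 1) dF Vp) t0 ct.
by split; [exact: D|rewrite -E derive1E].
Qed.

(** The mean value theorem produces a time that depends on [psi], but continuity in the dual norm
    makes the error uniform in [psi]; the lemma is applied to a test field that varies with [s]. *)
Lemma dual_path_increment F t e : dual_path F -> 0 < t -> 0 < e ->
  \forall s \near t, forall psi, Vspace psi ->
    `|\int[@lebesgue_measure R]_(r in `[0, s]) F r psi -
      \int[@lebesgue_measure R]_(r in `[0, t]) F r psi - (s - t) * F t psi| <=
    e * Vnorm psi * `|s - t|.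
Proof.
move=> dF t0 e0; have Fc := within_ge0 t0 (dual_continuous dF (ltW t0) e0).
(* Positivity of [s] is kept because the integral is differentiated at positive times. *)
have /nbhs_ballP[d /= d0 B] : \forall s \near t, 0 < s /\
    forall psi, Vspace psi -> `|F s psi - F t psi| <= e * Vnorm psi.
  by near=> s; split; [near: s; exact: lt_nbhsr|near: s; exact: Fc].
apply/nbhs_ballP; exists d => //= s ds psi Vp.
pose I b := \int[@lebesgue_measure R]_(r in `[0, b]) F r psi.
have seg a b : a <= b -> 0 < a -> exists2 c, c \in `[a, b] & I b - I a = F c psi * (b - a).
  move=> ab a0; apply: (MVT_segment ab) => [x|].
    rewrite in_itv/= => /andP[ax _]; apply: dual_path_integral_derive => //.
    exact: lt_trans ax.
  apply: derivable_within_continuous => x; rewrite in_itv/= => /andP[ax _].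
  have := dual_path_integral_derive dF Vp (lt_le_trans a0 ax).
  by move=> D; exact: ex_derive.
have [s0 _] := B s ds.
have [c cb E] : exists2 c, ball t d c & I s - I t = F c psi * (s - t).
  move: ds; rewrite /ball /= ltr_distlC => /andP[d1 d2]; have [st|/ltW ts] := leP s t.
    have [c] := seg s t st s0; rewrite in_itv/= => /andP[sc ct] E; exists c.
      by rewrite ltr_distlC; apply/andP; split; lra.
    by rewrite -[LHS]opprB E -mulrN opprB.
  have [c] := seg t s ts t0; rewrite in_itv/= => /andP[tc cs] E; exists c => //.
  by rewrite /ball /= ltr_distlC; apply/andP; split; lra.
rewrite -/(I s) -/(I t) E [_ * (s - t)]mulrC -mulrBr normrM mulrC.
by apply: ler_wpM2r => //; have [_] := B c cb; exact.
Unshelve. all: by end_near. Qed.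

(* The weak form, tested against V, of the equation w' = F(t, .). *)
Definition evolves w F := [/\ V_path w, dual_path F & forall t psi, 0 <= t ->
  Vspace psi -> inner (w t) psi = inner (w 0) psi +
    \int[@lebesgue_measure R]_(s in `[0, t]) F s psi].

(** The a.e. equation becomes an identity at every time: under the integral, [dw] may be replaced by
    the continuous [F]. *)
Lemma strong_path_evolves w dw F : strong_path w dw -> dual_path F ->
  {ae @lebesgue_measure R, forall t, 0 <= t ->
     forall psi, Vspace psi -> inner (dw t) psi = F t psi} ->
  evolves w F.
Proof.
move=> [Vw cw _ [_ mdw _] Iw] dF E; split=> // t psi t0 Vp.
rewrite Iw//; last exact: Vspace_Hspace.
congr (_ + fine _); apply: ae_eq_integral => //.
- apply/measurable_EFinP; apply: measurable_funS (mdw psi (Vspace_Hspace Vp)) => //.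
  by move=> s /=; rewrite !in_itv/= => /andP[->].
- by have /integrableP[] := dual_path_integrable t dF Vp.
- apply: (@filterS _ _ (ae_filter_ringOfSetsType _) _ _ _ E) => s Es; rewrite /= in_itv /= => /andP[s0 _].
  by rewrite Es.
Qed.

(** The identity |x|^2 - |y|^2 = (x - y, x + y), arranged so that [psi] and [phi] are paired with
    one common test field. *)
Lemma sqr_norm_diff psi phi f : L2v psi -> L2v phi -> L2v f ->
  norm (psi - f) ^+ 2 - norm (phi - f) ^+ 2 =
  inner psi (psi - f + (phi - f)) - inner phi (psi - f + (phi - f)).
Proof.
move=> Lp Lq Lf; have L1 := L2vD Lp (L2vN Lf); have L2 := L2vD Lq (L2vN Lf).
rewrite !sqr_norm (innerDr L1 L2 Lp) (innerDr L1 L2 Lq).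
rewrite (innerBl Lp Lf L1) (innerBl Lq Lf L2) !(innerBr Lp Lf)// !(innerBr Lq Lf)//.
rewrite (innerC psi phi) (innerC f psi) (innerC f phi); lra.
Qed.

Lemma subr_pair (V : zmodType) (x y z : V) :
  x - z + (y - z) = x - y + ((y - z) + (y - z)).
Proof. by rewrite [RHS]addrA subrKA. Qed.

(** The increment is the integral of F(r, q) from t to s, where q = (w s - psi) + (w t - psi) tends
    in V to 2 (w t - psi). *)
Lemma sqr_norm_is_derive w F psi t : evolves w F -> Vspace psi -> 0 < t ->
  is_derive t 1 (fun s => norm (w s - psi) ^+ 2) (2 * F t (w t - psi)).
Proof.
have aux (i f1 f2 ds V1 V2 W e K : R) : 0 < e -> 0 <= K -> 0 <= W -> 0 <= V1 ->
    `|i - ds * f2| <= e / 2 / (1 + 2 * V1) * V2 * `|ds| ->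
    V2 <= W + 2 * V1 -> W <= 1 -> W <= e / 2 / (K + 1) -> `|f2 - f1| <= K * W ->
    `|i - ds * f1| <= e * `|ds|.
  move=> e0 K0 W0 V0 h1 h2 h3 h4 h5.
  have K1 : 0 < K + 1 by rewrite ltr_wpDl.
  have V3 : 0 < 1 + 2 * V1 by lra.
  rewrite (_ : _ - _ = (i - ds * f2) + ds * (f2 - f1)); last by ring.
  apply: le_trans (ler_normD _ _) _; rewrite normrM.
  have a1 : e / 2 / (1 + 2 * V1) * V2 <= e / 2.
    have : e / 2 / (1 + 2 * V1) * V2 <= e / 2 / (1 + 2 * V1) * (1 + 2 * V1).
      by apply: ler_wpM2l; [rewrite !divr_ge0 ?ltW|lra].
    by rewrite divfK// gt_eqF.
  have a2 : K * W <= e / 2.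
    have : (K + 1) * W <= (K + 1) * (e / 2 / (K + 1)) by apply: ler_wpM2l => //; exact: ltW.
    rewrite (_ : (K + 1) * (e / 2 / (K + 1)) = e / 2); last by field; rewrite gt_eqF.
    by lra.
  have := ler_wpM2r (normr_ge0 ds) a1.
  have := ler_wpM2l (normr_ge0 ds) (le_trans h5 a2); lra.
move=> [[Vw cw] dF Ew] Vp t0; have tt0 := ltW t0.
have [K HK] := dual_bounded dF tt0.
pose d := w t - psi; have Vd : Vspace d by apply: VspaceB => //; exact: Vw.
have K0 : 0 <= `|K| by [].
apply: is_derive_estimate => e e0.
(* Half of the error [e] goes to replacing the integral by (s - t) F(t, q), as ||q|| <= 1 + 2 ||d||
   once ||w s - w t|| <= 1; the other half goes to replacing q by 2 d, at the cost of |K| ||w s - w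
   t||. *)
have e1 : 0 < e / 2 / (1 + 2 * Vnorm d).
  by rewrite !divr_gt0// ltr_pwDl// mulr_ge0 ?Vnorm_ge0.
have e2 : 0 < e / 2 / (`|K| + 1) by rewrite !divr_gt0// ltr_wpDl.
have inc := dual_path_increment dF t0 e1.
have small c : 0 < c -> \forall s \near t, Vnorm (w s - w t) <= c.
  move=> c0; apply: (within_ge0 t0); have /cvgrPdist_le /(_ c c0) := cw t tt0.
  by apply: filterS => s; rewrite sub0r normrN ger0_norm ?Vnorm_ge0.
near=> s.
have s0 : 0 <= s by apply: ltW; near: s; exact: lt_nbhsr.
have Vs := Vw s s0; have Vt := Vw t tt0.
have Vst := VspaceB Vs Vt; have Vsp := VspaceB Vs Vp.
pose q := w s - psi + d; have Vq : Vspace q by exact: VspaceD.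
have q1 : q = (w s - w t) + (d + d) by exact: subr_pair.
have q2 : q = (w s - w t) + 2 *: d by rewrite q1 scaler_nat mulr2n.
have V2 : Vnorm q <= Vnorm (w s - w t) + 2 * Vnorm d.
  rewrite q1; apply: le_trans (VnormD Vst (VspaceD Vd Vd)) _.
  by have := VnormD Vd Vd; move: (Vnorm _) (Vnorm _) (Vnorm d) => x y z; lra.
have f12 : F t q - 2 * F t d = F t (w s - w t).
  by rewrite q2 [X in F t X]addrC (dual_lin dF)// addrAC subrr add0r.
rewrite (sqr_norm_diff (Vspace_L2v Vs) (Vspace_L2v Vt) (Vspace_L2v Vp)).
rewrite -/d -/q (Ew s q s0 Vq) (Ew t q tt0 Vq) opprD addrACA subrr add0r.
apply: (aux _ _ (F t q) _ (Vnorm d) (Vnorm q) (Vnorm (w s - w t)) e `|K|) => //.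
- exact: Vnorm_ge0.
- exact: Vnorm_ge0.
- by move: q Vq {q1 q2 V2 f12}; near: s.
- by near: s; exact: small.
- by near: s; exact: small.
- rewrite f12; apply: le_trans (HK _ Vst) _; apply: ler_wpM2r; first exact: Vnorm_ge0.
  exact: ler_norm.
Unshelve. all: by end_near. Qed.

(** Includes t = 0, where no derivative is available but the decay estimates start. *)
Lemma sqr_norm_within w psi : V_path w -> Vspace psi ->
  {within `[0, +oo[, continuous (fun s => norm (w s - psi) ^+ 2)}.
Proof.
have aux (W V V2 x y : R) : `|x - y| <= W * V2 -> V2 <= W + 2 * V -> 0 <= W ->
    `|y - x| <= W * (W + 2 * V).
  by move=> h1 h2 h3; rewrite distrC; apply: le_trans h1 _; exact: ler_wpM2l.
have aux2 (Q : set_system R) (p : R -> R) (b : R) : Filter Q ->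
    p @ Q --> 0 -> p s * (p s + b) @[s --> Q] --> 0.
  move=> FQ p0; have -> : 0 = 0 * (0 + b) :> R by rewrite mul0r.
  by apply: cvgM => //; apply: cvgD => //; exact: cvg_cst.
move=> [Vw cw] Vp; apply/subspace_continuousP => t /=; rewrite in_itv /= andbT => t0.
have Vt := Vw t t0; pose d := w t - psi; have Vd : Vspace d by exact: VspaceB.
pose r s := Vnorm (w s - w t).
have cr : r s * (r s + 2 * Vnorm d) @[s --> within `[0, +oo[ (nbhs t)] --> (0 : R).
  exact: (aux2 _ _ _ _ (cw t t0)).
apply/cvgrPdist_le => e e0; have /cvgrPdist_le /(_ e e0) := cr.
move=> near_r; near=> s.
have s0 : 0 <= s.
  have : `[0, +oo[%classic s by near: s; exact: withinT.
  by rewrite /= in_itv/= andbT.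
have Vs := Vw s s0; have Vst := VspaceB Vs Vt; have Vsp := VspaceB Vs Vp.
have r0 : 0 <= r s by exact: Vnorm_ge0.
apply: (@le_trans _ _ (r s * (r s + 2 * Vnorm d))); last first.
  apply: le_trans (ler_norm _) _; rewrite -[X in `|X|]subr0 distrC.
  by near: s.
have V2 : Vnorm (w s - psi + d) <= r s + 2 * Vnorm d.
  rewrite /d subr_pair; apply: le_trans (VnormD Vst (VspaceD Vd Vd)) _.
  by have := VnormD Vd Vd; rewrite -/d /r; move: (Vnorm _) (Vnorm _) (Vnorm d) => x y z; lra.
apply: (aux _ _ _ _ _ _ V2 r0).
rewrite (sqr_norm_diff (Vspace_L2v Vs) (Vspace_L2v Vt) (Vspace_L2v Vp)).
have Vq := VspaceD Vsp Vd; rewrite -(innerBl (Vspace_L2v Vs) (Vspace_L2v Vt) (Vspace_L2v Vq)).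
apply: le_trans (inner_CS (Vspace_L2v Vst) (Vspace_L2v Vq)) _.
by apply: ler_pM; rewrite ?norm_ge0 ?norm_poincare.
Unshelve. all: by end_near. Qed.

End EvolutionDerivative.

(** * The equations tested against V *)

Section WeakForms.
Context {R : realType}.
Implicit Types (u v w : R -> vfield R) (psi phi f b x y : vfield R) (n : nat)
  (a c e t s cL nu mu : R) (F G : R -> vfield R -> R).

#[local] Opaque Vnorm norm inner.

Lemma ae_time3 (P Q S T : set (measurableTypeR R)) : (forall t, P t -> Q t -> S t -> T t) ->
  {ae @lebesgue_measure R, forall t, P t} -> {ae @lebesgue_measure R, forall t, Q t} ->
  {ae @lebesgue_measure R, forall t, S t} -> {ae @lebesgue_measure R, forall t, T t}.
Proof. exact: (@filterS3 _ _ (ae_filter_ringOfSetsType (@lebesgue_measure R))). Qed.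

Lemma eq_inner x y psi : L2v x -> L2v y -> L2v psi -> x = y %[ae @torus R] ->
  inner x psi = inner y psi.
Proof.
move=> Lx Ly Lp E; apply: eq_bigr => i _; apply: eq_sinner => //; last exact: aeW.
by apply: (torus_aeS2 _ E E) => z e _ _; rewrite /component e.
Qed.

Lemma innerZl a x psi : L2v x -> L2v psi -> inner (a *: x) psi = a * inner x psi.
Proof.
move=> Lx Lp; have L := L2vN Lx.
rewrite -[a *: x]addr0 -(subrr x) addrA innerBl//; last exact: L2v_lin.
by rewrite inner_linl// addrK.
Qed.

Lemma innerNl x psi : L2v x -> L2v psi -> inner (- x) psi = - inner x psi.
Proof. by move=> Lx Lp; rewrite -scaleN1r innerZl// mulN1r. Qed.

(** Test fields of V already lie in H, so the Leray projection disappears from the pairing. *)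
Lemma is_B_weak cL x y b : ladyzhenskaya cL -> Vspace x -> Vspace y -> is_B x y b ->
  L2v b /\ forall psi, Vspace psi -> inner b psi = tri x y psi.
Proof.
move=> H Vx Vy [La Hb E]; split; first exact: Hspace_L2v.
by move=> psi Vp; rewrite E ?(inner_advect H)//; exact: Vspace_Hspace.
Qed.

Lemma is_DB_weak cL x y b : ladyzhenskaya cL -> Vspace x -> Vspace y -> is_DB x y b ->
  L2v b /\ forall psi, Vspace psi -> inner b psi = tri x y psi + tri y x psi.
Proof.
move=> H Vx Vy [b1 [b2 [B1 B2 ->]]].
have [L1 E1] := is_B_weak H Vx Vy B1; have [L2 E2] := is_B_weak H Vy Vx B2.
split; first exact: L2vD.
by move=> psi Vp; rewrite innerDl ?E1 ?E2//; exact: Vspace_L2v.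
Qed.

Lemma L2v_PN n x : L2v x -> L2v (PN n x).
Proof. by move=> Lx i; rewrite component_PN//; exact: L2_teval. Qed.

Lemma steady_NSE_weak cL nu f x : ladyzhenskaya cL -> Hspace f -> steady_NSE nu f x ->
  Vspace x /\ forall psi, Vspace psi ->
    nu * dotV x psi + tri x x psi = inner f psi.
Proof.
move=> H Hf [Dx [b Bb E]]; have [Vx _] := Dx; split=> // psi Vp.
have [Lb Eb] := is_B_weak H Vx Vx Bb; have Ls := L2v_stokes Dx.
have Lf := Hspace_L2v Hf; have Lp := Vspace_L2v Vp.
have := eq_inner (L2v_lin nu Ls Lb) Lf Lp E.
by rewrite inner_linl// inner_stokes// Eb.
Qed.

Lemma steady_nudged_weak cL nu mu n f x y : ladyzhenskaya cL -> Hspace f -> Vspace x ->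
  steady_nudged nu mu n f x y ->
  Vspace y /\ forall psi, Vspace psi ->
    nu * dotV y psi + tri y y psi + mu * pn n y psi = inner f psi + mu * pn n x psi.
Proof.
move=> H Hf Vx [Dy [b Bb E]]; have [Vy _] := Dy; split=> // psi Vp.
have [Lb Eb] := is_B_weak H Vy Vy Bb; have Ls := L2v_stokes Dy.
have Lf := Hspace_L2v Hf; have Lp := Vspace_L2v Vp.
have Lx := Vspace_L2v Vx; have Ly := Vspace_L2v Vy.
have LPx := L2v_PN n Lx; have LPy := L2v_PN n Ly.
have Lm := L2vZ mu LPy; have Lm' := L2vZ mu LPx; have Ln := L2v_lin nu Ls Lb.
have := eq_inner (L2vD Ln Lm) (L2vD Lf Lm') Lp E.
rewrite (innerDl Ln Lm Lp) (innerDl Lf Lm' Lp) (innerZl _ LPy Lp) (innerZl _ LPx Lp).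
by rewrite (inner_linl _ Ls Lb Lp) (inner_stokes Dy Vp) (Eb _ Vp) !inner_PN.
Qed.

Lemma steady_sensitivity_weak cL nu mu n x y : ladyzhenskaya cL -> DA x ->
  steady_sensitivity nu mu n x y ->
  Vspace y /\ forall psi, Vspace psi ->
    nu * dotV y psi + mu * pn n y psi + (tri x y psi + tri y x psi) = - dotV x psi.
Proof.
have aux (m l p q r s p' q' r' s' : R) : m * p + l * q + r = - s ->
  p = p' -> q = q' -> r = r' -> s = s' -> m * p' + l * q' + r' = - s'.
  by move=> + <- <- <- <-.
move=> H Dx [Dy [b Bb E]]; have [Vy _] := Dy; have [Vx _] := Dx; split=> // psi Vp.
have [Lb Eb] := is_DB_weak H Vx Vy Bb; have Ls := L2v_stokes Dy.
have Lsx := L2v_stokes Dx; have Lp := Vspace_L2v Vp.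
have Ly := Vspace_L2v Vy; have LPy := L2v_PN n Ly; have Lm := L2vZ mu LPy.
have Ln := L2v_lin nu Ls Lm.
have := eq_inner (L2vD Ln Lb) (L2vN Lsx) Lp E.
rewrite (innerDl Ln Lb Lp) innerNl// (inner_linl _ Ls Lm Lp) innerZl//.
move=> {}E.
exact: (aux _ _ _ _ _ _ _ _ _ _ E (inner_stokes Dy Vp) (inner_PN n Ly Lp) (Eb psi Vp)
  (inner_stokes Dx Vp)).
Qed.

(** The right-hand side is nested as a * F + G, with explicit factors -1, to be an iterated instance
    of [dual_path_lin]; the next two equations follow the same pattern. *)
Lemma NSE_evolves cL nu f x u : 0 <= cL -> ladyzhenskaya cL -> Hspace f ->
  NSE_solution nu f x u ->
  evolves u (fun t psi =>
    - nu * dotV (u t) psi + (-1 * tri (u t) (u t) psi + inner f psi)).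
Proof.
move=> cL0 H Hf [du [S E _]]; have [Vu cu [Du _] [Hdu _ _] _] := S.
have pu : V_path u by split.
apply: (strong_path_evolves S).
  apply: dual_path_lin; first exact: dual_path_dotV.
  apply: dual_path_lin; first exact: (dual_path_tri cL0 H).
  by apply: dual_path_inner; exact: Hspace_L2v.
apply: (ae_time3 _ E Du Hdu) => t {}E {}Du {}Hdu t0 psi Vp.
have Vt := Vu t t0; have [b Bb {}E] := E t0; have Ld := Hspace_L2v (Hdu t0).
have [Lb Eb] := is_B_weak H Vt Vt Bb; have Ls := L2v_stokes (Du t0).
have Lf := Hspace_L2v Hf; have Lp := Vspace_L2v Vp.
have Lm := L2vZ nu Ls; have Ln := L2vD Ld Lm.
have := eq_inner (L2vD Ln Lb) Lf Lp E.
rewrite (innerDl Ln Lb Lp) (innerDl Ld Lm Lp) innerZl// (inner_stokes (Du t0) Vp) Eb//.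
move: (inner _ _) (inner _ _) (dotV _ _) (tri _ _ _) => p q r s; lra.
Qed.

Lemma nudged_evolves cL nu mu n f x u v : 0 <= cL -> ladyzhenskaya cL -> Hspace f ->
  V_path u -> nudged_solution nu mu n f u x v ->
  evolves v (fun t psi =>
    - nu * dotV (v t) psi + (-1 * tri (v t) (v t) psi +
    (- mu * pn n (v t) psi + (mu * pn n (u t) psi + inner f psi)))).
Proof.
move=> cL0 H Hf pu [dv [S E _]]; have [Vv cv [Dv _] [Hdv _ _] _] := S.
have pv : V_path v by split.
apply: (strong_path_evolves S).
  apply: dual_path_lin; first exact: dual_path_dotV.
  apply: dual_path_lin; first exact: (dual_path_tri cL0 H).
  apply: dual_path_lin; first exact: dual_path_pn.
  apply: dual_path_lin; first exact: dual_path_pn.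
  by apply: dual_path_inner; exact: Hspace_L2v.
apply: (ae_time3 _ E Dv Hdv) => t {}E {}Dv {}Hdv t0 psi Vp.
have Vt := Vv t t0; have [b Bb {}E] := E t0; have Ld := Hspace_L2v (Hdv t0).
have [Lb Eb] := is_B_weak H Vt Vt Bb; have Ls := L2v_stokes (Dv t0).
have Lf := Hspace_L2v Hf; have Lp := Vspace_L2v Vp; have Lv := Vspace_L2v Vt.
have [Vu _] := pu; have Lu := Vspace_L2v (Vu t t0).
have Lm := L2vZ nu Ls; have Ln := L2vD Ld Lm.
have P1 := L2vZ mu (L2v_PN n Lv); have P2 := L2vZ mu (L2v_PN n Lu).
have Q1 := L2vN P1; have Q2 := L2vD Lf Q1.
have := eq_inner (L2vD Ln Lb) (L2vD Q2 P2) Lp E.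
rewrite (innerDl Ln Lb Lp) (innerDl Ld Lm Lp) (innerZl _ Ls Lp) (inner_stokes (Dv t0) Vp) Eb//.
rewrite (innerDl Q2 P2 Lp) (innerBl Lf P1 Lp) (innerZl _ (L2v_PN n Lv) Lp).
rewrite (innerZl _ (L2v_PN n Lu) Lp) (inner_PN n Lv Lp) (inner_PN n Lu Lp).
move: (inner _ _) (inner _ _) (dotV _ _) (tri _ _ _) (pn _ _ _) (pn _ _ _) => p q r s k l.
lra.
Qed.

Lemma sensitivity_evolves cL nu mu n v w : 0 <= cL -> ladyzhenskaya cL ->
  V_path v -> {ae @lebesgue_measure R, forall t, 0 <= t -> DA (v t)} ->
  sensitivity_solution nu mu n v w ->
  evolves w (fun t psi =>
    - nu * dotV (w t) psi + (-1 * tri (v t) (w t) psi + (-1 * tri (w t) (v t) psi +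
    (- mu * pn n (w t) psi + (-1 * dotV (v t) psi + 0))))).
Proof.
move=> cL0 H pv Dv [dw [S E _]]; have [Vw cw [Dw _] [Hdw _ _] _] := S.
have pw : V_path w by split.
apply: (strong_path_evolves S).
  apply: dual_path_lin; first exact: dual_path_dotV.
  apply: dual_path_lin; first exact: (dual_path_tri cL0 H).
  apply: dual_path_lin; first exact: (dual_path_tri cL0 H).
  apply: dual_path_lin; first exact: dual_path_pn.
  apply: dual_path_lin; first exact: dual_path_dotV.
  (* The final [+ 0] is the zero path that ends the chain. *)
  split=> [*|t t0|t t0 e e0]; first by rewrite mulr0 addr0.
    by exists 0 => *; rewrite normr0 mul0r.
  by near=> s => psi _; rewrite subrr normr0 (mulr_ge0 (ltW e0) (Vnorm_ge0 _)).
have Dvw : {ae @lebesgue_measure R, forall t, 0 <= t -> DA (v t) /\ DA (w t)}.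
  by apply: (ae_time3 _ Dv Dw Dw) => t D1 D2 _ t0; split; [exact: D1|exact: D2].
apply: (ae_time3 _ E Dvw Hdw) => t {}E {}Dvw {}Hdw t0 psi Vp.
have [{}Dv {}Dw] := Dvw t0.
have Vt := Vw t t0; have [b Bb {}E] := E t0; have Ld := Hspace_L2v (Hdw t0).
have [Vvt _] := Dv.
have [Lb Eb] := is_DB_weak H Vvt Vt Bb; have Ls := L2v_stokes Dw.
have Lsv := L2v_stokes Dv; have Lp := Vspace_L2v Vp; have Lw := Vspace_L2v Vt.
have Lm := L2vZ nu Ls; have Ln := L2vD Ld Lm.
have P1 := L2vZ mu (L2v_PN n Lw); have Q1 := L2vN P1.
have Q2 : L2v (- (mu *: PN n (w t)) - stokes (v t)) by apply: L2vD => //; exact: L2vN.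
have := eq_inner (L2vD Ln Lb) Q2 Lp E.
rewrite (innerDl Ln Lb Lp) (innerDl Ld Lm Lp) (innerZl _ Ls Lp) (inner_stokes Dw Vp) Eb//.
rewrite (innerBl Q1 Lsv Lp) (innerNl P1 Lp) (innerZl _ (L2v_PN n Lw) Lp).
rewrite (inner_PN n Lw Lp) (inner_stokes Dv Vp).
move: (inner _ _) (dotV _ _) (dotV _ _) (tri _ _ _) (tri _ _ _) (pn _ _ _) => p q r s k l.
lra.
Unshelve. all: by end_near. Qed.

End WeakForms.

(** * Gronwall's lemma and the three energy inequalities *)

Section EnergyDecay.
Context {R : realType}.
Implicit Types (u v w z us vs ws : vfield R) (psi phi f : vfield R) (n : nat)
  (a b c k t s x y p q r cL nu nmin mu vmax K : R).

#[local] Opaque Vnorm norm inner.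

Lemma is_derive_expRM a t : is_derive t 1 (fun s => expR (a * s)) (a * expR (a * t)).
Proof.
have d1 : is_derive t 1 (fun s : R => a * s) a.
  by apply: is_derive_eq; rewrite /GRing.scale /= mulr1.
have d2 := is_derive_expR (a * t).
by have := is_derive1_comp (f := expR) d2 d1; rewrite mulrC.
Qed.

(** The forcing is normalized so that k exp (- b t) solves the equation with equality: exp (a t)
    times the distance to it is nonincreasing. It also covers a = b, where the forcing vanishes. *)
Lemma gronwall_exp (g dg : R -> R) a b k t : 0 <= b -> b <= a -> 0 <= k -> 0 <= g 0 ->
  {within `[0, +oo[, continuous g} -> (forall s, 0 < s -> is_derive s 1 g (dg s)) ->
  (forall s, 0 < s -> dg s + a * g s <= k * (a - b) * expR (- (b * s))) ->
  0 <= t -> g t <= (g 0 + k) * expR (- (b * t)).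
Proof.
move=> b0 ba k0 g0 cg dgP H t0.
pose E c s := expR (c * s); pose G s := E a s * g s - k * E (a - b) s.
have dG s : 0 < s -> is_derive s 1 G
    (E a s * (dg s + a * g s) - k * ((a - b) * E (a - b) s)).
  move=> s0; have d1 := dgP s s0; have d2 := is_derive_expRM a s.
  have d3 := is_derive_expRM (a - b) s.
  have -> : G = (E a * g - k *: E (a - b))%R by apply/funext.
  apply: is_derive_eq; rewrite /GRing.scale /= /E; ring.
have cE c s : {for s, continuous (E c)}.
  apply: differentiable_continuous; apply/derivable1_diffP.
  by have d := is_derive_expRM c s; exact: ex_derive.
have := @ler0_derive1_nincry R G 0 _ _ _ 0 t (lexx 0) t0.
rewrite /G /E !mulr0 !expR0 !mul1r !mulr1 => /(_ _ _ _) Gt.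
have {Gt} : expR (a * t) * g t - k * expR ((a - b) * t) <= g 0 - k.
  apply: Gt.
  - by move=> s; rewrite in_itv/= andbT => s0; have := dG s s0 => d; exact: ex_derive.
  - move=> s; rewrite in_itv/= andbT => s0; have d := dG s s0.
    rewrite derive1E derive_val subr_le0.
    have := ler_wpM2l (expR_ge0 (a * s)) (H s s0); rewrite /E => h; apply: le_trans h _.
    rewrite mulrCA -expRD (_ : a * s + - (b * s) = (a - b) * s); last by ring.
    by rewrite mulrA.
  - apply/subspace_continuousP => s /=; rewrite in_itv/= andbT => s0.
    have /subspace_continuousP /(_ s) cgs := cg.
    apply: cvgB; first apply: cvgM.
    + exact: cvg_within_filter (cE a s).
    + by apply: cgs; rewrite /= in_itv/= andbT.
    + apply: cvgM; first exact: cvg_cst.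
      exact: cvg_within_filter (cE (a - b) s).
move=> h; have h2 := ler_wpM2l (expR_ge0 (- (a * t))) h.
rewrite mulrBr mulrA -expRD addNr expR0 mul1r mulrCA -expRD in h2.
rewrite (_ : - (a * t) + (a - b) * t = - (b * t)) in h2; last by ring.
have e1 : expR (- (a * t)) <= expR (- (b * t)).
  by rewrite ler_expR lerN2 ler_wpM2r.
have := ler_wpM2r g0 e1; have := mulr_ge0 k0 (expR_ge0 (- (a * t))).
lra.
Qed.

(* AM-GM: a x y <= nmin x^2 / 8 + 2 a^2 y^2 / nmin, and y^2 is split into its low and
   high frequency parts p and y^2 - p. *)
Lemma absorption nmin mu a x y p r : 0 < nmin -> 0 <= a -> 0 <= p -> p <= y ^+ 2 ->
  r ^+ 2 * (y ^+ 2 - p) <= x ^+ 2 -> 20 * a ^+ 2 / nmin <= mu ->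
  4 * Num.sqrt 2 * a / nmin <= r -> a * x * y <= 3 / 16 * nmin * x ^+ 2 + mu / 10 * p.
Proof.
move=> n0 a0 p0 py gap hmu hr.
have r2 : 32 * a ^+ 2 / nmin ^+ 2 <= r ^+ 2.
  have -> : 32 * a ^+ 2 / nmin ^+ 2 = (4 * Num.sqrt 2 * a / nmin) ^+ 2.
    rewrite !exprMn sqr_sqrtr// exprVn; ring.
  rewrite ler_pXn2r// nnegrE; last apply: le_trans hr.
    by rewrite !mulr_ge0// ?sqrtr_ge0// invr_ge0 ltW.
  by rewrite !mulr_ge0// ?sqrtr_ge0// invr_ge0 ltW.
(* The low modes cost 2 a^2 p / nmin <= mu p / 10. The high modes cost 2 a^2 (y^2 - p) / nmin <=
   nmin x^2 / 16 since 32 = (4 sqrt 2)^2, and 1/8 + 1/16 = 3/16. *)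
have h1 : 20 * a ^+ 2 <= mu * nmin by rewrite -ler_pdivrMr.
have h2 : 32 * a ^+ 2 <= r ^+ 2 * nmin ^+ 2 by rewrite -ler_pdivrMr// exprn_gt0.
have h3 : 32 * a ^+ 2 * (y ^+ 2 - p) <= nmin ^+ 2 * x ^+ 2.
  apply: (@le_trans _ _ (r ^+ 2 * nmin ^+ 2 * (y ^+ 2 - p))).
    by apply: ler_wpM2r => //; rewrite subr_ge0.
  rewrite mulrAC mulrC; apply: ler_wpM2l => //; exact: sqr_ge0.
have h4 := ler_wpM2r p0 h1.
rewrite -(ler_pM2l n0).
have := sqr_ge0 (nmin * x - 4 * (a * y)).
rewrite sqrrB !exprMn; lra.
Qed.

Lemma amgm_sqrt q x y a b : 0 <= x -> 0 <= y -> q ^+ 2 <= x * y -> 0 <= a -> 0 <= b ->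
  1 <= 4 * a * b -> q <= a * x + b * y.
Proof.
move=> x0 y0 h a0 b0 ab; have [q0|q0] := leP q 0.
  by apply: le_trans q0 _; rewrite addr_ge0 ?mulr_ge0.
rewrite -(@ler_pXn2r _ 2)// ?nnegrE ?addr_ge0 ?mulr_ge0// ?(ltW q0)//.
apply: le_trans h _; have := ler_wpM2r (mulr_ge0 x0 y0) ab.
have := sqr_ge0 (a * x - b * y); rewrite sqrrB sqrrD; lra.
Qed.

Lemma young K nmin x y : 0 < nmin -> K * y * x <= nmin / 16 * x ^+ 2 + 4 * K ^+ 2 / nmin * y ^+ 2.
Proof.
move=> n0; rewrite -(ler_pM2l n0).
have -> : nmin * (nmin / 16 * x ^+ 2 + 4 * K ^+ 2 / nmin * y ^+ 2) =
  nmin ^+ 2 / 16 * x ^+ 2 + 4 * K ^+ 2 * y ^+ 2 by field; rewrite gt_eqF.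
have := sqr_ge0 (nmin * x / 4 - 2 * (K * y)); rewrite sqrrB !exprMn exprVn; lra.
Qed.

(** Testing with [u] removes the nonlinearity: nu ||u||^2 = (f, u) <= |f| ||u||. *)
Lemma small_forcing cL nu f u : ladyzhenskaya cL -> 0 < nu -> Hspace f ->
  norm f <= nu ^+ 2 / (2 * cL) -> Vspace u ->
  (forall psi, Vspace psi -> nu * dotV u psi + tri u u psi = inner f psi) ->
  0 <= cL /\ cL * Vnorm u <= nu / 2.
Proof.
have aux (U N c F : R) : 0 < nu -> 0 <= c -> 0 <= U -> F <= nu ^+ 2 / (2 * c) ->
    nu * U ^+ 2 <= N -> N <= F * U -> c * U <= nu / 2.
  move=> n0; rewrite [in X in X -> _]le_eqVlt => /orP[/eqP<-|c0] U0 h1 h2 h3.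
    by rewrite mul0r divr_ge0 ?ltW.
  move: U0; rewrite le_eqVlt => /orP[/eqP<-|U0]; first by rewrite mulr0 divr_ge0 ?ltW.
  have := le_trans h2 h3; rewrite expr2 mulrA ler_pM2r// => h4.
  have := le_trans h4 h1; rewrite ler_pdivlMr ?mulr_gt0// expr2.
  by rewrite -mulrA ler_pM2l//; lra.
move=> H n0 Hf hf Vu E.
(* For a negative [cL] the bound on |f| would be negative; the case cL = 0 makes the second claim
   trivial. *)
have cL0 : 0 <= cL.
  rewrite leNgt; apply/negP => c0; have := le_trans (norm_ge0 f) hf.
  by rewrite leNgt pmulr_rlt0 ?exprn_gt0// invr_lt0 pmulr_rlt0// c0.
split=> //; have := E u Vu; rewrite (tri_diag0 cL0 H Vu Vu) addr0 -sqr_Vnorm => Eu.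
apply: (aux _ (inner f u) _ (norm f)) => //; first exact: Vnorm_ge0.
  by rewrite Eu.
apply: le_trans (ler_norm _) _; apply: le_trans (inner_CS (Hspace_L2v Hf) (Vspace_L2v Vu)) _.
by apply: ler_wpM2l; [exact: norm_ge0|exact: norm_poincare].
Qed.

(** Since b(u, v - z, v - z) = 0, the middle slot can be moved to the steady state [z], whose norm
    is fixed. *)
Lemma tri_sub_diag cL u w v z : 0 <= cL -> ladyzhenskaya cL -> Vspace u -> Vspace w ->
  Vspace v -> Vspace z -> tri u v (v - z) - tri w z (v - z) = tri (u - w) z (v - z).
Proof.
move=> cL0 H Vu Vw Vv Vz; have Vd := VspaceB Vv Vz.
have := tri_diag0 cL0 H Vu Vd.
rewrite {1}(triBm H Vu Vv Vz Vd) (triBl H Vu Vw Vz Vd).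
by move: (tri _ _ _) (tri _ _ _) (tri _ _ _) => x y t; lra.
Qed.

(** The opposite choice: the first field stays in the middle slot. For the nudged equation it is the
    path, which [V1] controls, whereas no bound on its steady state is assumed. *)
Lemma tri_diag_sub cL u v : 0 <= cL -> ladyzhenskaya cL -> Vspace u -> Vspace v ->
  tri u u (u - v) - tri v v (u - v) = tri (u - v) u (u - v).
Proof.
move=> cL0 H Vu Vv; have Vd := VspaceB Vu Vv.
have := tri_diag0 cL0 H Vv Vd.
rewrite {1}(triBm H Vv Vu Vv Vd) (triBl H Vu Vv Vu Vd).
by move: (tri _ _ _) (tri _ _ _) (tri _ _ _) => x y t; lra.
Qed.

Lemma NSE_energy cL nu f u v : 0 <= cL -> ladyzhenskaya cL -> Vspace u -> Vspace v ->
  (forall psi, Vspace psi -> nu * dotV v psi + tri v v psi = inner f psi) ->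
  cL * Vnorm v <= nu / 2 ->
  2 * (- nu * dotV u (u - v) + (-1 * tri u u (u - v) + inner f (u - v))) <=
  - nu * Vnorm (u - v) ^+ 2.
Proof.
have aux (t1 t2 t3 du dv V U c : R) : t1 - t2 = t3 -> `|t3| <= c * V * U * V ->
    c * U <= nu / 2 -> 0 <= V -> du - dv = V ^+ 2 ->
    2 * (- nu * du + (-1 * t1 + (nu * dv + t2))) <= - nu * V ^+ 2.
  move=> e1 h1 h2 V0 e2; have := le_trans (ler_norm (- t3)) _.
  rewrite normrN => /(_ _ h1) h3; have := ler_wpM2r (sqr_ge0 V) h2.
  rewrite expr2 in e2 *; have -> : t1 = t2 + t3 by lra.
  have -> : du = dv + V * V by lra.
  lra.
move=> cL0 H Vu Vv E hv; have Vd := VspaceB Vu Vv.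
rewrite -(E _ Vd); have e2 := dotVBl Vu Vv Vd; rewrite -sqr_Vnorm in e2.
have p1 := ladyzhenskaya_tri cL0 H Vd Vv Vd.
exact: (aux _ _ _ _ _ _ _ _ (tri_sub_diag cL0 H Vu Vv Vu Vv) p1 hv (Vnorm_ge0 _) (esym e2)).
Qed.

Lemma nudging_absorption cL nmin mu vmax n v z : 0 <= cL -> ladyzhenskaya cL -> 0 < nmin ->
  Vspace v -> Vspace z -> Vnorm v <= vmax -> 20 * cL ^+ 2 * vmax ^+ 2 / nmin <= mu ->
  4 * Num.sqrt 2 * cL * vmax / nmin <= n%:R ->
  - tri z v z <= 3 / 16 * nmin * Vnorm z ^+ 2 + mu / 10 * pn n z z.
Proof.
move=> cL0 H n0 Vv Vz hV hmu hN.
apply: le_trans (ler_norm _) _; rewrite normrN.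
apply: le_trans (ladyzhenskaya_tri_diag cL0 H Vz Vv) _.
apply: (@le_trans _ _ (cL * vmax * Vnorm z * norm z)).
  do 2!(apply: ler_wpM2r; rewrite ?norm_ge0 ?Vnorm_ge0//); exact: ler_wpM2l.
apply: (absorption (r := n%:R)) => //.
- by rewrite mulr_ge0// (le_trans (Vnorm_ge0 v)).
- exact: pn_ge0.
- by apply: pn_le; exact: Vspace_L2v.
- exact: pn_gap.
- by rewrite exprMn mulrA.
- by rewrite mulrA.
Qed.

Lemma nudged_energy cL nu nmin mu vmax n f u us v vs : 0 <= cL -> ladyzhenskaya cL ->
  0 < nmin -> nmin <= nu -> 0 < mu -> Vspace u -> Vspace us -> Vspace v -> Vspace vs ->
  Vnorm v <= vmax -> 20 * cL ^+ 2 * vmax ^+ 2 / nmin <= mu ->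
  4 * Num.sqrt 2 * cL * vmax / nmin <= n%:R ->
  (forall psi, Vspace psi ->
    nu * dotV vs psi + tri vs vs psi + mu * pn n vs psi = inner f psi + mu * pn n us psi) ->
  2 * (- nu * dotV v (v - vs) + (-1 * tri v v (v - vs) +
    (- mu * pn n v (v - vs) + (mu * pn n u (v - vs) + inner f (v - vs))))) <=
  - (13 / 8) * nmin * Vnorm (v - vs) ^+ 2 + 5 / 9 * mu * norm (u - us) ^+ 2.
Proof.
have aux (t1 t2 t3 du dv V pv pvs pu pus fz p q W : R) : t1 - t2 = t3 ->
    - t3 <= 3 / 16 * nmin * V ^+ 2 + mu / 10 * p -> nmin <= nu -> 0 < mu ->
    du - dv = V ^+ 2 -> pv - pvs = p -> pu - pus = q -> 0 <= p -> 0 <= W -> q ^+ 2 <= p * W ->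
    nu * dv + t2 + mu * pvs = fz + mu * pus ->
    2 * (- nu * du + (-1 * t1 + (- mu * pv + (mu * pu + fz)))) <=
    - (13 / 8) * nmin * V ^+ 2 + 5 / 9 * mu * W.
  move=> e1 h1 h2 m0 e2 e3 e4 p0 W0 h3 e5.
  (* After the share mu/10 of the absorption, 9/10 of the nudging is left for [q]; then 4 (9/10)
     (5/18) = 1 fixes the other coefficient. Doubling gives 5/9, and 13/8 = 2 - 2 (3/16). *)
  have {}h3 : q <= 9 / 10 * p + 5 / 18 * W by apply: amgm_sqrt h3 _ _ _ => //; lra.
  have h4 := ler_wpM2r (sqr_ge0 V) h2.
  have h5 := ler_wpM2l (ltW m0) h3.
  have -> : fz = nu * dv + t2 + mu * pvs - mu * pus by lra.
  have -> : t1 = t2 + t3 by lra.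
  have -> : pv = pvs + p by lra.
  have -> : pu = pus + q by lra.
  have -> : du = dv + V ^+ 2 by lra.
  lra.
move=> cL0 H n0 nn m0 Vu Vus Vv Vvs hV hmu hN E; have Vd := VspaceB Vv Vvs.
have Vw := VspaceB Vu Vus.
have L := @Vspace_L2v R.
have e2 := dotVBl Vv Vvs Vd; rewrite -sqr_Vnorm in e2.
have e3 := pnBl n (L v Vv) (L vs Vvs) (L _ Vd).
have e4 := pnBl n (L u Vu) (L us Vus) (L _ Vd).
apply: (aux _ _ _ _ _ _ _ _ _ _ _ _ _ _ (tri_diag_sub cL0 H Vv Vvs) _ nn m0 (esym e2)
  (esym e3) (esym e4) (pn_ge0 n _) (sqr_ge0 (norm (u - us))) _ (E _ Vd)).
  exact: nudging_absorption hmu hN.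
apply: le_trans (pn_CS n (L _ Vw) (L _ Vd)) _; rewrite mulrC.
by apply: ler_wpM2l; [exact: pn_ge0|apply: pn_le; exact: L].
Qed.

(** With d = w - ws and z = v - vs, the nonlinear differences reduce to b(z, ws, d) + b(ws, z, d),
    linear in z with the fixed field [ws] as coefficient, and to b(d, v, d), which the nudging
    absorbs. *)
Lemma sensitivity_energy cL nu nmin mu vmax n v vs w ws : 0 <= cL -> ladyzhenskaya cL ->
  0 < nmin -> nmin <= nu -> 0 < mu -> Vspace v -> Vspace vs -> Vspace w -> Vspace ws ->
  Vnorm v <= vmax -> 20 * cL ^+ 2 * vmax ^+ 2 / nmin <= mu ->
  4 * Num.sqrt 2 * cL * vmax / nmin <= n%:R ->
  (forall psi, Vspace psi ->
    nu * dotV ws psi + mu * pn n ws psi + (tri vs ws psi + tri ws vs psi) = - dotV vs psi) ->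
  2 * (- nu * dotV w (w - ws) + (-1 * tri v w (w - ws) + (-1 * tri w v (w - ws) +
    (- mu * pn n w (w - ws) + (-1 * dotV v (w - ws) + 0))))) <=
  - (3 / 2) * nmin * Vnorm (w - ws) ^+ 2 +
    8 * (2 * (cL * Vnorm ws) + 1) ^+ 2 / nmin * Vnorm (v - vs) ^+ 2.
Proof.
have aux (a1 a2 a3 b1 b2 b3 b4 dw ds dv dvs dz V Z U c p pw ps : R) :
    a1 - a2 = a3 -> b1 - b2 = b3 + b4 -> pw - ps = p -> dw - ds = V ^+ 2 -> dv - dvs = dz ->
    - b3 <= 3 / 16 * nmin * V ^+ 2 + mu / 10 * p ->
    `|a3| <= c * Z * U * V -> `|b4| <= c * U * Z * V -> `|dz| <= Z * V ->
    0 < nmin -> nmin <= nu -> 0 < mu -> 0 <= p ->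
    nu * ds + mu * ps + (a2 + b2) = - dvs ->
    2 * (- nu * dw + (-1 * a1 + (-1 * b1 + (- mu * pw + (-1 * dv + 0))))) <=
    - (3 / 2) * nmin * V ^+ 2 + 8 * (2 * (c * U) + 1) ^+ 2 / nmin * Z ^+ 2.
  move=> e1 e2 e3 e4 e5 h1 + + + n0 nn m0 p0 e6.
  rewrite -normrN => /(le_trans (ler_norm _)) h2.
  rewrite -normrN => /(le_trans (ler_norm _)) h3.
  rewrite -normrN => /(le_trans (ler_norm _)) h4.
  have h5 := ler_wpM2r (sqr_ge0 V) nn; have h6 := mulr_ge0 (ltW m0) p0.
  (* Two trilinear terms of size cL ||ws|| ||z|| ||d|| and the term from A v give the constant 2 cL
     ||ws|| + 1. Young takes nmin / 16, whence 3/2 = 2 (1 - 3/16 - 1/16). *)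
  have := young (2 * (c * U) + 1) V Z n0.
  rewrite (_ : 8 * _ / nmin * Z ^+ 2 = 2 * (4 * (2 * (c * U) + 1) ^+ 2 / nmin * Z ^+ 2)); last by ring.
  move: (4 * _ / nmin * _) => Y h7; rewrite !mulrDl mul1r in h7.
  have -> : dv = dz - (nu * ds + mu * ps + (a2 + b2)) by lra.
  have -> : a1 = a2 + a3 by lra.
  have -> : b1 = b2 + b3 + b4 by lra.
  have -> : pw = ps + p by lra.
  have -> : dw = ds + V ^+ 2 by lra.
  lra.
move=> cL0 H n0 nn m0 Vv Vvs Vw Vws hV hmu hN E; have Vd := VspaceB Vw Vws.
have Vz := VspaceB Vv Vvs; have L := @Vspace_L2v R.
have e4 := dotVBl Vw Vws Vd; rewrite -sqr_Vnorm in e4.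
have e3 := pnBl n (L w Vw) (L ws Vws) (L _ Vd).
have e5 := dotVBl Vv Vvs Vd.
have e2 : tri w v (w - ws) - tri ws vs (w - ws) =
    tri (w - ws) v (w - ws) + tri ws (v - vs) (w - ws).
  by rewrite (triBl H Vw Vws Vv Vd) (triBm H Vws Vv Vvs Vd) subrKA.
have p1 := ladyzhenskaya_tri cL0 H Vz Vws Vd.
have p2 := ladyzhenskaya_tri cL0 H Vws Vz Vd.
apply: (aux _ _ _ _ _ _ _ _ _ _ _ _ _ _ _ _ _ _ _ (tri_sub_diag cL0 H Vv Vvs Vw Vws) e2
  (esym e3) (esym e4) (esym e5) _ p1 p2 _ n0 nn m0 _ (E _ Vd)).
- exact: nudging_absorption hmu hN.
- exact: dotV_CS.
- exact: pn_ge0.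
Qed.

End EnergyDecay.

(** * The coupled decay of the three energies *)

Section Cascade.
Context {R : realType}.

(** [z] and [h] stand for the squared V norms. [H] is driven by [z], for which there is no
    differential inequality, so decay of [Z] would not suffice: the dissipation of [Z] has to pay
    for the forcing of [H], and [Zz] is used only afterwards. *)
Lemma cascade_decay (nmin A B : R) (W Z H dW dZ dH z h : R -> R) :
  0 < nmin -> 0 <= A -> 0 <= B ->
  (forall s : R, 0 <= W s) -> (forall s : R, 0 <= Z s) -> (forall s : R, 0 <= H s) ->
  {within `[0, +oo[, continuous W} -> {within `[0, +oo[, continuous Z} ->
  {within `[0, +oo[, continuous H} ->
  (forall s : R, 0 < s -> is_derive s 1 W (dW s)) ->
  (forall s : R, 0 < s -> is_derive s 1 Z (dZ s)) ->
  (forall s : R, 0 < s -> is_derive s 1 H (dH s)) ->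
  (forall s : R, 0 < s -> dW s <= - nmin * W s) ->
  (forall s : R, 0 < s -> dZ s <= - (13 / 8) * nmin * z s + A * W s) ->
  (forall s : R, 0 < s -> dH s <= - (3 / 2) * nmin * h s + B * z s) ->
  (forall s : R, 0 < s -> Z s <= z s) -> (forall s : R, 0 < s -> H s <= h s) ->
  exists C, forall t : R, 0 <= t -> H t <= C * expR (- (nmin * t)).
Proof.
move=> n0 A0 B0 W0 Z0 H0 cW cZ cH DW DZ DH eW eZ eH Zz Hh.
have decW t : 0 <= t -> W t <= W 0 * expR (- (nmin * t)).
  move=> t0; have := gronwall_exp (ltW n0) (lexx nmin) (lexx 0) (W0 0) cW DW _ t0.
  by rewrite addr0; apply=> s /eW; rewrite !mul0r; lra.
(* The surplus 13/8 - 3/2 = 1/8 of the dissipation of M Z then equals B z exactly. *)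
have [M M0 eM] : exists2 M : R, 0 <= M & M * nmin = 8 * B.
  by exists (8 * B / nmin); rewrite ?divfK ?gt_eqF// divr_ge0 ?mulr_ge0// ltW.
(* Matches the remaining forcing M A W(0) exp (- nmin t) with the form required by [gronwall_exp]
   for the rates 3/2 nmin and nmin. *)
have [k k0 ek] : exists2 k : R, 0 <= k & k * (3 / 2 * nmin - nmin) = M * A * W 0.
  exists (2 * (M * A * W 0) / nmin); last by field; rewrite gt_eqF.
  by rewrite divr_ge0 ?(ltW n0)// mulr_ge0// mulr_ge0// mulr_ge0.
pose E s := H s + M * Z s.
have E0 : 0 <= E 0 by apply: addr_ge0 => //; exact: mulr_ge0.
have cE : {within `[0, +oo[, continuous E}.
  move=> x; apply: cvgD; first exact: cH.
  by apply: cvgM; [exact: cvg_cst|exact: cZ].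
have DE (s : R) : 0 < s -> is_derive s 1 E (dH s + M * dZ s).
  move=> s0; have d1 := DH s s0; have d2 := DZ s s0.
  have -> : E = (H + M *: Z)%R by apply/funext.
  exact: (is_deriveD d1 (is_deriveZ M d2)).
exists (E 0 + k) => t t0; apply: (@le_trans _ _ (E t)).
  by rewrite lerDl mulr_ge0.
apply: (gronwall_exp (ltW n0) (_ : nmin <= 3 / 2 * nmin) k0 E0 cE DE _ t0); first lra.
move=> s s0; have h1 := eZ s s0; have h2 := eH s s0; have h3 := Zz s s0; have h4 := Hh s s0.
have h5 := decW s (ltW s0).
have h6 := ler_wpM2l M0 h1; have h7 := ler_wpM2l (mulr_ge0 M0 A0) h5.
have h8 := ler_wpM2l (mulr_ge0 M0 (ltW n0)) h3; have h9 := ler_wpM2l (ltW n0) h4.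
rewrite ek /E; move: (expR _) h5 h7 => e h5 h7; rewrite eM in h8.
have h10 : M * (- (13 / 8) * nmin * z s + A * W s) =
    - (13 / 8) * (8 * B * z s) + M * A * W s by rewrite -eM; ring.
rewrite h10 in h6; have h11 : 3 / 2 * nmin * (H s + M * Z s) =
    3 / 2 * (nmin * H s) + 3 / 2 * (8 * B * Z s) by rewrite -eM; ring.
rewrite h11; clear -h2 h6 h7 h8 h9; lra.
Qed.

End Cascade.

(** * Exponential convergence of the sensitivity to its steady state *)

Theorem proposition4p3 (R : realType) (cL nu0 rho nu nuh mu V1 : R) (N : nat)
    (f u0 v0 us vs vhs : vfield R) (u v vh : R -> vfield R)
    (hcL : ladyzhenskaya cL)
    (hnu0 : 0 < nu0) (hrho : 0 < rho)
    (hnu : nu \in `[nu0, (1 + rho) * nu0])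
    (hnuh : nuh \in `[nu0, (1 + rho) * nu0])
    (hmu : 0 < mu)
    (hf : Hspace f) (hfsmall : norm f <= nu ^+ 2 / (2 * cL))
    (hus : steady_NSE nu f us)
    (hu0 : Vspace u0) (hu : NSE_solution nu f u0 u)
    (hv0 : Vspace v0) (hv : nudged_solution nuh mu N f u v0 v)
    (hV1 : ereal_sup [set (Vnorm (v t))%:E | t in `[0, +oo[] = V1%:E)
    (hmuV1 : 20 * cL ^+ 2 * V1 ^+ 2 / nu0 <= mu)
    (hNV1 : 4 * Num.sqrt 2 * cL * V1 / nu0 <= N%:R)
    (hvs : steady_nudged nuh mu N f us vs)
    (hvh : sensitivity_solution nuh mu N v vh)
    (hvhs : steady_sensitivity nuh mu N vs vhs) :
  exists C : R, forall t : R, 0 <= t ->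
    norm (vh t - vhs) ^+ 2 <= C * expR (- (nu0 * t)).
Proof.
have sqr_le (x y : R) : 0 <= x -> x <= y -> x ^+ 2 <= y ^+ 2.
  by move=> x0 xy; rewrite ler_pXn2r// nnegrE// (le_trans x0).
have nnu : nu0 <= nu by move: hnu; rewrite in_itv/= => /andP[].
have nnuh : nu0 <= nuh by move: hnuh; rewrite in_itv/= => /andP[].
have nu_gt0 := lt_le_trans hnu0 nnu.
have [Vus Eus] := steady_NSE_weak hcL hf hus.
have [cL0 small] := small_forcing hcL nu_gt0 hf hfsmall Vus Eus.
have evu := NSE_evolves cL0 hcL hf hu; have [pu _ _] := evu; have [Vu _] := pu.
have evv := nudged_evolves cL0 hcL hf pu hv; have [pv _ _] := evv; have [Vv _] := pv.
have Dv : {ae @lebesgue_measure R, forall t, 0 <= t -> DA (v t)}.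
  by case: hv => dv [[_ _ [Dv _] _ _] _ _].
have evh := sensitivity_evolves cL0 hcL pv Dv hvh; have [ph _ _] := evh; have [Vh _] := ph.
have [Vvs Evs] := steady_nudged_weak hcL hf Vus hvs.
have [Dvs _] := hvs.
have [Vvhs Evhs] := steady_sensitivity_weak hcL Dvs hvhs.
have vV1 t : 0 <= t -> Vnorm (v t) <= V1.
  move=> t0; rewrite -lee_fin -hV1; apply: ereal_sup_ubound; exists t => //.
  by rewrite /= in_itv/= andbT.
have A0 : 0 <= 5 / 9 * mu by rewrite mulr_ge0// ltW.
have B0 : 0 <= 8 * (2 * (cL * Vnorm vhs) + 1) ^+ 2 / nu0.
  by rewrite divr_ge0 ?(ltW hnu0)// mulr_ge0// sqr_ge0.
apply: (cascade_decay hnu0 A0 B0 (fun s => sqr_ge0 (norm (u s - us)))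
  (fun s => sqr_ge0 (norm (v s - vs))) (fun s => sqr_ge0 (norm (vh s - vhs)))
  (sqr_norm_within pu Vus) (sqr_norm_within pv Vvs) (sqr_norm_within ph Vvhs)
  (fun s => sqr_norm_is_derive evu Vus) (fun s => sqr_norm_is_derive evv Vvs)
  (fun s => sqr_norm_is_derive evh Vvhs)
  (z := fun s => Vnorm (v s - vs) ^+ 2) (h := fun s => Vnorm (vh s - vhs) ^+ 2)).
- move=> s /ltW s0; have Vd := VspaceB (Vu s s0) Vus.
  apply: le_trans (NSE_energy cL0 hcL (Vu s s0) Vus Eus small) _.
  (* Poincare's inequality replaces ||w|| by |w|, and the rate drops from [nu] to [nu0], common to
     the three energies. *)
  rewrite !mulNr lerN2; apply: ler_pM; [exact: ltW|exact: sqr_ge0|exact: nnu|].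
  by apply: sqr_le; [exact: norm_ge0|exact: norm_poincare].
- move=> s /ltW s0.
  exact: (nudged_energy cL0 hcL hnu0 nnuh hmu (Vu s s0) Vus (Vv s s0) Vvs (vV1 s s0)
    hmuV1 hNV1 Evs).
- move=> s /ltW s0.
  exact: (sensitivity_energy cL0 hcL hnu0 nnuh hmu (Vv s s0) Vvs (Vh s s0) Vvhs (vV1 s s0)
    hmuV1 hNV1 Evhs).
- move=> s /ltW s0; apply: sqr_le; first exact: norm_ge0.
  by apply: norm_poincare; exact: VspaceB (Vv s s0) Vvs.
- move=> s /ltW s0; apply: sqr_le; first exact: norm_ge0.
  by apply: norm_poincare; exact: VspaceB (Vh s s0) Vvhs.
Qed.
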